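(* Let $N\ge 1$ be an integer and let $z$ be a complex number with $\Re(z)>0$; put $\theta=\arg z\in(-\frac{\pi}{2},\frac{\pi}{2})$. Then both $|R_N(z)|$ and $|\widetilde R_N(z)|$ are at most \[ \left(\frac{|\gamma_N|}{|z|^N}+\frac{|\gamma_{N+1}|}{|z|^{N+1}}\right)\cdot \begin{cases} |\csc(2\theta)| & \text{if } \frac{\pi}{4}<|\theta|<\frac{\pi}{2},\\ 1 & \text{if } |\theta|\le\frac{\pi}{4}.\end{cases} \]
   Context: The scaled gamma function is $\Gamma^\ast(z) = \dfrac{\Gamma(z)}{\sqrt{2\pi}\, z^{z-\frac12} e^{-z}}$ for $|\arg z|<\pi$ (principal branch of the power). The Stirling coefficients $\gamma_n$ ($n\ge 0$) are the real numbers in the asymptotic expansion $\Gamma^\ast(z)\sim\sum_{n\ge 0}(-1)^n\gamma_n z^{-n}$ as $z\to\infty$ in $|\arg z|\le\pi-\delta$; equivalently, they are given by the formal power series identity \[ \exp\left(\sum_{n=1}^\infty \frac{B_{2n}}{2n(2n-1)}x^{2n-1}\right)=\sum_{n=0}^\infty(-1)^n\gamma_n x^n, \] where $B_{k}$ are the Bernoulli numbers. Thus $\gamma_0=1$, $\gamma_1=-\frac1{12}$, $\gamma_2=\frac1{288}$, $\gamma_3=\frac{139}{51840}$. One also has $1/\Gamma^\ast(z)\sim\sum_{n\ge0}\gamma_n z^{-n}$. For every integer $N\ge 1$ the remainders $R_N(z)$, $\widetilde R_N(z)$ are defined by \[ \Gamma^\ast(z)=\sum_{n=0}^{N-1}(-1)^n\frac{\gamma_n}{z^n}+R_N(z),\qquad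 \frac1{\Gamma^\ast(z)}=\sum_{n=0}^{N-1}\frac{\gamma_n}{z^n}+\widetilde R_N(z). \] *)

(* Defs.v *)
From mathcomp Require Export all_boot all_order all_algebra.
From mathcomp Require Export all_classical all_reals all_analysis.
From mathcomp Require Export complex.

Set Implicit Arguments.
Unset Strict Implicit.
Unset Printing Implicit Defensive.

Import Order.TTheory GRing.Theory Num.Theory.
Import numFieldNormedType.Exports.
Import ComplexField.Normc.

Local Open Scope ring_scope.
Local Open Scope complex_scope.

Section ComplexFunctions.
Variable R : realType.
Implicit Types z w : R[i].

Definition cexp z : R[i] :=
  (expR (complex.Re z))%:C * (cos (complex.Im z) +i* sin (complex.Im z)).

(* Principal argument, in ]-pi, pi] for z != 0. *)
Definition carg z : R :=
  let a := acos (complex.Re z / normc z) in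
  if 0 <= complex.Im z then a else - a.

Definition clog z : R[i] := ln (normc z) +i* carg z.

Definition cpow z w : R[i] := cexp (w * clog z).

Definition cintegral (D : set R) (f : R -> R[i]) : R[i] :=
  (\int[lebesgue_measure]_(t in D) complex.Re (f t))%R +i*
  (\int[lebesgue_measure]_(t in D) complex.Im (f t))%R.

(* Euler's integral of the second kind. It converges, and hence is the Gamma
   function, exactly for Re z > 0; no analytic continuation is performed. *)
Definition cGamma z : R[i] :=
  cintegral `]0, +oo[%classic
    (fun t : R => cpow t%:C (z - 1) * cexp (- t%:C)).

Definition scaled_gamma z : R[i] :=
  cGamma z / ((Num.sqrt (2 * pi))%:C * cpow z (z - 2^-1) * cexp (- z)).

End ComplexFunctions.

Section StirlingCoefficients.
Variable R : realType.

(* [:: B_0; ...; B_n], from x = (e^x - 1) \sum_k B_k x^k / k!, that is,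
   B_0 = 1 and \sum_(k <= m) 'C(m + 1, k) B_k = 0 for m >= 1. *)
Fixpoint bernoulli_seq (n : nat) : seq R :=
  if n is m.+1 then
    let s := bernoulli_seq m in
    rcons s (- ((m.+2%:R)^-1 * \sum_(k < m.+1) 'C(m.+2, k)%:R * s`_k))
  else [:: 1].

Definition bernoulli (n : nat) : R := (bernoulli_seq n)`_n.

(* \sum_(j >= 1) B_(2j) / (2j (2j - 1)) x^(2j - 1), up to the power x^(2n-1). *)
Definition stirling_exponent (n : nat) : {poly R} :=
  \sum_(1 <= j < n.+1)
    (bernoulli j.*2 / (j.*2 * j.*2.-1)%N%:R) *: 'X^(j.*2.-1).

(* (-1)^n gamma_n is the coefficient of x^n in the formal power series
   exp S = \sum_k S^k / k!, S being the full exponent. Since S has no constant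
   term, the powers S^k with k > n and the terms of S of degree > n do not
   contribute to that coefficient, so it may be read off a polynomial. *)
Definition stirling_coef (n : nat) : R :=
  (-1) ^+ n * (\sum_(k < n.+1) (k`!%:R)^-1 *: stirling_exponent n ^+ k)`_n.

End StirlingCoefficients.

Section Remainders.
Variable R : realType.
Implicit Types z : R[i].

Definition gamma_rem (N : nat) z : R[i] :=
  scaled_gamma z - \sum_(n < N) (-1) ^+ n * (stirling_coef R n)%:C / z ^+ n.

Definition inv_gamma_rem (N : nat) z : R[i] :=
  (scaled_gamma z)^-1 - \sum_(n < N) (stirling_coef R n)%:C / z ^+ n.

End Remainders.

(* Main.v *)
Require Import Defs.
From mathcomp Require Import ring lra zify measurable_realfun.

Import Order.TTheory GRing.Theory Num.Theory.
Import numFieldNormedType.Exports.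
Import ComplexField.Normc.

Set Implicit Arguments.
Unset Strict Implicit.
Unset Printing Implicit Defensive.

Local Open Scope ring_scope.
Local Open Scope complex_scope.

Local Notation Re := complex.Re.
Local Notation Im := complex.Im.
Local Notation mu := lebesgue_measure.

(** Binet's formula gives [scaled_gamma z = exp (L z)], where [L] is the Laplace
    transform of [b(t) = (1/(e^t - 1) - 1/t + 1/2)/t = \sum_k 2/(t^2 + 4 pi^2 k^2)].
    Cut the sum at [k <= K]; then [L] extends continuously to the imaginary axis.
    On the right half-plane [sinh L] and [cosh L - 1] are Poisson integrals of
    their boundary values, which are governed by
    [Re L(is) = \sum_k e^(-2 pi k |s|)/(2k) >= 0] and, since [b] decreases and
    [b(t) <= 1/(2t)], by [-pi/2 <= Im L(is) <= 0] for [s > 0]. Hence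
    [sinh L(z) = (1/pi) \int A(s) z/(z^2 + s^2) ds] and
    [cosh L(z) - 1 = (1/pi) \int B(s)/(z^2 + s^2) ds] with [A, B >= 0] of
    exponential decay. Expanding [1/(z^2 + s^2)] geometrically, the remainder of
    each series is at most its first omitted term times
    [max_s |z^2/(z^2 + s^2)|], which is [1] or [|csc 2 theta|]. As
    [exp (+-L) = 1 + (cosh L - 1) +- sinh L], the two first omitted terms are the
    N-th and the (N+1)-st terms of the expansion of [exp (+-L)]. Its coefficients
    are identified by uniqueness of asymptotic expansions, and [K] tends to
    infinity. *)

(** The cut at [K] is forced: the full [b] decays only like [1 / (2 t)], so it is not integrable and
    its transform is unbounded at 0. The truncated kernel is integrable, hence [exp (+-L)] stays
    bounded up to the axis. The Poisson representation uses no contour integration: it is computed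
    from primitives for the resolvents [1 / (x + w) ^ n], passes to [exp (- T w)] as a limit of
    these, by Fubini to products with Laplace transforms, and to [exp L] as the limit of
    [(1 + L / n) ^ n]. The split into hyperbolic functions isolates the factor [sinh (Re L(is))],
    which carries the exponential decay, whereas [exp (+-L(is))] tends to 1 and has no moments. For
    the even part the function represented is [w (cosh L(w) - 1)]: the factor [w] gives the density
    [- s sinh (Re L(is)) sin (Im L(is))] its sign. As Gamma is given by Euler's integral, Binet's
    formula has to be proved: the difference equation of [L] and Euler's limit determine Gamma up to
    a constant, which duplication and Gamma(3/2) fix. *)

Section ComplexBasics.
Variable R : realType.
Implicit Types (z w : R[i]) (x y : R).

Lemma ReM z w : Re (z * w) = Re z * Re w - Im z * Im w.
Proof. by case: z; case: w. Qed.

Lemma ImM z w : Im (z * w) = Re z * Im w + Im z * Re w.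
Proof. by case: z; case: w. Qed.

Lemma ReD z w : Re (z + w) = Re z + Re w.
Proof. by case: z; case: w. Qed.

Lemma ImD z w : Im (z + w) = Im z + Im w.
Proof. by case: z; case: w. Qed.

Lemma ReN z : Re (- z) = - Re z.
Proof. by case: z. Qed.

Lemma ImN z : Im (- z) = - Im z.
Proof. by case: z. Qed.

Lemma ReB z w : Re (z - w) = Re z - Re w.
Proof. by rewrite ReD ReN. Qed.

Lemma ImB z w : Im (z - w) = Im z - Im w.
Proof. by rewrite ImD ImN. Qed.

Lemma ReC x : Re x%:C = x. Proof. by []. Qed.

Lemma ImC x : Im x%:C = 0. Proof. by []. Qed.

Lemma Re0 : Re (0 : R[i]) = 0. Proof. by []. Qed.
Lemma Im0 : Im (0 : R[i]) = 0. Proof. by []. Qed.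
Lemma Re1 : Re (1 : R[i]) = 1. Proof. by []. Qed.
Lemma Im1 : Im (1 : R[i]) = 0. Proof. by []. Qed.

Lemma Re_nat n : Re (n%:R : R[i]) = n%:R.
Proof. by rewrite -(rmorph_nat (real_complex R)) ReC. Qed.

Lemma Im_nat n : Im (n%:R : R[i]) = 0.
Proof. by rewrite -(rmorph_nat (real_complex R)) ImC. Qed.

Lemma ReZl x z : Re (x%:C * z) = x * Re z.
Proof. by rewrite ReM ReC ImC mul0r subr0. Qed.

Lemma ImZl x z : Im (x%:C * z) = x * Im z.
Proof. by rewrite ImM ReC ImC mul0r addr0. Qed.

Lemma ReZr x z : Re (z * x%:C) = Re z * x.
Proof. by rewrite mulrC ReZl mulrC. Qed.

Lemma ImZr x z : Im (z * x%:C) = Im z * x.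
Proof. by rewrite mulrC ImZl mulrC. Qed.

Lemma Re_sum n (F : nat -> R[i]) : Re (\sum_(k < n) F k) = \sum_(k < n) Re (F k).
Proof. by elim/big_rec2: _ => // i a b _ <-; rewrite ReD. Qed.

Lemma eqC z w : Re z = Re w -> Im z = Im w -> z = w.
Proof. by case: z => a b; case: w => c d /= -> ->. Qed.

Lemma Rei : Re ('i : R[i]) = (0 : R). Proof. by []. Qed.
Lemma Imi : Im ('i : R[i]) = (1 : R). Proof. by []. Qed.

Definition cE := (Rei, Imi, ReZl, ImZl, ReZr, ImZr, ReM, ImM, ReD, ImD, ReN, ImN, ReC, ImC,
  Re0, Im0, Re1, Im1, Re_nat, Im_nat).

Lemma CE z : z = (Re z)%:C + 'i * (Im z)%:C.
Proof. by apply: eqC; rewrite !cE; ring. Qed.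

Lemma ii : 'i * 'i = -1 :> R[i].
Proof. by rewrite -expr2 sqr_i. Qed.

Lemma normcE2 z : normc z ^+ 2 = Re z ^+ 2 + Im z ^+ 2.
Proof. by case: z => a b /=; rewrite sqr_sqrtr // addr_ge0 ?sqr_ge0. Qed.

Lemma normc_ge0 z : 0 <= normc z.
Proof. by case: z => a b /=; exact: sqrtr_ge0. Qed.

Lemma normcR x : normc x%:C = `|x|.
Proof. by rewrite /= expr0n addr0 sqrtr_sqr. Qed.

Lemma normcX z n : normc (z ^+ n) = normc z ^+ n.
Proof. by elim: n => [|n IH]; rewrite ?expr0 ?normc1 // !exprS normcM IH. Qed.

Lemma normc_div z w : normc (z / w) = normc z / normc w.
Proof. by rewrite normcM normcV. Qed.

Lemma normc_eq0 z : (normc z == 0) = (z == 0).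
Proof.
by apply/eqP/eqP => [/eq0_normc //|->]; rewrite normc0.
Qed.

Lemma normc_gt0 z : z != 0 -> 0 < normc z.
Proof. by move=> z0; rewrite lt_def normc_eq0 z0 normc_ge0. Qed.

Lemma normcD_le z w a b : normc z <= a -> normc w <= b -> normc (z + w) <= a + b.
Proof. by move=> ? ?; apply: (le_trans (le_normcD _ _)); exact: lerD. Qed.

Lemma normcM_le z w a b : normc z <= a -> normc w <= b -> normc (z * w) <= a * b.
Proof. by move=> ? ?; rewrite normcM; apply: ler_pM; rewrite ?normc_ge0. Qed.

Lemma normc_distC z w : normc (z - w) = normc (w - z).
Proof. by rewrite -normcN opprB. Qed.

Lemma normc_sub_le z w : normc z - normc w <= normc (z - w).
Proof. by rewrite lerBlDr -{1}(subrK w z) le_normcD. Qed.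

Lemma normc_sum n (F : 'I_n -> R[i]) : normc (\sum_(k < n) F k) <= \sum_(k < n) normc (F k).
Proof. by elim/big_rec2: _ => [|i a b _ le]; [rewrite normc0|apply: normcD_le]. Qed.

Lemma Re_le_normc z : `|Re z| <= normc z.
Proof.
rewrite -(ler_pXn2r (_ : (0 < 2)%N)) ?nnegrE ?normc_ge0 //.
by rewrite real_normK ?num_real // normcE2 lerDl sqr_ge0.
Qed.

Lemma Im_le_normc z : `|Im z| <= normc z.
Proof.
rewrite -(ler_pXn2r (_ : (0 < 2)%N)) ?nnegrE ?normc_ge0 //.
by rewrite real_normK ?num_real // normcE2 lerDr sqr_ge0.
Qed.

Lemma Re_le_normc' z : Re z <= normc z.
Proof. exact: le_trans (ler_norm _) (Re_le_normc z). Qed.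

Lemma normc_i : normc ('i : R[i]) = 1.
Proof. by rewrite /= expr0n expr1n add0r sqrtr1. Qed.

Lemma normc_le_ReIm z : normc z <= `|Re z| + `|Im z|.
Proof.
rewrite {1}[z]CE; apply: (le_trans (le_normcD _ _)).
by rewrite normcM normc_i mul1r !normcR.
Qed.

Lemma normcP z : z * (Re z -i* Im z) = (normc z ^+ 2)%:C.
Proof.
by rewrite normcE2; apply: eqC; rewrite ?ReM ?ImM /=; ring.
Qed.

Lemma normc_conj z : normc (conjc z) = normc z.
Proof. by case: z => a b /=; rewrite sqrrN. Qed.

Lemma Re_conj z : Re (conjc z) = Re z. Proof. by case: z. Qed.
Lemma Im_conj z : Im (conjc z) = - Im z. Proof. by case: z. Qed.

Lemma neq0_Re z : 0 < Re z -> z != 0.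
Proof. by move=> h; apply/eqP => z0; move: h; rewrite z0 ltxx. Qed.

Lemma ReV z : Re z^-1 = Re z / normc z ^+ 2.
Proof. by rewrite normcE2; case: z. Qed.

Lemma ImV z : Im z^-1 = - Im z / normc z ^+ 2.
Proof. by rewrite normcE2; case: z => a b /=; rewrite mulNr. Qed.

(** Serves [cint_norm_le]: after a rotation the modulus of an integral is the real part of an
    integral, to which monotonicity of real integrals applies. *)
Lemma normc_rot z : exists2 u : R[i], normc u = 1 & u * z = (normc z)%:C.
Proof.
have [->|z0] := eqVneq z 0; first by exists 1; rewrite ?normc1 // normc0 mulr0.
have n0 := normc_gt0 z0.
exists ((normc z)%:C / z).
  by rewrite normcM normcV normcR ger0_norm ?normc_ge0 // divff // gt_eqF.
by rewrite mulfVK.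
Qed.

Lemma cexpD z w : cexp (z + w) = cexp z * cexp w.
Proof.
by apply: eqC; rewrite /cexp !cE /= expRD ?cosD ?sinD; ring.
Qed.

Lemma Re_cexp z : Re (cexp z) = expR (Re z) * cos (Im z).
Proof. by rewrite /cexp ReM /= mul0r subr0. Qed.

Lemma Im_cexp z : Im (cexp z) = expR (Re z) * sin (Im z).
Proof. by rewrite /cexp ImM /= mul0r addr0. Qed.

Lemma cexpR x : cexp x%:C = (expR x)%:C.
Proof. by apply: eqC; rewrite ?Re_cexp ?Im_cexp /= ?cos0 ?sin0 ?mulr1 ?mulr0. Qed.

Lemma cexp0 : cexp (0 : R[i]) = 1.
Proof. by rewrite (_ : 0 = 0%:C) // cexpR expR0. Qed.

Lemma normc_cexp z : normc (cexp z) = expR (Re z).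
Proof.
rewrite /cexp normcM normcR ger0_norm ?expR_ge0 //=.
by rewrite cos2Dsin2 sqrtr1 mulr1.
Qed.

Lemma cexp_neq0 z : cexp z != 0.
Proof. by rewrite -normc_eq0 normc_cexp expR_eq0. Qed.

Lemma cexpN z : cexp (- z) = (cexp z)^-1.
Proof.
apply: (mulIf (cexp_neq0 z)); rewrite mulVf ?cexp_neq0 //.
by rewrite -cexpD addNr cexp0.
Qed.

Lemma cexpMn z n : cexp (n%:R * z) = cexp z ^+ n.
Proof.
elim: n => [|n IH]; first by rewrite mul0r cexp0 expr0.
by rewrite -natr1 mulrDl mul1r cexpD IH exprSr.
Qed.

Lemma cexp_conj z : cexp (conjc z) = conjc (cexp z).
Proof.
by apply: eqC; rewrite ?Re_conj ?Im_conj ?Re_cexp ?Im_cexp ?Re_conj ?Im_conj ?cosN ?sinN ?mulrN.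
Qed.

Lemma conj_C x : conjc x%:C = x%:C. Proof. by rewrite /= oppr0. Qed.

End ComplexBasics.

(** * Quantitative Taylor bounds and the limit of [(1 + w / n) ^ n] *)

Section ElementaryBounds.
Variable R : realType.
Implicit Types (z w : R[i]) (x y : R).

(** From [1 - x <= expR (- x)] one gets [expR x <= 1 / (1 - x)], and the excess [x ^+ 2 / (1 - x)]
    over [1 + x] is at most [2 * x ^+ 2] on this range. *)
Lemma expR_taylor1 x : `|x| <= 2^-1 -> `|expR x - 1 - x| <= 2 * x ^+ 2.
Proof.
move=> hx; have h1 := expR_ge1Dx x; have h2 := expR_ge1Dx (- x).
have [a1 a2] : - 2^-1 <= x /\ x <= 2^-1 by apply/andP; rewrite -ler_norml.
rewrite ger0_norm; last lra.
have p : 0 < expR (- x) by exact: expR_gt0.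
have e1 : expR x * expR (- x) = 1 by exact: expRxMexpNx_1.
have : expR x * (1 - x) <= 1 by rewrite -[leRHS]e1 ler_wpM2l ?expR_ge0.
move: (expR x) h1 => e h1 h; nra.
Qed.

Lemma sin_le_abs x : `|sin x| <= `|x|.
Proof.
wlog x0 : x / 0 <= x.
  move=> H; have [|/ltW xn] := leP 0 x; first exact: H.
  by rewrite -normrN -sinN -(normrN x); apply: H; rewrite oppr_ge0.
have [->|xn] := eqVneq x 0; first by rewrite sin0 normr0.
have xp : 0 < x by rewrite lt_def xn.
have [c _] := MVT xp (fun y _ => is_derive_sin y) (continuous_subspaceT (@continuous_sin R)).
rewrite sin0 !subr0 => ->; rewrite normrM ler_piMl //; exact: cos_max.
Qed.

Lemma cos_sub1_le x : `|cos x - 1| <= x ^+ 2.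
Proof.
wlog x0 : x / 0 <= x.
  move=> H; have [|/ltW xn] := leP 0 x; first exact: H.
  by rewrite -cosN -sqrrN; apply: H; rewrite oppr_ge0.
have [->|xn] := eqVneq x 0; first by rewrite cos0 subrr normr0 expr0n.
have xp : 0 < x by rewrite lt_def xn.
have [c] := MVT xp (fun y _ => is_derive_cos y) (continuous_subspaceT (@continuous_cos R)).
rewrite in_itv /= => /andP[c0 cx].
rewrite cos0 !subr0 => ->; rewrite normrM normrN expr2.
apply: ler_pM => //; rewrite ?(ger0_norm x0) //.
by apply: (le_trans (sin_le_abs _)); rewrite ger0_norm ltW.
Qed.

Lemma cos_sub1_abs x : `|cos x - 1| <= `|x|.
Proof.
wlog x0 : x / 0 <= x.
  move=> H; have [|/ltW xn] := leP 0 x; first exact: H.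
  by rewrite -cosN -(normrN x); apply: H; rewrite oppr_ge0.
have [->|xn] := eqVneq x 0; first by rewrite cos0 subrr normr0.
have xp : 0 < x by rewrite lt_def xn.
have [c] := MVT xp (fun y _ => is_derive_cos y) (continuous_subspaceT (@continuous_cos R)).
rewrite in_itv /= => /andP[c0 cx].
rewrite cos0 !subr0 => ->; rewrite normrM normrN ler_piMl //; exact: sin_max.
Qed.

Lemma sin_sub_le x : `|sin x - x| <= x ^+ 2.
Proof.
wlog x0 : x / 0 <= x.
  move=> H; have [|/ltW xn] := leP 0 x; first exact: H.
  by have := H (- x); rewrite sinN -opprD normrN sqrrN; apply; rewrite oppr_ge0.
have [->|xn] := eqVneq x 0; first by rewrite sin0 subrr normr0 expr0n.
have xp : 0 < x by rewrite lt_def xn.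
have [c] := MVT xp (fun y _ => is_derive_sin y) (continuous_subspaceT (@continuous_sin R)).
rewrite in_itv /= => /andP[c0 cx].
rewrite sin0 !subr0 => ->; rewrite -{2}(mul1r x) -mulrBl normrM expr2.
rewrite (ger0_norm x0) ler_wpM2r //.
by apply: (le_trans (cos_sub1_abs _)); rewrite ger0_norm ltW.
Qed.

(** Each part is split into one-variable remainders times bounded factors; the sum of the resulting
    quadratic bounds leaves room in the constant 6. *)
Lemma cexp_taylor1 w : normc w <= 2^-1 -> normc (cexp w - 1 - w) <= 6 * normc w ^+ 2.
Proof.
move=> hw; apply: (le_trans (normc_le_ReIm _)).
rewrite normcE2 !(ReB, ImB) Re_cexp Im_cexp Re1 Im1.
have ha := le_trans (Re_le_normc w) hw; have hb := le_trans (Im_le_normc w) hw.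
move: (Re w) (Im w) ha hb => a b ha hb.
have e1 := expR_taylor1 ha; have c1 := cos_sub1_le b; have s1 := sin_sub_le b.
have s0 := sin_le_abs b.
have e2 : `|expR a - 1| <= 2 * `|a|.
  rewrite -[expR a - 1](subrK a); apply: (le_trans (ler_normD _ _)).
  move: e1; rewrite -(real_normK (num_real a)); have := normr_ge0 a.
  rewrite expr2; nra.
have R1 : `|expR a * cos b - 1 - a| <= 2 * a ^+ 2 + 2 * b ^+ 2.
  rewrite (_ : _ - a = (expR a - 1 - a) * cos b + (1 + a) * (cos b - 1)); last ring.
  apply: (le_trans (ler_normD _ _)); rewrite !normrM; apply: lerD.
    by rewrite -[leRHS]mulr1 ler_pM // cos_max.
  apply: ler_pM => //.
  by apply: (le_trans (ler_normD _ _)); rewrite normr1; lra.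
have R2 : `|expR a * sin b - 0 - b| <= 2 * (`|a| * `|b|) + b ^+ 2.
  rewrite (_ : _ - b = (expR a - 1) * sin b + (sin b - b)); last ring.
  apply: (le_trans (ler_normD _ _)); rewrite !normrM; apply: lerD => //.
  by rewrite mulrA ler_pM.
have : `|a| * `|b| <= a ^+ 2 + b ^+ 2.
  by rewrite -(real_normK (num_real a)) -(real_normK (num_real b)) !expr2; nra.
have := sqr_ge0 a; have := sqr_ge0 b; lra.
Qed.

Lemma normc_exp_sub_le (a b : R[i]) (M : R) n : 1 <= M -> normc a <= M -> normc b <= M ->
  normc (a ^+ n - b ^+ n) <= n%:R * normc (a - b) * M ^+ n.
Proof.
move=> M1 ha hb; elim: n => [|n IH]; first by rewrite subrr normc0 mul0r mul0r.
rewrite !exprS (_ : _ - _ = a * (a ^+ n - b ^+ n) + (a - b) * b ^+ n); last ring.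
have M0 : 0 <= M by apply: le_trans M1.
apply: (le_trans (normcD_le (normcM_le ha IH) (normcM_le (lexx _) (lexx (normc (b ^+ n)))))).
have : normc (b ^+ n) <= M * M ^+ n.
  rewrite normcX -exprS; apply: (@le_trans _ _ (M ^+ n)); first by rewrite lerXn2r // nnegrE normc_ge0.
  by rewrite exprS ler_peMl // exprn_ge0.
have := normc_ge0 (a - b); rewrite -(natr1 n).
move: (normc (b ^+ n)) (normc (a - b)) (M ^+ n) => B D MM h0 h1; nra.
Qed.

Lemma normc_1Dexp_le w n : normc ((1 + w / n.+1%:R) ^+ n.+1) <= expR (normc w).
Proof.
rewrite normcX (_ : normc w = n.+1%:R * (normc w / n.+1%:R)); last by field.
rewrite expRM_natl lerXn2r // ?nnegrE ?normc_ge0 ?expR_ge0 //.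
apply: le_trans (expR_ge1Dx _); apply: normcD_le; rewrite ?normc1 // normc_div.
by rewrite -(rmorph_nat (real_complex R)) normcR ger0_norm.
Qed.

(** The bases [1 + w / n.+1%:R] and [cexp (w / n.+1%:R)] differ by [O(1 / n^2)] and are both at most
    [expR (normc w / n.+1%:R)], so their powers differ by [O(1 / n)]. This limit later carries facts
    about polynomials in a Laplace transform over to its exponential. *)
Lemma normc_1Dexp_sub w n : normc w <= n.+1%:R / 2 ->
  normc ((1 + w / n.+1%:R) ^+ n.+1 - cexp w) <= 6 * normc w ^+ 2 * expR (normc w) / n.+1%:R.
Proof.
move=> hw; rewrite [in cexp w](_ : w = n.+1%:R * (w / n.+1%:R)); last first.
  by rewrite mulrCA divff ?mulr1 // pnatr_eq0.
rewrite cexpMn.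
have nw : normc (w / n.+1%:R) = normc w / n.+1%:R.
  by rewrite normc_div -(rmorph_nat (real_complex R)) normcR ger0_norm.
have n0 : (0 : R) < n.+1%:R by rewrite ltr0n.
have hv : normc (w / n.+1%:R) <= 2^-1.
  by rewrite nw ler_pdivrMr // mulrC.
have B := cexp_taylor1 hv.
set M := expR (normc w / n.+1%:R).
have M1 : 1 <= M by rewrite -expR0 ler_expR divr_ge0 ?normc_ge0.
have := @normc_exp_sub_le (1 + w / n.+1%:R) (cexp (w / n.+1%:R)) M n.+1 M1.
move=> /(_ _ _) H; apply: le_trans (H _ _) _.
- apply: le_trans (expR_ge1Dx _); apply: normcD_le; rewrite ?normc1 // nw //.
- by rewrite normc_cexp ler_expR -nw Re_le_normc'.
have -> : M ^+ n.+1 = expR (normc w) by rewrite -expRM_natl; congr expR; field.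
rewrite normc_distC (_ : cexp _ - _ = cexp (w / n.+1%:R) - 1 - w / n.+1%:R); last ring.
rewrite -!mulrA [leRHS]mulrA.
apply: (@le_trans _ _ (n.+1%:R * ((6 * (normc w / n.+1%:R) ^+ 2) * expR (normc w)))).
  rewrite ler_wpM2l // ler_wpM2r ?expR_ge0 // -nw //.
rewrite le_eqVlt; apply/orP; left; apply/eqP; field; lra.
Qed.

End ElementaryBounds.

(** * Limits of complex sequences *)

Section ComplexLimits.
Variable R : realType.
Implicit Types (z w a b l : R[i]) (x y : R) (u v : nat -> R[i]).
Local Open Scope classical_set_scope.

(** Componentwise, so that limit theorems and dominated convergence reduce to their real versions;
    [ccvg_norm] and [ccvg_normP] relate it to convergence in modulus. *)
Definition ccvg u l :=
  (Re (u n) @[n --> \oo] --> Re l) /\ (Im (u n) @[n --> \oo] --> Im l).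

Lemma ccvg_norm u l : (normc (u n - l) @[n --> \oo] --> (0 : R)) -> ccvg u l.
Proof.
move=> h; split; apply/cvgrPdist_le => e e0; move/cvgrPdist_le : h => /(_ e e0);
  apply: filterS => n; rewrite sub0r normrN ger0_norm ?normc_ge0 // => h.
- by rewrite distrC -ReB; apply: le_trans h; exact: Re_le_normc.
- by rewrite distrC -ImB; apply: le_trans h; exact: Im_le_normc.
Qed.

Lemma ccvg_normP u l : ccvg u l -> (normc (u n - l) @[n --> \oo] --> (0 : R)).
Proof.
move=> [h1 h2].
have : `|Re (u n) - Re l| + `|Im (u n) - Im l| @[n --> \oo] --> (0 : R).
  rewrite -(addr0 0) -{1}(normr0 R) -{2}(normr0 R); apply: cvgD; apply: cvg_norm.
    by rewrite -(subrr (Re l)); apply: cvgB => //; exact: cvg_cst.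
  by rewrite -(subrr (Im l)); apply: cvgB => //; exact: cvg_cst.
apply: (squeeze_cvgr _ (cvg_cst 0)); near=> n.
by rewrite normc_ge0 (le_trans (normc_le_ReIm _)) // ReB ImB.
Unshelve. all: by end_near. Qed.

Lemma ccvg_bound u l (e : nat -> R) :
  (\forall n \near \oo, normc (u n - l) <= e n) -> (e n @[n --> \oo] --> (0 : R)) -> ccvg u l.
Proof.
move=> h he; apply: ccvg_norm; apply: (squeeze_cvgr _ (cvg_cst 0) he).
by apply: filterS h => n ->; rewrite normc_ge0.
Qed.

Lemma ccvg_cst l : ccvg (fun=> l) l.
Proof. by split; exact: cvg_cst. Qed.

Lemma ccvgD u v a b : ccvg u a -> ccvg v b -> ccvg (fun n => u n + v n) (a + b).
Proof.
move=> [u1 u2] [v1 v2]; split; rewrite ?ReD ?ImD; under eq_fun do rewrite ?ReD ?ImD;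
  exact: cvgD.
Qed.

Lemma ccvgN u a : ccvg u a -> ccvg (fun n => - u n) (- a).
Proof.
move=> [u1 u2]; split; rewrite ?ReN ?ImN; under eq_fun do rewrite ?ReN ?ImN; exact: cvgN.
Qed.

Lemma ccvgB u v a b : ccvg u a -> ccvg v b -> ccvg (fun n => u n - v n) (a - b).
Proof. by move=> hu hv; apply: ccvgD => //; apply: ccvgN. Qed.

Lemma ccvgM u v a b : ccvg u a -> ccvg v b -> ccvg (fun n => u n * v n) (a * b).
Proof.
move=> [u1 u2] [v1 v2]; split.
  rewrite ReM; under eq_fun do rewrite ReM.
  exact: (cvgB (cvgM u1 v1) (cvgM u2 v2)).
rewrite ImM; under eq_fun do rewrite ImM.
exact: (cvgD (cvgM u1 v2) (cvgM u2 v1)).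
Qed.

Lemma ccvgR (u : nat -> R) x : (u n @[n --> \oo] --> x) -> ccvg (fun n => (u n)%:C) x%:C.
Proof. by move=> h; split => //=; exact: cvg_cst. Qed.

Lemma ccvg_sum k (F : 'I_k -> nat -> R[i]) (L : 'I_k -> R[i]) :
  (forall i, ccvg (F i) (L i)) -> ccvg (fun n => \sum_(i < k) F i n) (\sum_(i < k) L i).
Proof.
elim: k F L => [|k IH] F L h.
  by rewrite big_ord0; under eq_fun do rewrite big_ord0; exact: ccvg_cst.
rewrite big_ord_recr /=; under eq_fun do rewrite big_ord_recr /=.
by apply: ccvgD => //; apply: IH.
Qed.

Lemma ccvg_unique u a b : ccvg u a -> ccvg u b -> a = b.
Proof.
move=> [u1 u2] [v1 v2]; apply: eqC.
  exact: (cvg_unique (@norm_hausdorff _ R) u1 v1).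
exact: (cvg_unique (@norm_hausdorff _ R) u2 v2).
Qed.

Lemma ccvg_normc u a : ccvg u a -> normc (u n) @[n --> \oo] --> normc a.
Proof.
move=> h; apply/cvgrPdist_le => e e0.
move/ccvg_normP : h => /cvgrPdist_le /(_ e e0); apply: filterS => n.
rewrite sub0r normrN ger0_norm ?normc_ge0 // => h.
rewrite ler_norml; apply/andP; split.
  rewrite lerNl opprB; apply: le_trans h; exact: normc_sub_le.
by apply: le_trans h; rewrite normc_distC; exact: normc_sub_le.
Qed.

Lemma ccvg_le u a (e : nat -> R) x : ccvg u a -> (e n @[n --> \oo] --> x) ->
  (forall n, normc (u n) <= e n) -> normc a <= x.
Proof.
move=> h1 h2 h3; apply: (@ler_cvg_to _ _ _ _ _ _ _ _ (ccvg_normc h1) h2).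
by near=> n; exact: h3.
Unshelve. all: by end_near. Qed.

Lemma ccvg_eq u v a : (\forall n \near \oo, u n = v n) -> ccvg u a -> ccvg v a.
Proof.
move=> uv [h1 h2]; split.
  by apply: cvg_trans h1; apply: near_eq_cvg; apply: filterS uv => n ->.
by apply: cvg_trans h2; apply: near_eq_cvg; apply: filterS uv => n ->.
Qed.

Lemma ccvgV u a : a != 0 -> ccvg u a -> ccvg (fun n => (u n)^-1) a^-1.
Proof.
move=> a0 h; have hn := ccvg_normc h.
have n0 : normc a ^+ 2 != 0 by rewrite expf_neq0 // normc_eq0.
have hn2 : (normc (u n) ^+ 2)^-1 @[n --> \oo] --> (normc a ^+ 2)^-1.
  apply: cvgV => //; rewrite expr2; under eq_fun do rewrite expr2; exact: cvgM.
case: h => h1 h2.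
split.
  rewrite ReV; under eq_fun do rewrite ReV.
  exact: (cvgM h1 hn2).
rewrite ImV; under eq_fun do rewrite ImV.
exact: (cvgM (cvgN h2) hn2).
Qed.

Lemma ccvg_cexp u a : ccvg u a -> ccvg (fun n => cexp (u n)) (cexp a).
Proof.
move=> [h1 h2].
have e1 : expR (Re (u n)) @[n --> \oo] --> expR (Re a).
  by apply: continuous_cvg => //; exact: continuous_expR.
have e2 : cos (Im (u n)) @[n --> \oo] --> cos (Im a).
  by apply: continuous_cvg => //; exact: continuous_cos.
have e3 : sin (Im (u n)) @[n --> \oo] --> sin (Im a).
  by apply: continuous_cvg => //; exact: continuous_sin.
split.
  rewrite Re_cexp; under eq_fun do rewrite Re_cexp.
  exact: (cvgM e1 e2).
rewrite Im_cexp; under eq_fun do rewrite Im_cexp.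
exact: (cvgM e1 e3).
Qed.

Lemma cvg_invn (c : R) : c / n.+1%:R @[n --> \oo] --> (0 : R).
Proof. by rewrite -(mulr0 c); apply: cvgM; [exact: cvg_cst|exact: cvg_harmonic]. Qed.

Lemma ccvg_1Dexp w : ccvg (fun n => (1 + w / n.+1%:R) ^+ n.+1) (cexp w).
Proof.
apply: (@ccvg_bound _ _ (fun n => 6 * normc w ^+ 2 * expR (normc w) / n.+1%:R)); last exact: cvg_invn.
have [N hN] : exists N, normc w * 2 <= N%:R.
  by exists (Num.bound (normc w * 2)); apply/ltW/archi_boundP; rewrite mulr_ge0 ?normc_ge0.
exists N => // n /= nN; apply: normc_1Dexp_sub; rewrite ler_pdivlMr //.
apply: (le_trans hN); rewrite ler_nat; exact: leqW.
Qed.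

End ComplexLimits.

(** * Measurability of complex functions *)

Section ComplexMeasurability.
Context d (T : measurableType d) (R : realType).
Implicit Types (f g : T -> R[i]) (h : T -> R).

Definition cmeas f := measurable_fun setT (fun x => Re (f x)) /\ measurable_fun setT (fun x => Im (f x)).

Lemma cmeas_cst (c : R[i]) : cmeas (fun=> c).
Proof. by split; exact: measurable_cst. Qed.

Lemma cmeasR h : measurable_fun setT h -> cmeas (fun x => (h x)%:C).
Proof. by split => //; exact: measurable_cst. Qed.

Lemma cmeasD f g : cmeas f -> cmeas g -> cmeas (fun x => f x + g x).
Proof.
move=> [f1 f2] [g1 g2]; split.
  by under eq_fun do rewrite ReD; exact: measurable_funD.
by under eq_fun do rewrite ImD; exact: measurable_funD.
Qed.

Lemma cmeasN f : cmeas f -> cmeas (fun x => - f x).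
Proof.
move=> [f1 f2]; split.
  by under eq_fun do rewrite ReN; exact: measurable_funN.
by under eq_fun do rewrite ImN; exact: measurable_funN.
Qed.

Lemma cmeasM f g : cmeas f -> cmeas g -> cmeas (fun x => f x * g x).
Proof.
move=> [f1 f2] [g1 g2]; split.
  under eq_fun do rewrite ReM.
  exact: (measurable_funB (measurable_funM f1 g1) (measurable_funM f2 g2)).
under eq_fun do rewrite ImM.
exact: (measurable_funD (measurable_funM f1 g2) (measurable_funM f2 g1)).
Qed.

Lemma cmeasX f n : cmeas f -> cmeas (fun x => f x ^+ n).
Proof.
move=> hf; elim: n => [|n IH]; first exact: cmeas_cst.
by under eq_fun do rewrite exprS; exact: cmeasM.
Qed.

Lemma measurable_inv_ge0 h : (forall x, 0 <= h x) -> measurable_fun setT h ->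
  measurable_fun setT (fun x => (h x)^-1).
Proof.
(* Written as the real power with exponent -1, the inverse is measurable also where [h] vanishes. *)
move=> h0 mh; under eq_fun do rewrite -powR_inv1 //.
by apply: (measurableT_comp (measurable_powR _)).
Qed.

Lemma cmeasV f : cmeas f -> cmeas (fun x => (f x)^-1).
Proof.
move=> [f1 f2].
have m : measurable_fun setT (fun x => (normc (f x) ^+ 2)^-1).
  apply: measurable_inv_ge0 => [x|]; first exact: sqr_ge0.
  by under eq_fun do rewrite normcE2; apply: measurable_funD; exact: measurable_funX.
split.
  by under eq_fun do rewrite ReV; exact: measurable_funM.
by under eq_fun do rewrite ImV; apply: measurable_funM => //; exact: measurable_funN.
Qed.

Lemma cmeas_cexp f : cmeas f -> cmeas (fun x => cexp (f x)).
Proof.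
move=> [f1 f2].
have e : measurable_fun setT (fun x => expR (Re (f x))).
  exact: (measurableT_comp (@measurable_expR R)).
split.
  under eq_fun do rewrite Re_cexp; apply: measurable_funM => //.
  by apply: measurableT_comp f2; apply: continuous_measurable_fun; exact: continuous_cos.
under eq_fun do rewrite Im_cexp; apply: measurable_funM => //.
by apply: measurableT_comp f2; apply: continuous_measurable_fun; exact: continuous_sin.
Qed.

Lemma cmeas_lim (F : nat -> T -> R[i]) f : (forall n, cmeas (F n)) ->
  (forall x, ccvg (F^~ x) (f x)) -> cmeas f.
Proof.
move=> mF h; split.
  apply: (@measurable_fun_cvg _ _ _ _ (fun n x => Re (F n x))) => // [n|x _]; first by case: (mF n).
  by case: (h x).
apply: (@measurable_fun_cvg _ _ _ _ (fun n x => Im (F n x))) => // [n|x _]; first by case: (mF n).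
by case: (h x).
Qed.

End ComplexMeasurability.

Lemma cmeas_comp d1 d2 (T1 : measurableType d1) (T2 : measurableType d2) (R : realType)
  (f : T2 -> R[i]) (g : T1 -> T2) : cmeas f -> measurable_fun setT g -> cmeas (fun x => f (g x)).
Proof.
move=> [f1 f2] mg; split; [exact: (measurableT_comp f1 mg)|exact: (measurableT_comp f2 mg)].
Qed.

(** The complex inverse divides by the nonnegative [normc ^+ 2], so passing through it lets [g]
    change sign or vanish. *)
Lemma measurable_div_gen d (T : measurableType d) (R : realType) (f g : T -> R) :
  measurable_fun setT f -> measurable_fun setT g -> measurable_fun setT (fun x => f x / g x).
Proof.
move=> mf mg.
have [h _] := cmeasM (cmeasR mf) (cmeasV (cmeasR mg)).
rewrite (_ : (fun x => f x / g x) = (fun x => Re ((f x)%:C * (g x)%:C^-1))) //.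
by apply/funext => x; rewrite -fmorphV -rmorphM.
Qed.

(** * Integrals of complex-valued functions *)

Section ComplexIntegral.
Variable R : realType.
Implicit Types (D : set R) (f g : R -> R[i]) (h : R -> R).
Local Open Scope classical_set_scope.

Definition rintble D h := mu.-integrable D (EFin \o h).
Definition cintble D f := rintble D (fun x => Re (f x)) /\ rintble D (fun x => Im (f x)).

Lemma rintble_le D h k : measurable D -> measurable_fun setT h -> rintble D k ->
  (forall x, D x -> `|h x| <= k x) -> rintble D h.
Proof.
move=> mD mh ik hk; apply: (@le_integrable _ _ _ mu D mD (EFin \o h) (EFin \o k) _ _ ik).
  by apply/measurable_EFinP; exact: measurable_funTS.
by move=> x Dx /=; rewrite lee_fin (le_trans (hk _ Dx)) // ler_norm.
Qed.

Lemma cintble_le D f h : measurable D -> cmeas f -> rintble D h ->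
  (forall x, D x -> normc (f x) <= h x) -> cintble D f.
Proof.
move=> mD [m1 m2] ih hf; split; apply: (rintble_le mD _ ih) => // x Dx.
  exact: le_trans (Re_le_normc _) (hf _ Dx).
exact: le_trans (Im_le_normc _) (hf _ Dx).
Qed.

Lemma rintbleD D h k : measurable D -> rintble D h -> rintble D k -> rintble D (fun x => h x + k x).
Proof. by move=> mD ih ik; exact: (@integrableD _ _ _ mu D mD (EFin \o h) (EFin \o k) ih ik). Qed.

Lemma rintbleB D h k : measurable D -> rintble D h -> rintble D k -> rintble D (fun x => h x - k x).
Proof. by move=> mD ih ik; exact: (@integrableB _ _ _ mu D mD (EFin \o h) (EFin \o k) ih ik). Qed.

Lemma rintbleN D h : measurable D -> rintble D h -> rintble D (fun x => - h x).
Proof. by move=> mD ih; exact: (@integrableN _ _ _ mu D (EFin \o h) ih). Qed.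

Lemma rintbleZ D c h : measurable D -> rintble D h -> rintble D (fun x => c * h x).
Proof. by move=> mD ih; exact: (@integrableZl _ _ _ mu D mD c (EFin \o h) ih). Qed.

Lemma rintble0 D : measurable D -> rintble D (fun=> 0).
Proof. by move=> mD; exact: (@integrable0 _ _ _ mu D). Qed.

Lemma rintble_eq D h k : measurable D -> (forall x, D x -> h x = k x) -> rintble D h -> rintble D k.
Proof. by move=> mD hk; apply: (@eq_integrable _ _ _ mu D mD (EFin \o h) (EFin \o k)) => x; rewrite inE => Dx /=; rewrite hk. Qed.

Lemma rintbleS D E h : measurable D -> measurable E -> E `<=` D -> rintble D h -> rintble E h.
Proof. by move=> mD mE ED; exact: (@integrableS _ _ _ mu D E (EFin \o h)). Qed.

Lemma rintble_norm D h : measurable D -> rintble D h -> rintble D (fun x => `|h x|).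
Proof. by move=> mD; exact: (@integrable_norm _ _ _ mu D h). Qed.

Lemma rintble_bounded (a b M : R) h : measurable_fun setT h ->
  (forall x, a <= x <= b -> `|h x| <= M) -> rintble `[a, b] h.
Proof.
move=> mh hM.
have hM' x : `[a, b] x -> `|h x| <= (fun=> M) x by rewrite /= in_itv /=; exact: hM.
apply: (rintble_le _ mh _ hM') => //.
have fin : (@lebesgue_measure R (`[a, b] : set R) < +oo)%E.
  by rewrite lebesgue_measure_itv /=; case: ifP => // _; rewrite -EFinB ltry.
apply: (@measurable_bounded_integrable _ _ _ mu) => //.
rewrite /bounded_near; near=> N => x _ /=.
by near: N; exact: nbhs_pinfty_ge.
Unshelve. all: by end_near. Qed.

Lemma cintbleD D f g : measurable D -> cintble D f -> cintble D g -> cintble D (fun x => f x + g x).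
Proof.
move=> mD [f1 f2] [g1 g2]; split.
  by under eq_fun do rewrite ReD; exact: rintbleD.
by under eq_fun do rewrite ImD; exact: rintbleD.
Qed.

Lemma cintbleN D f : measurable D -> cintble D f -> cintble D (fun x => - f x).
Proof.
move=> mD [f1 f2]; split.
  by under eq_fun do rewrite ReN; exact: rintbleN.
by under eq_fun do rewrite ImN; exact: rintbleN.
Qed.

Lemma cintbleZ D c f : measurable D -> cintble D f -> cintble D (fun x => c * f x).
Proof.
move=> mD [f1 f2]; split.
  by under eq_fun do rewrite ReM; apply: rintbleB => //; exact: rintbleZ.
by under eq_fun do rewrite ImM; apply: rintbleD => //; exact: rintbleZ.
Qed.

Lemma cintbleB D f g : measurable D -> cintble D f -> cintble D g -> cintble D (fun x => f x - g x).
Proof. by move=> mD hf hg; apply: cintbleD => //; exact: cintbleN. Qed.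

Lemma cintbleR D h : measurable D -> rintble D h -> cintble D (fun x => (h x)%:C).
Proof. by move=> mD ih; split => //=; exact: rintble0. Qed.

Lemma cintble_eq D f g : measurable D -> (forall x, D x -> f x = g x) -> cintble D f -> cintble D g.
Proof.
move=> mD fg [f1 f2]; split; [apply: rintble_eq f1 => //|apply: rintble_eq f2 => //];
  by move=> x Dx; rewrite fg.
Qed.

Lemma rintD D h k : measurable D -> rintble D h -> rintble D k ->
  \int[mu]_(x in D) (h x + k x) = \int[mu]_(x in D) h x + \int[mu]_(x in D) k x.
Proof. by move=> mD ih ik; rewrite RintegralD. Qed.

Lemma rintB D h k : measurable D -> rintble D h -> rintble D k ->
  \int[mu]_(x in D) (h x - k x) = \int[mu]_(x in D) h x - \int[mu]_(x in D) k x.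
Proof. by move=> mD ih ik; rewrite RintegralB. Qed.

Lemma rintZ D c h : measurable D -> rintble D h ->
  \int[mu]_(x in D) (c * h x) = c * \int[mu]_(x in D) h x.
Proof. by move=> mD ih; rewrite RintegralZl. Qed.

Lemma cint_eq D f g : (forall x, D x -> f x = g x) -> cintegral D f = cintegral D g.
Proof.
by move=> fg; rewrite /cintegral; congr Complex; apply: eq_Rintegral => x; rewrite inE => Dx; rewrite fg.
Qed.

Lemma cintD D f g : measurable D -> cintble D f -> cintble D g ->
  cintegral D (fun x => f x + g x) = cintegral D f + cintegral D g.
Proof.
move=> mD [f1 f2] [g1 g2]; apply: eqC; rewrite ?ReD ?ImD /=.
  by rewrite -RintegralD //; apply: eq_Rintegral => x _; rewrite ReD.
by rewrite -RintegralD //; apply: eq_Rintegral => x _; rewrite ImD.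
Qed.

Lemma cintZ D c f : measurable D -> cintble D f ->
  cintegral D (fun x => c * f x) = c * cintegral D f.
Proof.
move=> mD [f1 f2].
have i1 k : rintble D (fun x => k * Re (f x)) := rintbleZ k mD f1.
have i2 k : rintble D (fun x => k * Im (f x)) := rintbleZ k mD f2.
apply: eqC.
  rewrite ReM; transitivity (\int[mu]_(x in D) (Re c * Re (f x) - Im c * Im (f x)))%R.
    by apply: eq_Rintegral => x _; rewrite ReM.
  by rewrite (rintB mD (i1 _) (i2 _)) (rintZ _ mD f1) (rintZ _ mD f2).
rewrite ImM; transitivity (\int[mu]_(x in D) (Re c * Im (f x) + Im c * Re (f x)))%R.
  by apply: eq_Rintegral => x _; rewrite ImM.
by rewrite (rintD mD (i2 _) (i1 _)) (rintZ _ mD f1) (rintZ _ mD f2).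
Qed.

Lemma cintN D f : measurable D -> cintble D f -> cintegral D (fun x => - f x) = - cintegral D f.
Proof.
move=> mD hf; rewrite -mulN1r -cintZ //; apply: cint_eq => x _; by rewrite mulN1r.
Qed.

Lemma cintB D f g : measurable D -> cintble D f -> cintble D g ->
  cintegral D (fun x => f x - g x) = cintegral D f - cintegral D g.
Proof. by move=> mD hf hg; rewrite cintD ?cintN //; exact: cintbleN. Qed.

Lemma cintR D h : cintegral D (fun x => (h x)%:C) = (\int[mu]_(x in D) h x)%:C.
Proof.
apply: eqC => //=.
rewrite /Rintegral (_ : (fun x => _) = cst 0%E); last by [].
by rewrite integral0.
Qed.

Lemma cint_conj D f : measurable D -> cintble D f ->
  cintegral D (fun x => conjc (f x)) = conjc (cintegral D f).
Proof.
move=> mD [f1 f2]; apply: eqC.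
  by rewrite Re_conj /=; apply: eq_Rintegral => x _; rewrite Re_conj.
rewrite Im_conj /= -mulN1r -RintegralZl //; apply: eq_Rintegral => x _.
by rewrite Im_conj mulN1r.
Qed.

Lemma cint_sum D n (F : 'I_n -> R -> R[i]) : measurable D -> (forall i, cintble D (F i)) ->
  cintble D (fun x => \sum_(i < n) F i x) /\
  cintegral D (fun x => \sum_(i < n) F i x) = \sum_(i < n) cintegral D (F i).
Proof.
move=> mD; elim: n F => [|n IH] F hF.
  split.
    by under eq_fun do rewrite big_ord0; split; exact: rintble0.
  rewrite big_ord0 (@cint_eq _ _ (fun=> (0 : R)%:C)) => [|x _]; last by rewrite big_ord0.
  by rewrite cintR /Rintegral integral0.
have [h1 h2] := IH (fun i => F (widen_ord (leqnSn n) i)) (fun i => hF _).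
split.
  by under eq_fun do rewrite big_ord_recr /=; exact: cintbleD.
rewrite big_ord_recr /= -h2 -cintD //; apply: cint_eq => x _.
by rewrite big_ord_recr.
Qed.

Lemma cint_norm_le D f h : measurable D -> cintble D f -> rintble D h ->
  (forall x, D x -> normc (f x) <= h x) -> normc (cintegral D f) <= \int[mu]_(x in D) h x.
Proof.
move=> mD hf ih fh; have [u u1 hu] := normc_rot (cintegral D f).
rewrite -(ReC (normc _)) -hu -cintZ //.
have [r1 r2] := cintbleZ u mD hf.
apply: le_Rintegral => // x Dx; apply: (le_trans (Re_le_normc' _)).
by rewrite normcM u1 mul1r fh.
Qed.

Lemma rint_dct D (F : nat -> R -> R) h k : measurable D ->
  (forall n, measurable_fun setT (F n)) -> measurable_fun setT h ->
  (forall x, D x -> F n x @[n --> \oo] --> h x) -> rintble D k ->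
  (forall n x, D x -> `|F n x| <= k x) ->
  rintble D h /\ (\int[mu]_(x in D) F n x @[n --> \oo] --> \int[mu]_(x in D) h x).
Proof.
move=> mD mF mh Fh ik Fk.
have iF n : rintble D (F n) by apply: (rintble_le mD _ ik) => // x; exact: Fk.
have mF' n : measurable_fun D (EFin \o F n).
  by apply/measurable_EFinP; exact: measurable_funTS.
have mh' : measurable_fun D (EFin \o h).
  by apply/measurable_EFinP; exact: measurable_funTS.
have Fh' : {ae mu, forall x, D x -> (EFin \o F n) x @[n --> \oo] --> (EFin \o h) x}.
  by apply: aeW => x Dx; apply: cvg_EFin; [near=> n|exact: Fh].
have Fk' : {ae mu, forall x n, D x -> (`|(EFin \o F n) x| <= (EFin \o k) x)%E}.
  by apply: aeW => x n Dx; rewrite /= lee_fin; exact: Fk.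
have [ih _ c] := @dominated_convergence _ _ _ mu D mD (fun n => EFin \o F n) (EFin \o h) (EFin \o k)
  mF' mh' Fh' ik Fk'.
split => //; rewrite /Rintegral.
by apply: fine_cvg; rewrite fineK //; apply: (@integrable_fin_num _ _ _ mu D mD).
Unshelve. all: by end_near. Qed.

Lemma cint_dct D (F : nat -> R -> R[i]) f k : measurable D ->
  (forall n, cmeas (F n)) -> cmeas f ->
  (forall x, D x -> ccvg (F^~ x) (f x)) -> rintble D k ->
  (forall n x, D x -> normc (F n x) <= k x) ->
  cintble D f /\ ccvg (fun n => cintegral D (F n)) (cintegral D f).
Proof.
move=> mD mF [mf1 mf2] Ff ik Fk.
have [] := @rint_dct D (fun n x => Re (F n x)) (fun x => Re (f x)) k mD _ mf1 _ ik.
- by move=> n; case: (mF n).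
- by move=> x Dx; case: (Ff x Dx).
- by move=> n x Dx; apply: (le_trans (Re_le_normc _)); exact: Fk.
move=> a1 a2.
have [] := @rint_dct D (fun n x => Im (F n x)) (fun x => Im (f x)) k mD _ mf2 _ ik.
- by move=> n; case: (mF n).
- by move=> x Dx; case: (Ff x Dx).
- by move=> n x Dx; apply: (le_trans (Im_le_normc _)); exact: Fk.
by move=> b1 b2; split.
Qed.

End ComplexIntegral.

(** * Fubini's theorem under a product majorant *)

Section RealFubini.
Variable R : realType.
Local Open Scope classical_set_scope.

Let indic_patch (D : set R) (f : R -> R) :
  (\int[mu]_x (f x * \1_D x)%:E = \int[mu]_(x in D) (f x)%:E)%E.
Proof.
rewrite [RHS]integral_mkcond; apply: eq_integral => x _.
rewrite /patch indicE; case: ifP => _; by rewrite ?mulr1 ?mulr0.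
Qed.

Let product_integrable (h k : R -> R) : rintble setT h -> rintble setT k ->
  ((@lebesgue_measure R) \x (@lebesgue_measure R))%E.-integrable setT (fun z => (h z.1 * k z.2)%:E).
Proof.
move=> ih ik.
have mh : measurable_fun setT h by apply/measurable_EFinP; exact: measurable_int ih.
have mk : measurable_fun setT k by apply/measurable_EFinP; exact: measurable_int ik.
apply/integrable12ltyP.
  apply/measurable_EFinP; apply: measurable_funM.
    exact: measurableT_comp mh measurable_fst.
  exact: measurableT_comp mk measurable_snd.
have /integrableP[_ h1] := ih; have /integrableP[_ k1] := ik.
have C : (\int[mu]_y `|(EFin \o k) y| \is a fin_num)%E.
  by rewrite ge0_fin_numE //; exact: integral_ge0.
have E x : (\int[mu]_y `|(h x * k y)%:E| = `|(EFin \o h) x| * \int[mu]_y `|(EFin \o k) y|)%E.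
  rewrite -(@ge0_integralZl _ _ _ mu setT measurableT (fun y => `|(k y)%:E|%E)) //.
    by apply: eq_integral => y _; rewrite EFinM abseM.
  by apply: measurableT_comp => //; exact/measurable_EFinP.
under eq_integral do rewrite /= E.
rewrite ge0_integralZr //; last 2 first.
- by apply: measurableT_comp => //; exact/measurable_EFinP.
- exact: integral_ge0.
by rewrite lte_mul_pinfty // ?integral_ge0 // ge0_fin_numE // integral_ge0.
Qed.

(** A majorant [h x * k y] with integrable factors gives integrability on the product; all double
    integrals below have one. Cutting off by indicators reduces the rectangle to the plane. The
    integrability of the inner integral is recorded because it also yields its measurability. *)
Lemma rint_fubini (D E : set R) (f : R * R -> R) (h k : R -> R) :
  measurable D -> measurable E -> measurable_fun setT f -> rintble D h -> rintble E k ->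
  (forall x y, D x -> E y -> `|f (x, y)| <= h x * k y) ->
  rintble D (fun x => \int[mu]_(y in E) f (x, y))%R /\
  \int[mu]_(x in D) (\int[mu]_(y in E) f (x, y)) = \int[mu]_(y in E) (\int[mu]_(x in D) f (x, y)).
Proof.
move=> mD mE mf ih ik fhk.
pose g (z : R * R) := f z * \1_D z.1 * \1_E z.2.
have mg : measurable_fun setT g.
  apply: measurable_funM; first apply: measurable_funM => //.
    by apply: (measurableT_comp _ measurable_fst); exact/measurable_indicP.
  by apply: (measurableT_comp _ measurable_snd); exact/measurable_indicP.
have patchT (A : set R) (u : R -> R) : measurable A -> rintble A u -> rintble setT (fun x => u x * \1_A x).
  move=> mA iu; rewrite /rintble (_ : (EFin \o _) = (EFin \o u) \_ A).
    exact: (@integrable_mkcond _ _ _ mu A (EFin \o u) mA).1.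
  by apply/funext => x; rewrite /= /patch indicE; case: ifP => _; rewrite ?mulr1 ?mulr0.
have ig : ((@lebesgue_measure R) \x (@lebesgue_measure R))%E.-integrable setT (EFin \o g).
  apply: (le_integrable _ _ _ (product_integrable (patchT _ _ mD ih) (patchT _ _ mE ik))) => //.
    exact/measurable_EFinP.
  move=> [x y] _ /=; rewrite lee_fin /g /= !indicE.
  have [xD|_] := boolP (x \in D); last by rewrite !(mulr0, mul0r) normr0.
  have [yE|_] := boolP (y \in E); last by rewrite !(mulr0, mul0r) normr0.
  rewrite !mulr1; apply: (le_trans (fhk _ _ (set_mem xD) (set_mem yE))); exact: ler_norm.
have F1 x : (\int[mu]_y (g (x, y))%:E = ((\int[mu]_(y in E) f (x, y))%R * \1_D x)%:E)%E.
  rewrite /g /= indicE; have [xD|_] := boolP (x \in D); last first.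
    by rewrite mulr0; under eq_integral do rewrite mulr0 mul0r; rewrite integral0.
  rewrite mulr1; under eq_integral do rewrite mulr1.
  rewrite indic_patch /Rintegral fineK //; apply: (@integrable_fin_num _ _ _ mu E mE).
  apply: (rintble_le mE (k := fun y => h x * k y)).
  - exact: (measurableT_comp mf (pair1_measurable x)).
  - exact: rintbleZ.
  - by move=> y Ey; apply: fhk => //; exact: set_mem.
have F2 y : (\int[mu]_x (g (x, y))%:E = ((\int[mu]_(x in D) f (x, y))%R * \1_E y)%:E)%E.
  rewrite /g /= indicE; have [yE|_] := boolP (y \in E); last first.
    by rewrite mulr0; under eq_integral do rewrite mulr0; rewrite integral0.
  rewrite mulr1; under eq_integral do rewrite mulr1.
  rewrite indic_patch /Rintegral fineK //; apply: (@integrable_fin_num _ _ _ mu D mD).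
  apply: (rintble_le mD (k := fun x => k y * h x)).
  - exact: (measurableT_comp mf (pair2_measurable y)).
  - exact: rintbleZ.
  - by move=> x Dx; rewrite mulrC; apply: fhk => //; exact: set_mem.
have := Fubini ig; rewrite /=.
under eq_integral do rewrite F1.
under [in RHS]eq_integral do rewrite F2.
rewrite !indic_patch => H; split; last by rewrite /Rintegral H.
have := integrable_fubini_F ig.
rewrite /fubini_F /= (_ : (fun x => _) = (EFin \o (fun x => \int[mu]_(y in E) f (x, y)))%R \_ D).
  exact: (@integrable_mkcond _ _ _ mu D _ mD).2.
by apply/funext => x; rewrite F1 /patch indicE; case: ifP => _; rewrite ?mulr1 ?mulr0.
Qed.

Lemma cint_fubini (D E : set R) (f : R * R -> R[i]) (h k : R -> R) :
  measurable D -> measurable E -> cmeas f -> rintble D h -> rintble E k ->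
  (forall x y, D x -> E y -> normc (f (x, y)) <= h x * k y) ->
  cintble D (fun x => cintegral E (fun y => f (x, y))) /\
  cintegral D (fun x => cintegral E (fun y => f (x, y))) =
  cintegral E (fun y => cintegral D (fun x => f (x, y))).
Proof.
move=> mD mE [m1 m2] ih ik fhk.
have [i1 e1] := @rint_fubini D E (fun z => Re (f z)) h k mD mE m1 ih ik
  (fun x y Dx Ey => le_trans (Re_le_normc _) (fhk x y Dx Ey)).
have [i2 e2] := @rint_fubini D E (fun z => Im (f z)) h k mD mE m2 ih ik
  (fun x y Dx Ey => le_trans (Im_le_normc _) (fhk x y Dx Ey)).
by split; [split|apply: eqC].
Qed.

End RealFubini.

(** * The fundamental theorem of calculus on open and unbounded sets *)

Section FundamentalTheorem.
Variable R : realType.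
Implicit Types (f F : R -> R[i]) (h H : R -> R).
Local Open Scope classical_set_scope.

Lemma rint_ftc_itv h H (a b : R) : a < b ->
  (forall x, a <= x <= b -> is_derive x 1 H (h x)) ->
  (forall x, a <= x <= b -> {for x, continuous h}) ->
  \int[mu]_(x in `[a, b]) h x = H b - H a.
Proof.
move=> ab dH ch.
have cH x : a <= x <= b -> {for x, continuous H}.
  move=> /dH dx; apply: differentiable_continuous; apply/derivable1_diffP.
  exact: (@ex_derive _ _ _ _ _ _ _ dx).
rewrite /Rintegral (@continuous_FTC2 _ h H a b ab).
- by rewrite -EFinB.
- by apply: continuous_in_subspaceT => x; rewrite inE /= in_itv /=; exact: ch.
- split.
  + move=> x; rewrite in_itv /= => /andP[/ltW ax /ltW xb].
    exact: (@ex_derive _ _ _ _ _ _ _ (dH x (introT andP (conj ax xb)))).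
  + apply: cvg_at_right_filter; apply: cH; by rewrite lexx ltW.
  + apply: cvg_at_left_filter; apply: cH; by rewrite lexx ltW.
- move=> x; rewrite in_itv /= => /andP[/ltW ax /ltW xb].
  rewrite derive1E; exact: (@derive_val _ _ _ _ _ _ _ (dH x (introT andP (conj ax xb)))).
Qed.

(** The compact intervals exhaust [D], and dominated convergence with majorant [|h|] passes to the
    limit; an improper integral then only needs the limits of the primitive along the endpoints. *)
Lemma rint_ftc (D : set R) h H (a b : nat -> R) A B : measurable D ->
  (forall n, a n < b n) -> (forall n x, a n <= x <= b n -> D x) ->
  (forall x, D x -> \forall n \near \oo, a n <= x <= b n) ->
  (forall x, D x -> is_derive x 1 H (h x)) ->
  (forall x, D x -> {for x, continuous h}) ->
  measurable_fun setT h -> rintble D h ->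
  (H (a n) @[n --> \oo] --> A) -> (H (b n) @[n --> \oo] --> B) ->
  \int[mu]_(x in D) h x = B - A.
Proof.
move=> mD ab sD exh dH ch mh ih cA cB.
have E n : \int[mu]_(x in D) (h x * \1_`[a n, b n] x) = H (b n) - H (a n).
  transitivity (\int[mu]_(x in `[a n, b n]) h x); last first.
    by apply: (rint_ftc_itv (ab n)) => x /sD; [exact: dH|exact: ch].
  rewrite [RHS]Rintegral_mkcond Rintegral_mkcond.
  apply: eq_Rintegral => x _; rewrite /patch indicE.
  have [xi|_] := boolP (x \in `[a n, b n]%classic); last by rewrite mulr0; case: ifP.
  have xD : x \in D by rewrite inE; apply: (sD n); move: xi; rewrite inE /= in_itv.
  by rewrite xD mulr1.
have [] := @rint_dct R D (fun n x => h x * \1_`[a n, b n] x) h (fun x => `|h x|) mD.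
- by move=> n; apply: measurable_funM => //; exact/measurable_indicP.
- by [].
- move=> x Dx; apply: cvg_near_cst; apply: filterS (exh x Dx) => n hn.
  by rewrite indicE mem_set ?mulr1 //= in_itv.
- exact: rintble_norm.
- move=> n x Dx; rewrite indicE; case: (_ \in _); by rewrite ?mulr1 ?mulr0 ?normr0.
under eq_fun do rewrite E.
move=> _ c.
exact: (cvg_unique (@norm_hausdorff _ R) c (cvgB cB cA)).
Qed.

Definition cder F (x : R) (d : R[i]) :=
  is_derive x 1 (fun x => Re (F x)) (Re d) /\
  is_derive x 1 (fun x => Im (F x)) (Im d).

Lemma cint_ftc (D : set R) f F (a b : nat -> R) A B : measurable D ->
  (forall n, a n < b n) -> (forall n x, a n <= x <= b n -> D x) ->
  (forall x, D x -> \forall n \near \oo, a n <= x <= b n) ->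
  (forall x, D x -> cder F x (f x)) ->
  (forall x, D x -> exists d, cder f x d) ->
  cmeas f -> cintble D f ->
  ccvg (fun n => F (a n)) A -> ccvg (fun n => F (b n)) B ->
  cintegral D f = B - A.
Proof.
move=> mD ab sD exh dF df [m1 m2] [i1 i2] [a1 a2] [b1 b2].
have cont h (x : R) e : is_derive x 1 h e -> {for x, continuous h}.
  move=> dx; apply: differentiable_continuous; apply/derivable1_diffP.
  exact: (@ex_derive _ _ _ _ _ _ _ dx).
apply: eqC; rewrite ?ReB ?ImB /=.
  apply: (@rint_ftc D (fun x => Re (f x)) (fun x => Re (F x)) a b) => //.
    by move=> x /dF [].
  by move=> x /df [d [d1 _]]; exact: (cont _ _ _ d1).
apply: (@rint_ftc D (fun x => Im (f x)) (fun x => Im (F x)) a b) => //.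
  by move=> x /dF [].
by move=> x /df [d [_ d1]]; exact: (cont _ _ _ d1).
Qed.

End FundamentalTheorem.

(** * Derivatives of complex functions of a real variable *)

Section ComplexDerivative.
Variable R : realType.
Implicit Types (x : R) (d e c : R[i]) (F G : R -> R[i]) (f g : R -> R).

Lemma rder_eq f x (a b : R) : is_derive x 1 f a -> a = b -> is_derive x 1 f b.
Proof. by move=> h <-. Qed.

Lemma rderD f g x (a b : R) : is_derive x 1 f a -> is_derive x 1 g b ->
  is_derive x 1 (fun y => f y + g y) (a + b).
Proof. by move=> h1 h2; exact: is_deriveD. Qed.

Lemma rderN f x (a : R) : is_derive x 1 f a -> is_derive x 1 (fun y => - f y) (- a).
Proof. by move=> h; exact: is_deriveN. Qed.

Lemma rderB f g x (a b : R) : is_derive x 1 f a -> is_derive x 1 g b ->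
  is_derive x 1 (fun y => f y - g y) (a - b).
Proof. by move=> h1 h2; exact: is_deriveB. Qed.

Lemma rderM f g x (a b : R) : is_derive x 1 f a -> is_derive x 1 g b ->
  is_derive x 1 (fun y => f y * g y) (a * g x + f x * b).
Proof.
move=> h1 h2; apply: rder_eq (is_deriveM h1 h2) _.
by rewrite /GRing.scale /=; ring.
Qed.

Lemma rder_cst x (a : R) : is_derive x 1 (fun=> a) 0.
Proof. exact: is_derive_cst. Qed.

Lemma rder_id x : is_derive x 1 (fun y => y) 1.
Proof. exact: is_derive_id. Qed.

Lemma rder_comp f g x (a b : R) : is_derive (g x) 1 f a -> is_derive x 1 g b ->
  is_derive x 1 (fun y => f (g y)) (a * b).
Proof. by move=> h1 h2; exact: is_derive1_comp. Qed.

Lemma rderV f x (a : R) : f x != 0 -> is_derive x 1 f a ->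
  is_derive x 1 (fun y => (f y)^-1) (- a / f x ^+ 2).
Proof.
by move=> f0 h; apply: rder_eq (is_deriveV f0 h) _; rewrite /GRing.scale /=; field.
Qed.

Lemma cder_eq F x d e : cder F x d -> d = e -> cder F x e.
Proof. by move=> h <-. Qed.

Lemma cder_cst x c : cder (fun=> c) x 0.
Proof. by split; exact: rder_cst. Qed.

Lemma cderR f x (a : R) : is_derive x 1 f a -> cder (fun y => (f y)%:C) x a%:C.
Proof. by move=> h; split => //=; exact: rder_cst. Qed.

Lemma cder_id x : cder (fun y => y%:C) x 1.
Proof. exact: (cderR (rder_id x)). Qed.

Lemma cderD F G x d e : cder F x d -> cder G x e -> cder (fun y => F y + G y) x (d + e).
Proof.
move=> [f1 f2] [g1 g2]; split.
  by rewrite ReD; under eq_fun do rewrite ReD; exact: rderD.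
by rewrite ImD; under eq_fun do rewrite ImD; exact: rderD.
Qed.

Lemma cderN F x d : cder F x d -> cder (fun y => - F y) x (- d).
Proof.
move=> [f1 f2]; split.
  by rewrite ReN; under eq_fun do rewrite ReN; exact: rderN.
by rewrite ImN; under eq_fun do rewrite ImN; exact: rderN.
Qed.

Lemma cderB F G x d e : cder F x d -> cder G x e -> cder (fun y => F y - G y) x (d - e).
Proof. by move=> h1 h2; apply: cderD => //; exact: cderN. Qed.

Lemma cderM F G x d e : cder F x d -> cder G x e ->
  cder (fun y => F y * G y) x (d * G x + F x * e).
Proof.
move=> [f1 f2] [g1 g2]; split.
  under eq_fun do rewrite ReM.
  by apply: rder_eq (rderB (rderM f1 g1) (rderM f2 g2)) _; rewrite ReD !ReM; ring.
under eq_fun do rewrite ImM.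
by apply: rder_eq (rderD (rderM f1 g2) (rderM f2 g1)) _; rewrite ImD !ImM; ring.
Qed.

Lemma cderZ F x c d : cder F x d -> cder (fun y => c * F y) x (c * d).
Proof. by move=> h; apply: cder_eq (cderM (cder_cst x c) h) _; rewrite mul0r add0r. Qed.

Lemma cderX F x d n : cder F x d -> cder (fun y => F y ^+ n) x (n%:R * d * F x ^+ n.-1).
Proof.
move=> h; elim: n => [|n IH].
  by apply: cder_eq (cder_cst x 1) _; rewrite !mul0r.
under eq_fun do rewrite exprS.
apply: cder_eq (cderM h IH) _ => /=; case: n {IH} => [|n] /=.
  by rewrite !expr0 mul0r !mul0r mulr0 addr0; ring.
by rewrite exprS -(natr1 n.+1); ring.
Qed.

Lemma cderV F x d : F x != 0 -> cder F x d -> cder (fun y => (F y)^-1) x (- d / F x ^+ 2).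
Proof.
move=> F0 [f1 f2].
have n0 : Re (F x) ^+ 2 + Im (F x) ^+ 2 != 0 by rewrite -normcE2 expf_neq0 // normc_eq0.
have dn := rderD (rderM f1 f1) (rderM f2 f2).
have dV := rderV (_ : (fun y => Re (F y) * Re (F y) + Im (F y) * Im (F y)) x != 0) dn.
rewrite -!expr2 in dV; move: dV => /(_ n0) dV.
have E : - d / F x ^+ 2 = - (d * (Re (F x) -i* Im (F x)) ^+ 2) * ((Re (F x) ^+ 2 + Im (F x) ^+ 2) ^- 2)%:C.
  have Fc : F x * (Re (F x) -i* Im (F x)) = (Re (F x) ^+ 2 + Im (F x) ^+ 2)%:C.
    by rewrite normcP normcE2.
  have c0 : Re (F x) -i* Im (F x) != 0.
    apply/eqP => c0; move: Fc; rewrite c0 mulr0 => /(congr1 (@complex.Re R)) /= /esym /eqP.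
    by rewrite (negPf n0).
  rewrite fmorphV rmorphXn /= -Fc; field; by rewrite F0 c0.
split.
  under eq_fun do rewrite ReV normcE2 !expr2.
  apply: rder_eq (rderM f1 dV) _ => /=.
  rewrite E; move: (F x) d n0 {E f1 f2 dn dV F0} => [a b] [u v] /= n0.
  by rewrite !(ReM, ImM, ReN, ImN, exprS, expr0) /=; field; rewrite -!expr2.
under eq_fun do rewrite ImV normcE2 !expr2.
apply: rder_eq (rderM (rderN f2) dV) _ => /=.
rewrite E; move: (F x) d n0 {E f1 f2 dn dV F0} => [a b] [u v] /= n0.
by rewrite !(ReM, ImM, ReN, ImN, exprS, expr0) /=; field; rewrite -!expr2.
Qed.

Lemma cder_cexp F x d : cder F x d -> cder (fun y => cexp (F y)) x (d * cexp (F x)).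
Proof.
move=> [f1 f2].
have e1 := rder_comp (is_derive_expR (Re (F x))) f1.
have c1 := rder_comp (is_derive_cos (Im (F x))) f2.
have s1 := rder_comp (is_derive_sin (Im (F x))) f2.
split.
  under eq_fun do rewrite Re_cexp.
  by apply: rder_eq (rderM e1 c1) _; rewrite ReM Re_cexp Im_cexp; ring.
under eq_fun do rewrite Im_cexp.
by apply: rder_eq (rderM e1 s1) _; rewrite ImM Re_cexp Im_cexp; ring.
Qed.

(* The principal logarithm on the right half-plane, in a form that can be differentiated. *)
Definition clogh (z : R[i]) : R[i] := (ln (Re z ^+ 2 + Im z ^+ 2) / 2) +i* atan (Im z / Re z).

Lemma cder_clogh F x d : 0 < Re (F x) -> cder F x d -> cder (fun y => clogh (F y)) x (d / F x).
Proof.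
move=> F0 [f1 f2].
have n0 : 0 < Re (F x) * Re (F x) + Im (F x) * Im (F x).
  by rewrite ltr_pwDl // ?mulr_gt0 // -expr2 sqr_ge0.
have dn := rderD (rderM f1 f1) (rderM f2 f2).
have dl := rder_comp (@is_derive1_ln _ ((fun y => Re (F y) * Re (F y) + Im (F y) * Im (F y)) x) n0) dn.
have dq := rderM f2 (rderV (lt0r_neq0 F0) f1).
have da := rder_comp (is_derive1_atan ((fun y => Im (F y) / Re (F y)) x)) dq.
have E : d / F x = d * (Re (F x) -i* Im (F x)) * ((Re (F x) * Re (F x) + Im (F x) * Im (F x))^-1)%:C.
  have := normcP (F x); rewrite normcE2 !expr2 => Fc.
  have z0 : F x != 0 by exact: neq0_Re.
  have c0 : Re (F x) -i* Im (F x) != 0.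
    by apply: neq0_Re.
  rewrite fmorphV /= -Fc; field; by rewrite z0 c0.
rewrite {}E; split => /=.
  under eq_fun do rewrite !expr2.
  apply: rder_eq (rderM dl (rder_cst x 2^-1)) _ => /=.
  move: (F x) d n0 F0 {f1 f2 dn dl dq da} => [a b] [u v] /= n0 F0.
  by field; lra.
apply: rder_eq da _ => /=.
move: (F x) d n0 F0 {f1 f2 dn dl dq} => [a b] [u v] /= n0 F0.
by field; apply/andP; split; lra.
Qed.

End ComplexDerivative.

(** * The principal logarithm *)

Section ComplexLogarithm.
Variable R : realType.
Implicit Types (z w : R[i]) (x y : R).

(** On the right half-plane the arc cosine is an acute angle, hence the arc tangent of its own
    tangent; oddness of [atan] then absorbs the case distinction on the sign of [Im z]. *)
Lemma carg_atan z : 0 < Re z -> carg z = atan (Im z / Re z).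
Proof.
move=> z0; have n0 : 0 < normc z by rewrite normc_gt0 // neq0_Re.
set c := Re z / normc z.
have c0 : 0 < c by rewrite divr_gt0.
have c1 : c <= 1 by rewrite ler_pdivrMr // mul1r Re_le_normc'.
have cb : -1 <= c <= 1 by rewrite c1 andbT; lra.
have cosa : cos (acos c) = c by rewrite acosK // in_itv.
have sina : sin (acos c) = `|Im z| / normc z.
  rewrite sin_acos // -(ger0_norm (divr_ge0 (normr_ge0 (Im z)) (normc_ge0 z))) -sqrtr_sqr.
  congr Num.sqrt; rewrite /c !expr_div_n real_normK ?num_real //.
  have -> : (1 : R) = normc z ^+ 2 / normc z ^+ 2 by rewrite divff // expf_neq0 // gt_eqF.
  by rewrite -mulrBl normcE2; congr (_ / _); ring.
have a0 := acos_ge0 cb; have api := acos_lepi cb.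
have a2 : acos c < pi / 2.
  have : 0 < cos (acos c) by rewrite cosa.
  rewrite -(@cos_pihalf R) ltr_cos // in_itv /= ?a0 //.
  by have := @pi_ge0 R; lra.
have ta : tan (acos c) = `|Im z| / Re z.
  by rewrite /tan sina cosa /c; field; rewrite !gt_eqF.
have at0 : acos c = atan (`|Im z| / Re z).
  rewrite -ta tanK // in_itv /= a2 andbT; have := @pi_gt0 R; lra.
rewrite /carg -/c at0; case: ifP => [i0|/negbT]; first by rewrite ger0_norm.
by rewrite -ltNge => i0; rewrite ltr0_norm // mulNr atanN opprK.
Qed.

Lemma clogE z : 0 < Re z -> clog z = clogh z.
Proof.
move=> z0; rewrite /clog /clogh carg_atan //; congr Complex.
rewrite -normcE2 lnXn; last by rewrite normc_gt0 // neq0_Re.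
by field.
Qed.

Lemma cexp_clog z : z != 0 -> cexp (clog z) = z.
Proof.
move=> z0; have n0 := normc_gt0 z0.
set c := Re z / normc z.
have cb : -1 <= c <= 1.
  by rewrite -ler_norml /c normrM normfV (ger0_norm (normc_ge0 z)) ler_pdivrMr // mul1r Re_le_normc.
have cosa : cos (acos c) = c by rewrite acosK // in_itv.
have sina : sin (acos c) = `|Im z| / normc z.
  rewrite sin_acos // -(ger0_norm (divr_ge0 (normr_ge0 (Im z)) (normc_ge0 z))) -sqrtr_sqr.
  congr Num.sqrt; rewrite /c !expr_div_n real_normK ?num_real //.
  have -> : (1 : R) = normc z ^+ 2 / normc z ^+ 2 by rewrite divff // expf_neq0 // gt_eqF.
  by rewrite -mulrBl normcE2; congr (_ / _); ring.
have e : expR (ln (normc z)) = normc z by rewrite lnK // posrE.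
apply: eqC; rewrite ?Re_cexp ?Im_cexp /= e /carg -/c.
  by case: ifP => _; rewrite ?cosN cosa /c mulrC divfK // gt_eqF.
case: ifP => [i0|/negbT].
  by rewrite sina ger0_norm // mulrC divfK // gt_eqF.
by rewrite -ltNge => i0; rewrite sinN sina ltr0_norm // mulNr opprK mulrC divfK // gt_eqF.
Qed.

Lemma clogZ x z : 0 < x -> z != 0 -> clog (x%:C * z) = (ln x)%:C + clog z.
Proof.
move=> x0 z0; have n0 := normc_gt0 z0; apply: eqC; rewrite ?ReD ?ImD /=.
  by rewrite normcM normcR gtr0_norm // lnM.
rewrite add0r /carg ReZl ImZl normcM normcR gtr0_norm // pmulr_rge0 //.
by rewrite -mulf_div divff ?mul1r // gt_eqF.
Qed.

Lemma clogR x : 0 < x -> clog x%:C = (ln x)%:C.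
Proof.
move=> x0; rewrite /clog normcR gtr0_norm //; congr Complex.
by rewrite carg_atan //= mul0r atan0.
Qed.

Lemma cpowR x w : 0 < x -> cpow x%:C w = cexp (w * (ln x)%:C).
Proof. by move=> x0; rewrite /cpow clogR. Qed.

Lemma Re_clog_gt z : 0 < Re z -> `|Im (clog z)| <= pi / 2.
Proof.
move=> z0; rewrite clogE //= ler_norml; apply/andP; split; apply: ltW.
  exact: atan_gtNpi2.
exact: atan_ltpi2.
Qed.

End ComplexLogarithm.

Create HintDb cmeas.

Ltac cmeas := repeat lazymatch goal with
  | |- cmeas (fun x => @?f x * @?g x) => refine (@cmeasM _ _ _ f g _ _)
  | |- cmeas (fun x => @?f x + @?g x) => refine (@cmeasD _ _ _ f g _ _)
  | |- cmeas (fun x => - @?f x) => refine (@cmeasN _ _ _ f _)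
  | |- cmeas (fun x => (@?f x)^-1) => refine (@cmeasV _ _ _ f _)
  | |- cmeas (fun x => @?f x ^+ ?n) => refine (@cmeasX _ _ _ f n _)
  | |- cmeas (fun x => cexp (@?f x)) => refine (@cmeas_cexp _ _ _ f _)
  | |- cmeas (fun x => (@?f x)%:C) => refine (@cmeasR _ _ _ f _)
  | |- cmeas (fun x => ?c) => apply: cmeas_cst
  end; try exact: measurable_id; try exact: measurable_cst; try exact: measurable_fst; try exact: measurable_snd;
  try solve [auto with cmeas].

(** * The Poisson kernel of the right half-plane *)

Section PoissonKernel.
Variable R : realType.
Implicit Types (z w : R[i]) (x y s T : R).
Local Open Scope classical_set_scope.

Definition iR s : R[i] := 'i * s%:C.

Lemma Re_iR s : Re (iR s) = 0.
Proof. by rewrite ReZr Rei mul0r. Qed.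

Lemma Im_iR s : Im (iR s) = s.
Proof. by rewrite ImZr Imi mul1r. Qed.

Lemma iR_sqr s : iR s ^+ 2 = - (s%:C ^+ 2).
Proof. by rewrite exprMn sqr_i mulN1r. Qed.

Lemma normc_addi_ge z s : Re z <= normc (z + iR s).
Proof. by apply: le_trans (Re_le_normc' _); rewrite ReD Re_iR addr0. Qed.

Lemma addi_neq0 z s : 0 < Re z -> z + iR s != 0.
Proof. by move=> z0; apply: neq0_Re; rewrite ReD Re_iR addr0. Qed.

Lemma iRN s : iR (- s) = - iR s.
Proof. by rewrite /iR rmorphN /= mulrN. Qed.

Lemma subi_neq0 z s : 0 < Re z -> z - iR s != 0.
Proof. by move=> z0; rewrite -iRN addi_neq0. Qed.

Lemma sqrDE z s : z ^+ 2 + s%:C ^+ 2 = (z - iR s) * (z + iR s).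
Proof. by rewrite -subr_sqr iR_sqr opprK. Qed.

Lemma sqrD_neq0 z s : 0 < Re z -> z ^+ 2 + s%:C ^+ 2 != 0.
Proof. by move=> z0; rewrite sqrDE mulf_neq0 ?addi_neq0 ?subi_neq0. Qed.

(** Two lower bounds are combined: [s ^+ 2 - normc z ^+ 2], good for large [s], and [Re z ^+ 2],
    since both factors [z -+ is] have real part [Re z]. Suitably scaled, the second makes up for
    what the first loses. *)
Lemma sqrD_ge z s : 0 < Re z ->
  1 + s ^+ 2 <= normc (z ^+ 2 + s%:C ^+ 2) * (1 + (1 + normc z ^+ 2) / Re z ^+ 2).
Proof.
move=> z0; rewrite mulrDr mulr1.
have h1 : s ^+ 2 - normc z ^+ 2 <= normc (z ^+ 2 + s%:C ^+ 2).
  have := normc_sub_le (s%:C ^+ 2) (- z ^+ 2).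
  by rewrite normcN opprK [in leRHS]addrC !normcX normcR real_normK ?num_real.
have h2 : Re z ^+ 2 <= normc (z ^+ 2 + s%:C ^+ 2).
  rewrite sqrDE normcM expr2 ler_pM ?(ltW z0) //; last exact: normc_addi_ge.
  by rewrite -iRN normc_addi_ge.
have : 1 + normc z ^+ 2 <= normc (z ^+ 2 + s%:C ^+ 2) * ((1 + normc z ^+ 2) / Re z ^+ 2).
  rewrite mulrA ler_pdivlMr ?exprn_gt0 // mulrC ler_wpM2r //.
  by rewrite addr_ge0 ?sqr_ge0.
lra.
Qed.

(** Equal to [1 / (z - is) + 1 / (z + is)]: the Cauchy kernel plus a term that integrates to 0
    against boundary values from the right half-plane, the sum being integrable. For real [z] it is
    [2 pi] times the classical Poisson kernel; unlike that one it is holomorphic in [z]. *)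
Definition poisson z s : R[i] := 2%:R * z / (z ^+ 2 + s%:C ^+ 2).

Definition poisson_cst z : R := 2 * normc z * (1 + (1 + normc z ^+ 2) / Re z ^+ 2).

Lemma onesqr_gt0 s : 0 < 1 + s ^+ 2.
Proof. by rewrite ltr_pwDl // sqr_ge0. Qed.

Lemma normc_nat n : normc (n%:R : R[i]) = n%:R.
Proof. by rewrite -(rmorph_nat (real_complex R)) normcR ger0_norm. Qed.

Lemma poisson_le z s : 0 < Re z -> normc (poisson z s) <= poisson_cst z * (1 + s ^+ 2)^-1.
Proof.
move=> z0; rewrite normc_div normcM normc_nat /poisson_cst -[leRHS]mulrA.
apply: ler_wpM2l; first by rewrite mulr_ge0 ?normc_ge0.
have n0 : 0 < normc (z ^+ 2 + s%:C ^+ 2) by rewrite normc_gt0 // sqrD_neq0.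
rewrite ler_pdivlMr ?onesqr_gt0 // ler_pdivrMl //; exact: sqrD_ge.
Qed.

Lemma continuous_inv_onesqr : continuous (fun s : R => (1 + s ^+ 2)^-1).
Proof. exact: (@continuous_oneDsqrV R). Qed.

Lemma rintble_oneDsqrV : rintble setT (fun s : R => (1 + s ^+ 2)^-1).
Proof.
apply/integrableP; split.
  apply/measurable_EFinP; exact: (continuous_measurable_fun continuous_inv_onesqr).
have e : (\int[mu]_x ((1 + x ^+ 2)^-1 : R)%:E = 2%:E * (pi / 2)%:E)%E.
  rewrite (@ge0_symfun_integralT _ (fun x => (1 + x ^+ 2)^-1)).
  - congr (_ * _)%E; rewrite -integral0y_oneDsqr; congr (integral _ _ _).
    by apply/seteqP; split => x /=; rewrite in_itv /= andbT.
  - by move=> x; rewrite invr_ge0 ltW ?onesqr_gt0.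
  - exact: continuous_inv_onesqr.
  - by move=> x /=; rewrite sqrrN.
under eq_integral => x _ do rewrite /= ger0_norm ?invr_ge0 ?(ltW (onesqr_gt0 _)) //.
by rewrite e -EFinM ltry.
Qed.

Lemma cmeas_iR : cmeas iR.
Proof. by rewrite /iR; cmeas. Qed.

Lemma cmeas_poisson z : cmeas (poisson z).
Proof. by rewrite /poisson; cmeas. Qed.

Lemma cintble_poissonM z (f : R -> R[i]) M : 0 < Re z -> cmeas f ->
  (forall s, normc (f s) <= M) -> cintble setT (fun s => f s * poisson z s).
Proof.
move=> z0 mf fM.
apply: (@cintble_le _ _ _ (fun s => (M * poisson_cst z) * (1 + s ^+ 2)^-1)) => //.
- by apply: cmeasM => //; exact: cmeas_poisson.
- by apply: rintbleZ => //; exact: rintble_oneDsqrV.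
- by move=> s _; rewrite -mulrA; apply: normcM_le => //; exact: poisson_le.
Qed.

Lemma cder_iR s : cder iR s 'i.
Proof. by apply: cder_eq (cderZ 'i (cder_id s)) _; rewrite mulr1. Qed.

Lemma cder_addi z s : cder (fun s => z + iR s) s 'i.
Proof. by apply: cder_eq (cderD (cder_cst s z) (cder_iR s)) _; rewrite add0r. Qed.

Lemma cder_subi z s : cder (fun s => z - iR s) s (- 'i).
Proof. by apply: cder_eq (cderB (cder_cst s z) (cder_iR s)) _; rewrite add0r. Qed.

Lemma ccvg_clog_i (u : nat -> R[i]) : (forall n, 0 <= Im (u n)) -> ccvg u 'i ->
  ccvg (fun n => clog (u n)) ('i * (pi / 2)%:C).
Proof.
move=> up uc; have := ccvg_normc uc; rewrite normc_i => nc.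
have rc : Re (u n) / normc (u n) @[n --> \oo] --> (0 : R).
  rewrite -(mul0r (1 : R)^-1); apply: cvgM; first by case: uc.
  by apply: cvgV => //; exact: oner_neq0.
split; rewrite ?ReZr ?ImZr ?Rei ?Imi ?mul0r ?mul1r.
  rewrite -(@ln1 R); apply: continuous_cvg nc; exact: continuous_ln.
rewrite /clog /= /carg; under eq_fun do rewrite up.
rewrite -acos0; apply: continuous_cvg rc; apply: continuous_acos.
by rewrite ltr01 andbT oppr_lt0 ltr01.
Qed.

Lemma ccvg_invZ z : ccvg (fun n => z / n.+1%:R) 0.
Proof.
rewrite -(mulr0 z); apply: ccvgM; first exact: ccvg_cst.
have : (n.+1%:R : R)^-1 @[n --> \oo] --> (0 : R) by exact: cvg_harmonic.
move=> /ccvgR; apply: ccvg_eq; near=> n; by rewrite fmorphV rmorph_nat.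
Unshelve. all: by end_near. Qed.

Lemma ccvg_shift N (u : nat -> R[i]) z : ccvg (fun n => u (n + N)%N) z -> ccvg u z.
Proof. by move=> [h1 h2]; split; rewrite -(cvg_shiftn N). Qed.

(** Pulling out the factor [n] leaves the logarithm of [z / n + 'i], which tends to that of ['i]. *)
Lemma ccvg_clog_addi z : 0 < Re z ->
  ccvg (fun n => clogh (z + iR n.+1%:R) - (ln n.+1%:R)%:C) ('i * (pi / 2)%:C).
Proof.
move=> z0.
(* Beyond [N] the point [z / n + 'i] has nonnegative imaginary part, so [carg] stays in one branch
   of its definition. *)
have [N hN] : exists N : nat, normc z <= N%:R.
  by exists (Num.bound (normc z)); apply/ltW/archi_boundP; rewrite normc_ge0.
have uc : ccvg (fun n => z / (n + N).+1%:R + 'i) 'i.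
  rewrite -[X in ccvg _ X]add0r; apply: ccvgD; last exact: ccvg_cst.
  have [h1 h2] := ccvg_invZ z; split.
    exact: (cvg_comp _ (fun n => Re (z / n.+1%:R)) (cvg_addnr N)).
  exact: (cvg_comp _ (fun n => Im (z / n.+1%:R)) (cvg_addnr N)).
have /(ccvg_clog_i _) H := uc.
have {H} [n|h1 h2] := H _.
  rewrite ImD Imi -(rmorph_nat (real_complex R)) -fmorphV ImZr.
  have : `|Im z / (n + N).+1%:R| <= 1.
    rewrite normrM normfV (ger0_norm (ler0n _ _)) ler_pdivrMr ?ltr0n // mul1r.
    apply: (le_trans (Im_le_normc z)); apply: (le_trans hN).
    by rewrite ler_nat leqW // leq_addl.
  by rewrite ler_norml => /andP[h _]; rewrite -lerBlDr sub0r.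
have E n : clogh (z + iR (n + N).+1%:R) - (ln (n + N).+1%:R)%:C = clog (z / (n + N).+1%:R + 'i).
  set x : R := (n + N).+1%:R; have x0 : 0 < x by rewrite ltr0n.
  rewrite -clogE; last by rewrite ReD Re_iR addr0.
  have -> : z + iR x = x%:C * (z / (n + N).+1%:R + 'i).
    rewrite mulrDr /x !rmorph_nat mulrCA divff ?mulr1 ?pnatr_eq0 //.
    by rewrite /iR rmorph_nat mulrC.
  have v0 : z / (n + N).+1%:R + 'i != 0.
    apply: neq0_Re; rewrite ReD Rei addr0 -(rmorph_nat (real_complex R)) -fmorphV ReZr.
    exact: divr_gt0.
  by rewrite (clogZ x0 v0) [_%:C + clog _]addrC addrK.
apply: (@ccvg_shift N); under eq_fun do rewrite E.
by split.
Qed.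

Lemma conjD z w : conjc (z + w) = conjc z + conjc w.
Proof. by apply: eqC; rewrite !(Re_conj, Im_conj, ReD, ImD) ?opprD. Qed.

Lemma conjB z w : conjc (z - w) = conjc z - conjc w.
Proof. by apply: eqC; rewrite !(Re_conj, Im_conj, ReB, ImB) ?opprB // addrC opprK. Qed.

Lemma conjM z w : conjc (z * w) = conjc z * conjc w.
Proof. by apply: eqC; rewrite !(Re_conj, Im_conj, ReM, ImM); ring. Qed.

Lemma conjN z : conjc (- z) = - conjc z.
Proof. by apply: eqC; rewrite !(Re_conj, Im_conj, ReN, ImN). Qed.

Lemma conj_iR s : conjc (iR s) = - iR s.
Proof. by apply: eqC; rewrite !(Re_conj, Im_conj, ReN, ImN, Re_iR, Im_iR) ?oppr0. Qed.

Lemma clogh_conj z : clogh (conjc z) = conjc (clogh z).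
Proof.
by rewrite /clogh Re_conj Im_conj sqrrN mulNr atanN.
Qed.

Lemma ccvg_conj (u : nat -> R[i]) z : ccvg u z -> ccvg (fun n => conjc (u n)) (conjc z).
Proof.
move=> [h1 h2]; split; first by rewrite Re_conj; under eq_fun do rewrite Re_conj.
by rewrite Im_conj; under eq_fun do rewrite Im_conj; exact: cvgN.
Qed.

Lemma ccvg_clog_subi z : 0 < Re z ->
  ccvg (fun n => clogh (z - iR n.+1%:R) - (ln n.+1%:R)%:C) (- ('i * (pi / 2)%:C)).
Proof.
move=> z0; have := @ccvg_clog_addi (conjc z); rewrite Re_conj => /(_ z0) /ccvg_conj.
have -> : conjc ('i * (pi / 2)%:C) = - ('i * (pi / 2)%:C) :> R[i].
  by apply: eqC; rewrite ?Re_conj ?Im_conj !cE; ring.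
apply: ccvg_eq; near=> n.
by rewrite conjB conj_C -clogh_conj conjD conj_iR conjcK.
Unshelve. all: by end_near. Qed.

End PoissonKernel.

#[export] Hint Resolve cmeas_iR cmeas_poisson : cmeas.

(** * Poisson integrals of powers of resolvents *)

Section Lorentz.
Variable R : realType.
Implicit Types (z w : R[i]) (x y s T : R).
Local Open Scope classical_set_scope.

Lemma cintegral_line (f F : R -> R[i]) A B : (forall s, cder F s (f s)) ->
  (forall s, exists d, cder f s d) -> cmeas f -> cintble setT f ->
  ccvg (fun n => F (- n.+1%:R)) A -> ccvg (fun n => F n.+1%:R) B ->
  cintegral setT f = B - A.
Proof.
move=> dF df mf jf cA cB.
apply: (@cint_ftc _ setT f F (fun n => - n.+1%:R) (fun n => n.+1%:R)) => //.
- by move=> n; have : (0 : R) < n.+1%:R by []; lra.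
- move=> x _; exists (Num.bound `|x|) => // n /= xn.
  rewrite -ler_norml; apply: ltW; apply: (lt_le_trans (archi_boundP (normr_ge0 x))).
  by rewrite ler_nat leqW.
Qed.

Lemma clogh_diff_up z w : 0 < Re z -> 0 < Re w ->
  ccvg (fun n => clogh (z - iR n.+1%:R) - clogh (w + iR n.+1%:R)) (- ('i * pi%:C)).
Proof.
move=> z0 w0.
have -> : - ('i * pi%:C) = - ('i * (pi / 2)%:C) - 'i * (pi / 2)%:C :> R[i].
  by apply: eqC; rewrite !cE; lra.
apply: ccvg_eq (ccvgB (ccvg_clog_subi z0) (ccvg_clog_addi w0)); near=> n; ring.
Unshelve. all: by end_near. Qed.

Lemma clogh_diff_up0 z w : 0 < Re z -> 0 < Re w ->
  ccvg (fun n => clogh (z + iR n.+1%:R) - clogh (w + iR n.+1%:R)) 0.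
Proof.
move=> z0 w0; rewrite -(subrr ('i * (pi / 2)%:C)).
apply: ccvg_eq (ccvgB (ccvg_clog_addi z0) (ccvg_clog_addi w0)); near=> n; ring.
Unshelve. all: by end_near. Qed.

Lemma clogh_diff_down z w : 0 < Re z -> 0 < Re w ->
  ccvg (fun n => clogh (z + iR n.+1%:R) - clogh (w - iR n.+1%:R)) ('i * pi%:C).
Proof.
move=> z0 w0; rewrite -[X in ccvg _ X]opprK.
apply: ccvg_eq (ccvgN (clogh_diff_up w0 z0)); near=> n; ring.
Unshelve. all: by end_near. Qed.

Lemma clogh_diff_down0 z w : 0 < Re z -> 0 < Re w ->
  ccvg (fun n => clogh (z - iR n.+1%:R) - clogh (w - iR n.+1%:R)) 0.
Proof.
move=> z0 w0; rewrite -(subrr (- ('i * (pi / 2)%:C))).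
apply: ccvg_eq (ccvgB (ccvg_clog_subi z0) (ccvg_clog_subi w0)); near=> n; ring.
Unshelve. all: by end_near. Qed.

Lemma cder_clogh_addi z s : 0 < Re z -> cder (fun s => clogh (z + iR s)) s ('i / (z + iR s)).
Proof.
by move=> z0; apply: cder_clogh (cder_addi z s); rewrite ReD Re_iR addr0.
Qed.

Lemma cder_clogh_subi z s : 0 < Re z -> cder (fun s => clogh (z - iR s)) s (- 'i / (z - iR s)).
Proof.
by move=> z0; apply: cder_clogh (cder_subi z s); rewrite ReB Re_iR subr0.
Qed.

Lemma cder_poisson z s : 0 < Re z -> exists d, cder (poisson z) s d.
Proof.
move=> z0; eexists; rewrite /poisson.
apply: cderZ; apply: cderV; first exact: sqrD_neq0.
by apply: cderD; [exact: cder_cst|apply: cderX; exact: cder_id].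
Qed.

Lemma cintble_poisson z : 0 < Re z -> cintble setT (poisson z).
Proof.
move=> z0; apply: (cintble_le measurableT (cmeas_poisson z)
  (rintbleZ (poisson_cst z) measurableT (rintble_oneDsqrV R))) => s _.
exact: poisson_le.
Qed.

(** The Poisson formula for the constant 1: the primitive is ['i] times a difference of logarithms
    whose arguments tend to opposite right angles at each end. *)
Lemma cintegral_poisson z : 0 < Re z ->
  cintegral setT (poisson z) = 2%:R * pi%:C.
Proof.
move=> z0.
have e s : poisson z s = 'i * (- 'i / (z - iR s) - 'i / (z + iR s)).
  rewrite /poisson sqrDE mulrBr !mulrA mulrN ii.
  by field; rewrite addi_neq0 // subi_neq0.
rewrite (@cintegral_line _ (fun s => 'i * (clogh (z - iR s) - clogh (z + iR s)))
  ('i * ('i * pi%:C)) ('i * (- ('i * pi%:C)))).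
- by rewrite mulrN mulrA ii; ring.
- move=> s; rewrite e; apply: cderZ; apply: cderB.
    exact: cder_clogh_subi.
  exact: cder_clogh_addi.
- by move=> s; exact: cder_poisson.
- exact: cmeas_poisson.
- exact: cintble_poisson.
- apply: ccvgM; first exact: ccvg_cst.
  by apply: ccvg_eq (clogh_diff_down z0 z0); near=> n; rewrite iRN opprK.
- by apply: ccvgM; [exact: ccvg_cst|exact: clogh_diff_up].
Unshelve. all: by end_near. Qed.

Section Resolvent.
Variables (z : R[i]) (x : R).
Hypotheses (z0 : 0 < Re z) (x1 : 1 <= x) (xz : normc z < x).

Let g s : R[i] := (x%:C + iR s)^-1.
Let x0 : 0 < x. Proof. exact: lt_le_trans x1. Qed.
Let n0 s : x%:C + iR s != 0. Proof. exact: addi_neq0. Qed.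

Let g_cmeas : cmeas g. Proof. by rewrite /g; cmeas. Qed.

Let g_sqr s : normc (g s) ^+ 2 <= (1 + s ^+ 2)^-1.
Proof.
rewrite /g normcV exprVn lef_pV2 ?posrE ?onesqr_gt0 ?exprn_gt0 ?normc_gt0 //.
rewrite normcE2 ReD Re_iR ImD Im_iR /= addr0 add0r lerD2r.
by rewrite exprn_ege1.
Qed.

Let g_le1 s : normc (g s) <= 1.
Proof.
rewrite -(@ler_pXn2r _ 2) ?nnegrE ?normc_ge0 // expr1n.
by apply: (le_trans (g_sqr s)); rewrite invf_le1 ?onesqr_gt0 // lerDl sqr_ge0.
Qed.

Let gX_le1 n s : normc (g s ^+ n) <= 1.
Proof. by rewrite normcX exprn_ile1 ?normc_ge0. Qed.

Let dg n s : cder (fun s => g s ^+ n) s (- n%:R * 'i * g s ^+ n.+1).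
Proof.
have dV : cder g s (- 'i / (x%:C + iR s) ^+ 2) := cderV (n0 s) (cder_addi x%:C s).
apply: cder_eq (cderX n dV) _; rewrite -exprVn -/(g s).
case: n => [|n] /=; first by rewrite !mul0r oppr0 !mul0r.
by rewrite !exprS; ring.
Qed.

Let g_int n : cintble setT (fun s => g s ^+ n.+2).
Proof.
apply: (cintble_le measurableT (cmeasX _ g_cmeas) (rintble_oneDsqrV R)).
move=> s _; apply: le_trans (g_sqr s).
rewrite -addn2 exprD normcM [normc (g s ^+ 2)]normcX.
by apply: ler_piMl; [exact: sqr_ge0|exact: gX_le1].
Qed.

Let P_int n : cintble setT (fun s => g s ^+ n * poisson z s).
Proof. by apply: (cintble_poissonM z0 _ (gX_le1 n)); exact: cmeasX. Qed.

Let cvg_natV : (n.+1%:R : R)^-1 @[n --> \oo] --> (0 : R).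
Proof. exact: cvg_harmonic. Qed.

Let gX_lim (u : nat -> R) n : (forall k, `|u k| = k.+1%:R) -> ccvg (fun k => g (u k) ^+ n.+1) 0.
Proof.
move=> hu; apply: (ccvg_bound _ cvg_natV); near=> k.
rewrite subr0 exprS normcM -[leRHS]mulr1; apply: ler_pM => //; rewrite ?normc_ge0 ?gX_le1 //.
rewrite /g normcV lef_pV2 ?posrE ?normc_gt0 // -hu.
by apply: le_trans (Im_le_normc _); rewrite ImD Im_iR /= add0r.
Unshelve. all: by end_near. Qed.

Let g_int0 n : cintegral setT (fun s => g s ^+ n.+2) = 0.
Proof.
have c0 : n.+1%:R != 0 :> R[i] by rewrite pnatr_eq0.
rewrite (@cintegral_line _ (fun s => 'i / n.+1%:R * g s ^+ n.+1) 0 0) ?subr0 //.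
- move=> s; apply: cder_eq (cderZ _ (dg n.+1 s)) _.
  move: (n.+1%:R) c0 (g s ^+ n.+2) => c c0 G.
  transitivity (- ('i * 'i) * G * (c / c)); first by ring.
  by rewrite ii opprK mul1r divff // mulr1.
- by move=> s; eexists; exact: dg.
- exact: cmeasX.
- rewrite -(mulr0 ('i / n.+1%:R)); apply: ccvgM; first exact: ccvg_cst.
  by apply: gX_lim => k; rewrite normrN ger0_norm.
- rewrite -(mulr0 ('i / n.+1%:R)); apply: ccvgM; first exact: ccvg_cst.
  by apply: gX_lim => k; rewrite ger0_norm.
Qed.

Let xz0 : x%:C - z != 0.
Proof.
apply/eqP => /subr0_eq e; move: xz; rewrite -e normcR; have := ler_norm x; lra.
Qed.

Let xz1 : x%:C + z != 0.
Proof. by apply: neq0_Re; rewrite ReD /= addr_gt0. Qed.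

Let resolvent1 : cintegral setT (fun s => g s ^+ 1 * poisson z s) = 2%:R * pi%:C * (x%:C + z)^-1 ^+ 1.
Proof.
set A := (x%:C + z)^-1; set B := (x%:C - z)^-1.
(* Partial fractions of the product. Grouped in differences, the logarithms converge at both ends,
   and only the difference with opposite orientations contributes, by [-+ 'i * pi%:C]. *)
pose F s := 'i * (A * (clogh (z - iR s) - clogh (x%:C + iR s))
                  - B * (clogh (z + iR s) - clogh (x%:C + iR s))).
have dF s : cder F s (g s ^+ 1 * poisson z s).
  apply: cder_eq (cderZ 'i (cderB (cderZ A (cderB (cder_clogh_subi s z0) (cder_clogh_addi s _)))
    (cderZ B (cderB (cder_clogh_addi s z0) (cder_clogh_addi s _))))) _ => //.
  have E p q r (a b : R[i]) : 'i * (a * (- 'i * p - 'i * q) - b * ('i * r - 'i * q))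
      = - ('i * 'i) * (a * (p + q) + b * (r - q)) by ring.
  rewrite E ii opprK mul1r expr1 /g /poisson sqrDE /A /B.
  by field; rewrite addi_neq0 // subi_neq0 // n0 xz0 xz1.
rewrite (@cintegral_line _ F ('i * (A * ('i * pi%:C) - B * 0)) ('i * (A * (- ('i * pi%:C)) - B * 0))) //.
- rewrite (_ : _ - _ = - ('i * 'i) * (2%:R * pi%:C * A)); last ring.
  by rewrite ii opprK mul1r expr1.
- move=> s; have [d dP] := cder_poisson s z0; eexists; exact: (cderM (dg 1 s) dP).
- by apply: cmeasM; [exact: cmeasX|exact: cmeas_poisson].
- apply: ccvgM; first exact: ccvg_cst.
  apply: ccvgB; (apply: ccvgM; first exact: ccvg_cst).
    by apply: ccvg_eq (clogh_diff_down z0 (_ : 0 < Re x%:C)) => //; near=> n; rewrite iRN opprK.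
  by apply: ccvg_eq (clogh_diff_down0 z0 (_ : 0 < Re x%:C)) => //; near=> n; rewrite iRN.
- apply: ccvgM; first exact: ccvg_cst.
  apply: ccvgB; (apply: ccvgM; first exact: ccvg_cst).
    exact: clogh_diff_up.
  exact: clogh_diff_up0.
Unshelve. all: by end_near. Qed.

(** The Poisson formula for [w -> 1 / (x + w) ^ n]. Partial fractions give a three-term recurrence
    in [n], hence the induction on two consecutive cases. Its leading coefficient
    [z ^+ 2 - x%:C ^+ 2] is nonzero because [normc z < x]. *)
Lemma cintegral_poisson_resolvent n :
  cintegral setT (fun s => g s ^+ n * poisson z s) = 2%:R * pi%:C * (x%:C + z)^-1 ^+ n.
Proof.
suff [] : cintegral setT (fun s => g s ^+ n * poisson z s) = 2%:R * pi%:C * (x%:C + z)^-1 ^+ n /\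
  cintegral setT (fun s => g s ^+ n.+1 * poisson z s) = 2%:R * pi%:C * (x%:C + z)^-1 ^+ n.+1 by [].
elim: n => [|n [IH0 IH1]].
  split; last exact: resolvent1.
  by rewrite expr0 mulr1 -(cintegral_poisson z0); apply: cint_eq => s _; rewrite expr0 mul1r.
split=> //.
(* Partial fractions, from [z^2 + s^2 = z^2 - x^2 + 2 x (x + is) - (x + is)^2]. *)
have e s : g s ^+ n * poisson z s = (z ^+ 2 - x%:C ^+ 2) * (g s ^+ n.+2 * poisson z s) +
   (2%:R * x%:C * (g s ^+ n.+1 * poisson z s) - 2%:R * z * g s ^+ n.+2).
  have P : (z ^+ 2 + s%:C ^+ 2) * poisson z s = 2%:R * z.
    by rewrite /poisson mulrC divfK // sqrD_neq0.
  have G : g s * (x%:C + iR s) = 1 by rewrite /g mulVf.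
  have S : s%:C ^+ 2 = - iR s ^+ 2 by rewrite iR_sqr opprK.
  rewrite -[in 2%:R * z * _]P S !exprS.
  transitivity (g s ^+ n * poisson z s * (g s * (x%:C + iR s))); first by rewrite G mulr1.
  transitivity (g s ^+ n * poisson z s * (2%:R * x%:C * g s - g s * (x%:C + iR s) * (g s * (x%:C - iR s)))).
    by rewrite [in RHS]G; ring.
  ring.
have J1 := cintbleZ (z ^+ 2 - x%:C ^+ 2) measurableT (P_int n.+2).
have J2 := cintbleZ (2%:R * x%:C) measurableT (P_int n.+1).
have J3 := cintbleZ (2%:R * z) measurableT (g_int n).
have := IH0; rewrite (cint_eq (fun s _ => e s)).
rewrite (cintD measurableT J1 (cintbleB measurableT J2 J3)) (cintB measurableT J2 J3).
rewrite (cintZ _ measurableT (P_int n.+2)) (cintZ _ measurableT (P_int n.+1)).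
rewrite (cintZ _ measurableT (g_int n)) g_int0 mulr0 subr0 IH1 => H.
have D0 : z ^+ 2 - x%:C ^+ 2 != 0.
  rewrite subr_sqr; apply: mulf_neq0; last by rewrite addrC.
  by rewrite -oppr_eq0 opprB.
apply: (mulfI D0); rewrite (canRL (addrK _) H).
rewrite !exprS; field; exact: xz1.
Qed.

End Resolvent.
End Lorentz.

(** * Poisson integrals of exponentials and of Laplace transforms *)

Section LorentzIntegral.
Variable R : realType.
Implicit Types (z w : R[i]) (x y s T : R).
Local Open Scope classical_set_scope.

Lemma normc_1addi_ge1 (t : R) : 1 <= normc (1 + iR t).
Proof. by have := normc_addi_ge 1 t; rewrite Re1. Qed.

Lemma natRC n : (n%:R : R[i]) = (n%:R : R)%:C.
Proof. by rewrite rmorph_nat. Qed.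

(** The Poisson formula for [exp (- T w)], the limit of [(1 + w T / n) ^ (- n)]. These functions are
    powers of [x / (x + w)] with [x = n / T], hence resolvents, and have modulus at most 1 on the
    axis, so that dominated convergence applies. *)
Lemma cintegral_Lorentz z T : 0 < Re z -> 0 <= T ->
  cintegral setT (fun s => cexp (- (iR s * T%:C)) * poisson z s) = 2%:R * pi%:C * cexp (- (z * T%:C)).
Proof.
move=> z0; rewrite le_eqVlt => /predU1P[<-|T0].
  rewrite mulr0 oppr0 cexp0 mulr1 -(cintegral_poisson z0); apply: cint_eq => s _.
  by rewrite mulr0 oppr0 cexp0 mul1r.
pose F n s := ((1 + iR s * T%:C / n.+1%:R) ^+ n.+1)^-1 * poisson z s.
have Fe n s : 1 + iR s * T%:C / n.+1%:R = 1 + iR (s * T / n.+1%:R).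
  by rewrite /iR !rmorphM /= fmorphV natRC !mulrA.
have Fn1 n s : normc ((1 + iR s * T%:C / n.+1%:R) ^+ n.+1)^-1 <= 1.
  rewrite normcV normcX Fe invf_le1 ?exprn_ege1 ?normc_1addi_ge1 //.
  by rewrite exprn_gt0 // (lt_le_trans _ (normc_1addi_ge1 _)).
have [_ cF] : cintble setT (fun s => cexp (- (iR s * T%:C)) * poisson z s) /\
   ccvg (fun n => cintegral setT (F n)) (cintegral setT (fun s => cexp (- (iR s * T%:C)) * poisson z s)).
  apply: (cint_dct (k := fun s => poisson_cst z * (1 + s ^+ 2)^-1)) => //.
  - by move=> n; rewrite /F; cmeas.
  - by cmeas.
  - move=> s _; apply: ccvgM; last exact: ccvg_cst.
    rewrite cexpN; apply: ccvgV; first exact: cexp_neq0.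
    exact: ccvg_1Dexp.
  - by apply: rintbleZ => //; exact: rintble_oneDsqrV.
  - move=> n s _; rewrite /F -[leRHS]mul1r; apply: normcM_le; first exact: Fn1.
    exact: poisson_le.
apply: (ccvg_unique cF).
have : ccvg (fun n => 2%:R * pi%:C * ((1 + z * T%:C / n.+1%:R) ^+ n.+1)^-1)
   (2%:R * pi%:C * cexp (- (z * T%:C))).
  apply: ccvgM; first exact: ccvg_cst.
  by rewrite cexpN; apply: ccvgV; [exact: cexp_neq0|exact: ccvg_1Dexp].
apply: ccvg_eq.
(* From here on [x = n.+1%:R / T] exceeds [1 + normc z], which meets both conditions of the
   resolvent formula. *)
exists (Num.bound ((1 + normc z) * T)) => // n /= nN.
have nT : (1 + normc z) * T < n.+1%:R.
  apply: (lt_le_trans (archi_boundP _)); last by rewrite ler_nat leqW.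
  by rewrite mulr_ge0 ?(ltW T0) // addr_ge0 ?normc_ge0.
set x := n.+1%:R / T.
have xn : 1 + normc z < x by rewrite ltr_pdivlMr.
have x1 : 1 <= x by have := normc_ge0 z; lra.
have xz : normc z < x by lra.
have xx : x%:C != 0 by apply: neq0_Re => /=; lra.
have E w : 0 <= Re w -> (1 + w * T%:C / n.+1%:R)^-1 = x%:C * (x%:C + w)^-1.
  move=> w0; have xw : x%:C + w != 0 by apply: neq0_Re; rewrite ReD /=; lra.
  have TC : T%:C != 0 by apply: neq0_Re.
  rewrite /x rmorphM fmorphV /= natRC in xx xw *.
  have n1 : (n.+1%:R : R)%:C != 0 by apply: neq0_Re => /=.
  move: {n nN nT x xn x1 xz}((n.+1%:R : R)%:C) T%:C n1 TC xw {xx} => c t c0 t0 ct0.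
  have ct1 : w * t + c != 0 by apply: contraNneq ct0 => h; apply/eqP; apply: (mulIf t0); rewrite mul0r mulrDl divfK // addrC.
  have -> : 1 + w * t / c = (w * t + c) / c by field.
  by field; rewrite t0 addrC ct1.
rewrite -exprVn E ?(ltW z0) // exprMn mulrCA -(cintegral_poisson_resolvent z0 x1 xz).
rewrite -cintZ //; last first.
  apply: (@cintble_poissonM _ z _ 1 z0).
    by cmeas.
  move=> s; rewrite normcX exprn_ile1 ?normc_ge0 // normcV invf_le1.
    by apply: (le_trans x1); have := normc_addi_ge x%:C s.
  by rewrite normc_gt0 // addi_neq0 //=; lra.
apply: cint_eq => s _; rewrite /F -exprVn E; last by rewrite Re_iR.
by rewrite exprMn mulrA.
Qed.

Lemma cexpN_addM w x y : cexp (- (w * (x + y)%:C)) = cexp (- (w * x%:C)) * cexp (- (w * y%:C)).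
Proof. by rewrite -cexpD -opprD -mulrDr -rmorphD. Qed.

Definition lap (c : R -> R) w : R[i] :=
  cintegral `]0, +oo[ (fun t => (c t)%:C * cexp (- (w * t%:C))).

Definition kernel (c : R -> R) := measurable_fun setT c /\ rintble `]0, +oo[ c.

Lemma normc_cexpN_le1 w t : 0 <= Re w -> 0 <= t -> normc (cexp (- (w * t%:C))) <= 1.
Proof.
by move=> w0 t0; rewrite normc_cexp ReN ReZr -expR0 ler_expR oppr_le0 mulr_ge0.
Qed.

Lemma gt0_itv (t : R) : `]0, +oo[ t -> 0 < t.
Proof. by rewrite /= in_itv /= andbT. Qed.

Lemma cintble_lap c w : kernel c -> 0 <= Re w ->
  cintble `]0, +oo[ (fun t => (c t)%:C * cexp (- (w * t%:C))).
Proof.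
move=> [mc ic] w0; apply: (cintble_le _ _ (rintble_norm _ ic)) => //.
  by cmeas.
move=> t /gt0_itv t0; rewrite -[leRHS]mulr1; apply: normcM_le; first by rewrite normcR.
by apply: normc_cexpN_le1 => //; exact: ltW.
Qed.

Lemma lap_le c w : kernel c -> 0 <= Re w ->
  normc (lap c w) <= \int[mu]_(t in `]0, +oo[) `|c t|.
Proof.
move=> kc w0; apply: cint_norm_le => //; first exact: cintble_lap.
  by apply: rintble_norm => //; case: kc.
move=> t /gt0_itv t0; rewrite -[leRHS]mulr1; apply: normcM_le; first by rewrite normcR.
by apply: normc_cexpN_le1 => //; exact: ltW.
Qed.

Lemma kernelN c : kernel c -> kernel (fun t => - c t).
Proof.
move=> [mc ic]; split; first exact: measurable_funN.
exact: rintbleN.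
Qed.

Lemma lapN c w : kernel c -> 0 <= Re w -> lap (fun t => - c t) w = - lap c w.
Proof.
move=> kc w0; rewrite -cintN //; last exact: cintble_lap.
by apply: cint_eq => t _; rewrite rmorphN mulNr.
Qed.

Lemma lap_conj c w : kernel c -> 0 <= Re w -> lap c (conjc w) = conjc (lap c w).
Proof.
move=> kc w0; rewrite -cint_conj //; last exact: cintble_lap.
apply: cint_eq => t _; rewrite conjM -cexp_conj conj_C; congr (_ * cexp _).
by rewrite conjN conjM conj_C.
Qed.

(** Measurability of a parameter integral is read off Fubini. The weight [(1 + s ^+ 2)^-1] makes the
    integrand integrable in both variables and is divided out at the end. *)
Lemma cmeas_lap_iR c : kernel c -> cmeas (fun s => lap c (iR s)).
Proof.
move=> [mc ic].
pose f (p : R * R) := ((1 + p.1 ^+ 2)^-1)%:C * ((c p.2)%:C * cexp (- (iR p.1 * p.2%:C))).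
have mf : cmeas f.
  rewrite /f; cmeas.
  - exact: (measurableT_comp (continuous_measurable_fun (@continuous_inv_onesqr R)) measurable_fst).
  - exact: (measurableT_comp mc measurable_snd).
  - exact: (cmeas_comp (@cmeas_iR R) measurable_fst).
have fb (s t : R) : setT s -> `]0, +oo[ t -> normc (f (s, t)) <= (1 + s ^+ 2)^-1 * `|c t|.
  move=> _ /gt0_itv t0; rewrite /f [(_, _).1]/= [(_, _).2]/=; apply: normcM_le.
    by rewrite normcR ger0_norm // invr_ge0 ltW // onesqr_gt0.
  rewrite -[leRHS]mulr1; apply: normcM_le; first by rewrite normcR.
  by apply: normc_cexpN_le1; [rewrite Re_iR|exact: ltW].
have [[i1 i2] _] := cint_fubini measurableT (measurable_itv _) mf
  (rintble_oneDsqrV R) (rintble_norm (measurable_itv _) ic) fb.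
have m : cmeas (fun s => cintegral `]0, +oo[ (fun t => f (s, t))).
  by split; apply/measurable_EFinP; [exact: measurable_int i1|exact: measurable_int i2].
have -> : (fun s => lap c (iR s)) = (fun s => (1 + s ^+ 2)%:C * cintegral `]0, +oo[ (fun t => f (s, t))).
  apply/funext => s.
  rewrite (_ : cintegral _ _ = ((1 + s ^+ 2)^-1)%:C * lap c (iR s)); last first.
    by rewrite -cintZ //; apply: cintble_lap; rewrite ?Re_iR.
  by rewrite mulrA -rmorphM divff ?mul1r // gt_eqF // onesqr_gt0.
have m1 : measurable_fun setT (fun s : R => 1 + s ^+ 2).
  by apply: measurable_funD => //; exact: measurable_funX.
exact: (cmeasM (cmeasR m1) m).
Qed.

Hint Resolve cmeas_lap_iR : cmeas.

Section HardyClass.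
Variable z : R[i].
Hypothesis z0 : 0 < Re z.

(* Boundary values on the imaginary axis of a bounded function that is the
   Poisson integral of these values, even after multiplication by exp(-T w). *)
Definition hardy (q : R -> R[i]) (qz : R[i]) :=
  [/\ cmeas q, exists M, forall s, normc (q s) <= M &
    forall T, 0 <= T -> cintegral setT (fun s => q s * (cexp (- (iR s * T%:C)) * poisson z s))
      = 2%:R * pi%:C * (qz * cexp (- (z * T%:C)))].

Let Pint T q M : 0 <= T -> cmeas q -> (forall s, normc (q s) <= M) ->
  cintble setT (fun s => q s * (cexp (- (iR s * T%:C)) * poisson z s)).
Proof.
move=> T0 mq qM; apply: (cintble_le (h := fun s => M * poisson_cst z * (1 + s ^+ 2)^-1)) => //.
- by cmeas.
- by apply: rintbleZ => //; exact: rintble_oneDsqrV.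
- move=> s _; rewrite -mulrA; apply: normcM_le => //.
  rewrite -[leRHS]mul1r; apply: normcM_le; last exact: poisson_le.
  by apply: normc_cexpN_le1; rewrite ?Re_iR.
Qed.

Lemma hardy_cst a : hardy (fun=> a) a.
Proof.
split; [exact: cmeas_cst|by exists (normc a)|].
move=> T T0; rewrite cintZ //; last first.
  have := @Pint T (fun=> 1) 1 T0 (cmeas_cst _ _); under eq_fun do rewrite mul1r.
  by apply=> s; rewrite normc1.
by rewrite cintegral_Lorentz // mulrCA.
Qed.

Lemma hardyD q r a b : hardy q a -> hardy r b -> hardy (fun s => q s + r s) (a + b).
Proof.
move=> [mq [M qM] hq] [mr [N rN] hr]; split; first exact: cmeasD.
  by exists (M + N) => s; exact: normcD_le.
move=> T T0; rewrite [(a + b) * _]mulrDl [RHS]mulrDr -hq // -hr // -cintD //.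
- by apply: cint_eq => s _; rewrite mulrDl.
- exact: Pint qM.
- exact: Pint rN.
Qed.

Lemma hardyZ k q a : hardy q a -> hardy (fun s => k * q s) (k * a).
Proof.
move=> [mq [M qM] hq]; split; first by cmeas.
  by exists (normc k * M) => s; rewrite normcM ler_wpM2l ?normc_ge0.
move=> T T0; rewrite -[k * a * _]mulrA [RHS]mulrCA -hq // -cintZ //; last exact: Pint qM.
by apply: cint_eq => s _; rewrite -[k * _ * _]mulrA.
Qed.

Lemma hardy_sum n (q : 'I_n -> R -> R[i]) (a : 'I_n -> R[i]) :
  (forall i, hardy (q i) (a i)) -> hardy (fun s => \sum_(i < n) q i s) (\sum_(i < n) a i).
Proof.
elim: n q a => [|n IH] q a h.
  by rewrite big_ord0; under eq_fun do rewrite big_ord0; exact: hardy_cst.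
rewrite big_ord_recr; under eq_fun do rewrite big_ord_recr.
by apply: hardyD => //; exact: IH.
Qed.

(** By Fubini, the factor [exp (- t w)] under the Laplace integral merges with [exp (- T w)] into
    [exp (- (T + t) w)]. This is why [hardy] quantifies over all [T]. *)
Lemma hardy_lap c q a : kernel c -> hardy q a ->
  hardy (fun s => q s * lap c (iR s)) (a * lap c z).
Proof.
move=> kc [mq [M qM] hq]; have [mc ic] := kc.
have M0 : 0 <= M by apply: le_trans (qM 0); exact: normc_ge0.
split; first by cmeas.
  exists (M * (\int[mu]_(t in `]0, +oo[) `|c t|)) => s; apply: normcM_le => //.
  by apply: lap_le => //; rewrite Re_iR.
move=> T T0.
pose f (p : R * R) := q p.1 * (cexp (- (iR p.1 * T%:C)) * poisson z p.1) *
  ((c p.2)%:C * cexp (- (iR p.1 * p.2%:C))).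
have mf : cmeas f.
  rewrite /f; cmeas.
  - exact: (cmeas_comp mq measurable_fst).
  - exact: (cmeas_comp (@cmeas_iR R) measurable_fst).
  - exact: (cmeas_comp (cmeas_poisson z) measurable_fst).
  - exact: (measurableT_comp mc measurable_snd).
  - exact: (cmeas_comp (@cmeas_iR R) measurable_fst).
have fb (s t : R) : setT s -> `]0, +oo[ t ->
    normc (f (s, t)) <= (M * poisson_cst z * (1 + s ^+ 2)^-1) * `|c t|.
  move=> _ /gt0_itv t0; rewrite /f [(_, _).1]/= [(_, _).2]/=; apply: normcM_le.
    rewrite -[leRHS]mulrA; apply: normcM_le => //.
    rewrite -[leRHS]mul1r; apply: normcM_le; last exact: poisson_le.
    by apply: normc_cexpN_le1; rewrite ?Re_iR.
  rewrite -[leRHS]mulr1; apply: normcM_le; first by rewrite normcR.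
  by apply: normc_cexpN_le1; [rewrite Re_iR|exact: ltW].
have [_ fub] := cint_fubini measurableT (measurable_itv _) mf
  (rintbleZ (M * poisson_cst z) measurableT (rintble_oneDsqrV R)) (rintble_norm (measurable_itv _) ic) fb.
transitivity (cintegral setT (fun s => cintegral `]0, +oo[ (fun t => f (s, t)))).
  apply: cint_eq => s _.
  transitivity (q s * (cexp (- (iR s * T%:C)) * poisson z s) * lap c (iR s)); first by ring.
  have s0 : 0 <= Re (iR s) by rewrite Re_iR.
  exact: (esym (cintZ (q s * (cexp (- (iR s * T%:C)) * poisson z s)) (measurable_itv _) (cintble_lap kc s0))).
rewrite fub.
transitivity (cintegral `]0, +oo[ (fun t => 2%:R * pi%:C * a * cexp (- (z * T%:C)) *
   ((c t)%:C * cexp (- (z * t%:C))))).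
  apply: cint_eq => t /gt0_itv t0.
  transitivity (cintegral setT (fun s => (c t)%:C * (q s * (cexp (- (iR s * (T + t)%:C)) * poisson z s)))).
    apply: cint_eq => s _; rewrite /f [(_, _).1]/= [(_, _).2]/= cexpN_addM; ring.
  have Tt : 0 <= T + t by exact: addr_ge0 T0 (ltW t0).
  rewrite (cintZ (c t)%:C measurableT (Pint Tt mq qM)) (hq _ Tt).
  by rewrite cexpN_addM; ring.
rewrite (cintZ _ (measurable_itv _) (cintble_lap kc (ltW z0))).
by rewrite -/(lap c z); ring.
Qed.

Lemma hardy_lim (q : nat -> R -> R[i]) (a : nat -> R[i]) r b M :
  (forall n, hardy (q n) (a n)) -> (forall n s, normc (q n s) <= M) ->
  (forall s, ccvg (q^~ s) (r s)) -> ccvg a b -> hardy r b.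
Proof.
move=> hq qM qr ab.
have mr : cmeas r by apply: cmeas_lim qr => n; case: (hq n).
split=> //.
  by exists M => s; apply: (ccvg_le (qr s) (cvg_cst M)).
move=> T T0.
have [_ c] : cintble setT (fun s => r s * (cexp (- (iR s * T%:C)) * poisson z s)) /\
   ccvg (fun n => cintegral setT (fun s => q n s * (cexp (- (iR s * T%:C)) * poisson z s)))
        (cintegral setT (fun s => r s * (cexp (- (iR s * T%:C)) * poisson z s))).
  apply: (cint_dct (k := fun s => M * poisson_cst z * (1 + s ^+ 2)^-1)) => //.
  - by move=> n; have [mq _ _] := hq n; cmeas.
  - by cmeas.
  - by move=> s _; apply: ccvgM => //; exact: ccvg_cst.
  - by apply: rintbleZ => //; exact: rintble_oneDsqrV.
  - move=> n s _; rewrite -mulrA; apply: normcM_le => //.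
    rewrite -[leRHS]mul1r; apply: normcM_le; last exact: poisson_le.
    by apply: normc_cexpN_le1; rewrite ?Re_iR.
apply: (ccvg_unique c).
have -> : (fun n => cintegral setT (fun s => q n s * (cexp (- (iR s * T%:C)) * poisson z s))) =
          (fun n => 2%:R * pi%:C * (a n * cexp (- (z * T%:C)))).
  by apply/funext => n; have [_ _ h] := hq n; exact: h.
by apply: ccvgM; [exact: ccvg_cst|apply: ccvgM => //; exact: ccvg_cst].
Qed.

Lemma hardy_1DX c n k : kernel c ->
  hardy (fun s => (1 + lap c (iR s) / n.+1%:R) ^+ k) ((1 + lap c z / n.+1%:R) ^+ k).
Proof.
move=> kc; elim: k => [|k IH].
  by rewrite expr0; under eq_fun do rewrite expr0; exact: hardy_cst.
have e (l v p : R[i]) : (1 + l * v) * p = p + v * (p * l) by ring.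
rewrite exprS e; under eq_fun do rewrite exprS e.
by apply: hardyD => //; apply: hardyZ; exact: hardy_lap.
Qed.

Lemma hardy_cexp c : kernel c -> hardy (fun s => cexp (lap c (iR s))) (cexp (lap c z)).
Proof.
move=> kc; set M := (\int[mu]_(t in `]0, +oo[) `|c t|).
apply: (@hardy_lim _ _ _ _ (expR M) (fun n => hardy_1DX n n.+1 kc)).
- move=> n s; apply: (le_trans (normc_1Dexp_le _ _)); rewrite ler_expR.
  by apply: lap_le => //; rewrite Re_iR.
- by move=> s; exact: ccvg_1Dexp.
- exact: ccvg_1Dexp.
Qed.

(* The factor w is absorbed through w L(w) = a + L'(w), an integration by parts. *)
Lemma hardy_mul_cexp c c' (a : R[i]) : kernel c -> kernel c' ->
  (forall s, iR s * lap c (iR s) = a + lap c' (iR s)) -> z * lap c z = a + lap c' z ->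
  hardy (fun s => iR s * (cexp (lap c (iR s)) - 1)) (z * (cexp (lap c z) - 1)).
Proof.
move=> kc kc' hi hz.
set M := (\int[mu]_(t in `]0, +oo[) `|c t|); set M' := (\int[mu]_(t in `]0, +oo[) `|c' t|).
(* [L * S L n] is [(1 + L / n.+1%:R) ^+ n.+1 - 1] by the geometric sum, so the unbounded [w] only
   meets the factor [L]. Each of the [n.+1] summands has modulus at most [expR M], hence so does
   their mean [S]. *)
pose S (L : R[i]) n := n.+1%:R^-1 * \sum_(k < n.+1) (1 + L / n.+1%:R) ^+ k.
have SE w L n : w * ((1 + L / n.+1%:R) ^+ n.+1 - 1) = w * L * S L n.
  by rewrite subrX1 /S addrC addKr; ring.
have Hs n : hardy (fun s => (a + lap c' (iR s)) * S (lap c (iR s)) n) ((a + lap c' z) * S (lap c z) n).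
  have hS : hardy (fun s => S (lap c (iR s)) n) (S (lap c z) n).
    by apply: hardyZ; apply: hardy_sum => i; exact: hardy_1DX.
  rewrite mulrDl [lap c' z * _]mulrC.
  under eq_fun do rewrite mulrDl [lap c' _ * _]mulrC.
  by apply: hardyD; [exact: hardyZ|exact: hardy_lap].
apply: (@hardy_lim _ _ _ _ ((normc a + M') * expR M) Hs).
- move=> n s; apply: normcM_le.
    by apply: normcD_le => //; apply: lap_le => //; rewrite Re_iR.
  have LM : normc (lap c (iR s)) <= M by apply: lap_le => //; rewrite Re_iR.
  rewrite /S normcM normcV normc_nat ler_pdivrMl ?ltr0n //.
  apply: (le_trans (normc_sum _)).
  apply: (@le_trans _ _ (\sum_(k < n.+1) expR M)); last first.
    by rewrite sumr_const card_ord mulr_natl.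
  apply: ler_sum => k _; rewrite normcX.
  have h1 : normc (1 + lap c (iR s) / n.+1%:R) <= 1 + M / n.+1%:R.
    apply: normcD_le; rewrite ?normc1 // normc_div normc_nat.
    by rewrite ler_pM2r // invr_gt0 ltr0n.
  have M0 : 0 <= M by apply: le_trans LM; exact: normc_ge0.
  have g1 : 1 <= 1 + M / n.+1%:R by rewrite lerDl divr_ge0.
  apply: (@le_trans _ _ ((1 + M / n.+1%:R) ^+ k)).
    by apply: lerXn2r; rewrite ?nnegrE ?normc_ge0 //; exact: le_trans g1.
  apply: (@le_trans _ _ ((1 + M / n.+1%:R) ^+ n.+1)).
    by apply: ler_weXn2l => //; apply: ltnW.
  have := normc_1Dexp_le M%:C n; rewrite normcX normcR (ger0_norm M0) natRC -fmorphV -rmorphM.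
  by rewrite -(rmorph1 (real_complex R)) -rmorphD normcR ger0_norm //; exact: le_trans g1.
- move=> s; rewrite -hi; under eq_fun do rewrite -SE.
  by apply: ccvgM; [exact: ccvg_cst|apply: ccvgB; [exact: ccvg_1Dexp|exact: ccvg_cst]].
- rewrite -hz; under eq_fun do rewrite -SE.
  by apply: ccvgM; [exact: ccvg_cst|apply: ccvgB; [exact: ccvg_1Dexp|exact: ccvg_cst]].
Qed.

End HardyClass.

End LorentzIntegral.

(** * Stieltjes transforms and their remainders *)

Section StieltjesExpansion.
Variable R : realType.
Implicit Types (z w : R[i]) (x y s T : R) (A : R -> R).
Local Open Scope classical_set_scope.

Definition cscfac z : R := if pi / 4 < `|carg z| then `|(sin (2 * carg z))^-1| else 1.

Lemma polarE z : z != 0 -> z = (normc z)%:C * (cos (carg z) +i* sin (carg z)).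
Proof.
move=> z0; rewrite -{1}(cexp_clog z0) /cexp /clog /=.
by rewrite lnK // posrE normc_gt0.
Qed.

(** Distance from [z ^+ 2], of argument [2 t], to the point [- s ^+ 2] of the negative half-line. If
    [cos (2 t) >= 0] the nearest point of the half-line is 0; otherwise the distance is at least the
    imaginary part [normc z ^+ 2 * |sin (2 t)|]. *)
Lemma normc_sqr_le z s : 0 < Re z -> normc z ^+ 2 <= cscfac z * normc (z ^+ 2 + s%:C ^+ 2).
Proof.
move=> z0; have nz : z != 0 by exact: neq0_Re.
have r0 := normc_gt0 nz; set r := normc z; set t := carg z.
have zE : z ^+ 2 = (r ^+ 2)%:C * (cos (2 * t) +i* sin (2 * t)).
  rewrite {1}(polarE nz) -/r -/t exprMn rmorphXn; congr (_ * _).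
  have -> : 2 * t = t *+ 2 by rewrite mulr_natl.
  apply: eqC; rewrite expr2 ?(ReM, ImM) /= ?cos_mulr2n ?sin_mulr2n.
    by have := cos2Dsin2 t; rewrite !expr2; lra.
  by ring.
rewrite /cscfac -/t; case: ifP => [t4|/negbT].
  (* A vanishing sine would turn the inverse into 0 by convention and spoil the bound. It is
     excluded: [cos t > 0] would force [t = 0]. *)
  have [s0|s0] := eqVneq (sin (2 * t)) 0.
    have c0 : 0 < cos t.
      by move: z0; rewrite {1}(polarE nz) -/r -/t ReZl /= pmulr_rgt0.
    have /eqP := s0; rewrite mulr_natl sin_mulr2n -mulr_natl !mulf_eq0 pnatr_eq0 /= gt_eqF //= => /eqP st.
    have t2 : `|t| <= pi / 2 by exact: Re_clog_gt z0.
    have p0 := @pi_gt0 R.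
    have tz : t = 0.
      apply: sin_inj; rewrite ?sin0 // in_itv /=; first by rewrite -ler_norml.
      by apply/andP; split; lra.
    by move: t4; rewrite tz normr0; lra.
  rewrite normfV ler_pdivlMl ?normr_gt0 // mulrC -[r ^+ 2]ger0_norm ?sqr_ge0 // -normrM.
  apply: le_trans (Im_le_normc _).
  by rewrite ImD -rmorphXn ImC addr0 zE ImZl.
rewrite -leNgt mul1r ler_norml => /andP[t1 t2].
have c0 : 0 <= cos (2 * t).
  by apply: cos_ge0_pihalf; apply/andP; split; lra.
rewrite -(ler_pXn2r (_ : (0 < 2)%N)) ?nnegrE ?normc_ge0 ?sqr_ge0 //.
rewrite [normc (_ + _) ^+ 2]normcE2 -rmorphXn ReD ImD ReC ImC addr0 zE ReZl ImZl /=.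
have := cos2Dsin2 (2 * t); move: (cos (2 * t)) (sin (2 * t)) c0 => c d c0 e.
have -> : r ^+ 2 ^+ 2 = (r ^+ 2 * c) ^+ 2 + (r ^+ 2 * d) ^+ 2 by rewrite !exprMn -mulrDr e mulr1.
have rc : 0 <= r ^+ 2 * c by rewrite mulr_ge0 // sqr_ge0.
rewrite lerD2r; apply: lerXn2r; rewrite ?nnegrE // ?addr_ge0 ?sqr_ge0 //.
by rewrite lerDl sqr_ge0.
Qed.

Lemma poisson_le_csc z s : 0 < Re z -> normc (poisson z s) <= 2 * cscfac z / normc z.
Proof.
move=> z0; have r0 : 0 < normc z by rewrite normc_gt0 // neq0_Re.
rewrite /poisson normc_div normcM normc_nat ler_pdivrMr ?normc_gt0 ?sqrD_neq0 //.
rewrite -!mulrA ler_pM2l // mulrCA ler_pdivlMl // -expr2; exact: normc_sqr_le.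
Qed.

(** Normalised so that [(-1) ^+ j * moment A j] is the coefficient of [z ^- (2j + 1)] in
    [stieltjes A z]. *)
Definition moment A j : R := (\int[mu]_s (s ^+ j.*2 * A s)) / pi.

Definition stieltjes A z : R[i] :=
  cintegral setT (fun s => (A s)%:C * poisson z s) / (2%:R * pi%:C).

Definition moments_finite A :=
  measurable_fun setT A /\ forall j, rintble setT (fun s => s ^+ j.*2 * A s).

Lemma moments_finite_sqr A : moments_finite A -> moments_finite (fun s => s ^+ 2 * A s).
Proof.
move=> [mA iA]; split.
  by apply: measurable_funM => //; exact: measurable_funX.
move=> j; have := iA j.+1; apply: rintble_eq => // s _.
by rewrite mulrA -exprD doubleS addn2.
Qed.

Lemma moment_sqr A j : moment (fun s => s ^+ 2 * A s) j = moment A j.+1.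
Proof.
congr (_ / _); apply: eq_Rintegral => s _.
by rewrite mulrA -exprD doubleS addn2.
Qed.

Lemma cintble_stieltjes A z : 0 < Re z -> moments_finite A ->
  cintble setT (fun s => (A s)%:C * poisson z s).
Proof.
move=> z0 [mA iA].
have i0 : rintble setT A by have := iA 0%N; apply: rintble_eq => // s _; rewrite expr0 mul1r.
apply: (cintble_le measurableT _ (rintbleZ (2 * cscfac z / normc z) measurableT (rintble_norm measurableT i0))).
  by cmeas.
by move=> s _; rewrite mulrC; apply: normcM_le; [exact: poisson_le_csc|rewrite normcR].
Qed.

Lemma pi_neq0 : pi%:C != 0 :> R[i].
Proof. by apply: neq0_Re => /=; exact: pi_gt0. Qed.

Lemma stieltjes_step A z : 0 < Re z -> moments_finite A ->
  stieltjes A z = (moment A 0)%:C / z - stieltjes (fun s => s ^+ 2 * A s) z / z ^+ 2.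
Proof.
move=> z0 fA; have fA2 := moments_finite_sqr fA.
have nz : z != 0 by exact: neq0_Re.
have i0 : rintble setT A.
  by case: fA => _ iA; have := iA 0%N; apply: rintble_eq => // s _; rewrite expr0 mul1r.
have e s : (A s)%:C * poisson z s = 2%:R / z * (A s)%:C - (z ^+ 2)^-1 * ((s ^+ 2 * A s)%:C * poisson z s).
  rewrite /poisson rmorphM rmorphXn; field; by rewrite nz sqrD_neq0.
have iC := cintbleR measurableT i0.
have iS := cintble_stieltjes z0 fA2.
rewrite {1}/stieltjes (cint_eq (fun s _ => e s)).
rewrite (cintB measurableT (cintbleZ _ measurableT iC) (cintbleZ _ measurableT iS)).
rewrite (cintZ _ measurableT iC) (cintZ _ measurableT iS) cintR.
have -> : (moment A 0)%:C = (\int[mu]_s A s)%:C / pi%:C.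
  rewrite /moment rmorphM fmorphV; congr (_%:C / _).
  by apply: eq_Rintegral => s _; rewrite expr0 mul1r.
rewrite /stieltjes; set I := cintegral _ _; set J := (X in X%:C / pi%:C).
by have := pi_neq0; move: (pi%:C) => p p0; field; rewrite nz p0.
Qed.

(** The finite geometric expansion of [1 / (z ^+ 2 + s ^+ 2)] leaves an exact remainder, again a
    Stieltjes transform, whose density has gained the factor [s ^+ J.*2]. *)
Lemma stieltjes_expansion A z J : 0 < Re z -> moments_finite A ->
  stieltjes A z - \sum_(j < J) (-1) ^+ j * (moment A j)%:C / z ^+ j.*2.+1 =
  (-1) ^+ J * stieltjes (fun s => s ^+ J.*2 * A s) z / z ^+ J.*2.
Proof.
move=> z0; have nz : z != 0 by exact: neq0_Re.
elim: J A => [|J IH] A fA.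
  rewrite big_ord0 !expr0 mul1r subr0 divr1; congr (_ / _).
  by apply: cint_eq => s _; rewrite expr0 mul1r.
have := IH _ (moments_finite_sqr fA); under eq_bigr do rewrite moment_sqr.
have -> : stieltjes (fun s => s ^+ J.*2 * (s ^+ 2 * A s)) z = stieltjes (fun s => s ^+ J.+1.*2 * A s) z.
  by congr (_ / _); apply: cint_eq => s _; rewrite mulrA -exprD doubleS addn2.
move=> /eqP; rewrite subr_eq => /eqP H.
rewrite (stieltjes_step z0 fA) H big_ord_recl.
have -> : \sum_(i < J) (-1) ^+ bump 0 i * (moment A (bump 0 i))%:C / z ^+ (bump 0 i).*2.+1 =
   - (\sum_(i < J) (-1) ^+ i * (moment A i.+1)%:C / z ^+ i.*2.+1) / z ^+ 2.
  rewrite -sumrN mulr_suml; apply: eq_bigr => i _; rewrite /bump /= add1n doubleS !exprS.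
  by field; rewrite nz expf_neq0.
move: (\sum_(i < J) _) (stieltjes _ z) => X Y.
rewrite /= doubleS !exprS expr0; field; by rewrite nz expf_neq0.
Qed.

(** With a nonnegative density no cancellation is lost in the exact remainder: bounding the kernel
    by [2 * cscfac z / normc z] leaves precisely the first omitted moment. *)
Lemma stieltjes_remainder A z J : 0 < Re z -> moments_finite A -> (forall s, 0 <= A s) ->
  normc (stieltjes A z - \sum_(j < J) (-1) ^+ j * (moment A j)%:C / z ^+ j.*2.+1) <=
  cscfac z * (moment A J / normc z ^+ J.*2.+1).
Proof.
move=> z0 fA A0; have nz : z != 0 by exact: neq0_Re.
have r0 := normc_gt0 nz.
rewrite (stieltjes_expansion _ z0 fA) normcM normcV normcX normcM normcX normcN normc1 expr1n mul1r.
set B := fun s => s ^+ J.*2 * A s.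
have iB : rintble setT B by case: fA => _; apply.
have B0 s : 0 <= B s by rewrite mulr_ge0 // -muln2 exprM sqr_ge0.
have fB : moments_finite B.
  case: fA => mA iA; split; first by apply: measurable_funM => //; exact: measurable_funX.
  move=> j; have := iA (j + J)%N; apply: rintble_eq => // s _.
  by rewrite /B mulrA -exprD doubleD.
have h : normc (stieltjes B z) <= 2 * cscfac z / normc z * (\int[mu]_s B s) / (2 * pi).
  rewrite /stieltjes normc_div normcM normc_nat normcR (ger0_norm (@pi_ge0 R)).
  rewrite ler_pM2r ?invr_gt0 ?mulr_gt0 ?pi_gt0 // -rintZ //.
  apply: cint_norm_le => //; [exact: cintble_stieltjes|exact: rintbleZ|].
  move=> s _; rewrite mulrC; apply: normcM_le; first exact: poisson_le_csc.
  by rewrite normcR ger0_norm.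
apply: (le_trans (ler_wpM2r _ h)); first by rewrite invr_ge0 exprn_ge0 // normc_ge0.
rewrite /moment -/B le_eqVlt; apply/orP; left; apply/eqP.
have p0 : pi != 0 :> R by rewrite gt_eqF // pi_gt0.
have {}r0 := lt0r_neq0 r0.
by rewrite exprS; move: (pi : R) p0 (normc z) r0 => p p0 r r0; field; rewrite p0 expf_neq0 // r0.
Qed.

End StieltjesExpansion.

(** * Stieltjes representations of the hyperbolic sine and cosine *)

Section HyperbolicRepresentation.
Variable R : realType.
Implicit Types (z w : R[i]) (x y s T : R).
Local Open Scope classical_set_scope.

Lemma conj_nat n : conjc n%:R = n%:R :> R[i].
Proof. by rewrite natRC; exact: conj_C. Qed.

Lemma conjX z n : conjc (z ^+ n) = conjc z ^+ n.
Proof. by elim: n => [|n IH]; [rewrite !expr0 conjc1|rewrite !exprS conjM IH]. Qed.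

Lemma poisson_conj z s : poisson (conjc z) s = conjc (poisson z s).
Proof.
by rewrite /poisson !(conjM, conjc_inv, conjD, conjX, conj_nat, conj_C).
Qed.

(** Since [poisson (conjc z)] is the conjugate of [poisson z], averaging the formula at [z] with the
    conjugate of the formula at [conjc z] replaces [q] by its real part. *)
Lemma hardy_re z (q : R -> R[i]) (a : R[i]) : 0 < Re z ->
  hardy z q a -> hardy (conjc z) q (conjc a) ->
  stieltjes (fun s => Re (q s)) z = a.
Proof.
move=> z0 [mq [M qM] h1] [_ _ h2].
have z0' : 0 < Re (conjc z) by rewrite Re_conj.
have P w : 0 < Re w -> cintble setT (fun s => q s * poisson w s).
  by move=> w0; exact: (cintble_poissonM w0 mq qM).
have e1 : cintegral setT (fun s => q s * poisson z s) = 2%:R * pi%:C * a.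
  have := h1 0 (lexx 0); rewrite mulr0 oppr0 cexp0 mulr1 => <-.
  by apply: cint_eq => s _; rewrite mulr0 oppr0 cexp0 mul1r.
have e2 : cintegral setT (fun s => conjc (q s) * poisson z s) = 2%:R * pi%:C * a.
  have := h2 0 (lexx 0); rewrite mulr0 oppr0 cexp0 mulr1 => /(congr1 conjc).
  rewrite !conjM conjcK conj_C conj_nat => <-.
  rewrite -cint_conj //; last first.
    by apply: (cintble_eq _ _ (P _ z0')) => // s _; rewrite mulr0 oppr0 cexp0 mul1r.
  by apply: cint_eq => s _; rewrite mulr0 oppr0 cexp0 mul1r poisson_conj conjM conjcK.
have P2 : cintble setT (fun s => conjc (q s) * poisson z s).
  have mc : cmeas (fun s => conjc (q s)).
    case: mq => m1 m2; split; first by under eq_fun do rewrite Re_conj.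
    by under eq_fun do rewrite Im_conj; exact: measurable_funN.
  by apply: (cintble_poissonM (M := M) z0 mc) => s; rewrite normc_conj.
have E s : (Re (q s))%:C * poisson z s = 2%:R^-1 * (q s * poisson z s + conjc (q s) * poisson z s).
  by rewrite -[X in _ = 2%:R^-1 * X]mulrDl addcJ -[2%:R * _ * _]mulrA mulKf // pnatr_eq0.
rewrite /stieltjes (cint_eq (fun s _ => E s)) (cintZ _ measurableT (cintbleD measurableT (P _ z0) P2)).
rewrite (cintD measurableT (P _ z0) P2) e1 e2.
have := @pi_neq0 R; move: (pi%:C) => p p0; field; by rewrite p0.
Qed.

Variables (b b' : R -> R) (b0 : R).
Hypotheses (kb : kernel b) (kb' : kernel b').
Hypothesis hb : forall w, 0 <= Re w -> w * lap b w = b0%:C + lap b' w.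

Definition csinh w : R[i] := 2%:R^-1 * (cexp w - cexp (- w)).
Definition ccosh w : R[i] := 2%:R^-1 * (cexp w + cexp (- w)).

Definition axis_sinh s : R := Re (csinh (lap b (iR s))).
(** The real part of [w (cosh L(w) - 1)] at [w = iR s]. The real part of [cosh L - 1] itself would
    not do: it has in general neither a fixed sign nor exponential decay. *)
Definition axis_cosh s : R := - (s * Im (ccosh (lap b (iR s)))).

Let iR0 s : 0 <= Re (iR s). Proof. by rewrite Re_iR. Qed.

Let half_conj : conjc (2%:R^-1 : R[i]) = 2%:R^-1.
Proof. by rewrite conjc_inv conj_nat. Qed.

Lemma csinh_conj w : csinh (conjc w) = conjc (csinh w).
Proof. by rewrite /csinh conjM half_conj conjB -!cexp_conj conjN. Qed.

Lemma ccosh_conj w : ccosh (conjc w) = conjc (ccosh w).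
Proof. by rewrite /ccosh conjM half_conj conjD -!cexp_conj conjN. Qed.

Lemma hardy_csinh z : 0 < Re z -> hardy z (fun s => csinh (lap b (iR s))) (csinh (lap b z)).
Proof.
move=> z0; apply: (hardyZ z0).
have h1 := hardy_cexp z0 kb; have h2 := hardyZ z0 (-1) (hardy_cexp z0 (kernelN kb)).
have := hardyD z0 h1 h2; rewrite lapN ?(ltW z0) // mulN1r.
by under eq_fun do rewrite lapN // mulN1r.
Qed.

Lemma hardy_ccosh z : 0 < Re z ->
  hardy z (fun s => iR s * (ccosh (lap b (iR s)) - 1)) (z * (ccosh (lap b z) - 1)).
Proof.
move=> z0.
have h1 := hardy_mul_cexp z0 kb kb' (fun s => hb (iR0 s)) (hb (ltW z0)).
have hN w : 0 <= Re w -> w * lap (fun t => - b t) w = - b0%:C + lap (fun t => - b' t) w.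
  by move=> w0; rewrite !lapN // mulrN hb // opprD.
have h2 := hardy_mul_cexp z0 (kernelN kb) (kernelN kb') (fun s => hN _ (iR0 s)) (hN _ (ltW z0)).
have := hardyZ z0 2%:R^-1 (hardyD z0 h1 h2).
have e (v L : R[i]) : 2%:R^-1 * (v * (cexp L - 1) + v * (cexp (- L) - 1)) = v * (ccosh L - 1).
  by rewrite /ccosh; field.
rewrite lapN ?(ltW z0) // e.
by under eq_fun do rewrite lapN // e.
Qed.

Lemma csinh_rep z : 0 < Re z -> csinh (lap b z) = stieltjes axis_sinh z.
Proof.
move=> z0; rewrite (hardy_re z0 (hardy_csinh z0)) //.
rewrite -csinh_conj -lap_conj ?(ltW z0) //; apply: hardy_csinh; by rewrite Re_conj.
Qed.

Lemma ccosh_rep z : 0 < Re z -> ccosh (lap b z) - 1 = stieltjes axis_cosh z / z.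
Proof.
move=> z0; have nz : z != 0 by exact: neq0_Re.
have -> : stieltjes axis_cosh z = z * (ccosh (lap b z) - 1).
  rewrite -(hardy_re z0 (hardy_ccosh z0)).
    congr (_ / _); apply: cint_eq => s _; congr (_%:C * _).
    by rewrite ReM Re_iR Im_iR mul0r sub0r ImB Im1 subr0.
  rewrite conjM conjB conjc1 -ccosh_conj -lap_conj ?(ltW z0) //; apply: hardy_ccosh; by rewrite Re_conj.
by rewrite mulrAC divff // mul1r.
Qed.

Definition rsinh (x : R) : R := (expR x - expR (- x)) / 2.

Let Re_half w : Re (2%:R^-1 * w) = Re w / 2.
Proof. by rewrite natRC -fmorphV ReZl mulrC. Qed.
Let Im_half w : Im (2%:R^-1 * w) = Im w / 2.
Proof. by rewrite natRC -fmorphV ImZl mulrC. Qed.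

Lemma axis_sinhE s : axis_sinh s = rsinh (Re (lap b (iR s))) * cos (Im (lap b (iR s))).
Proof.
rewrite /axis_sinh /csinh Re_half ReB !Re_cexp ReN ImN cosN /rsinh; ring.
Qed.

Lemma axis_coshE s : axis_cosh s = - (s * (rsinh (Re (lap b (iR s))) * sin (Im (lap b (iR s))))).
Proof.
rewrite /axis_cosh /ccosh Im_half ImD !Im_cexp ReN ImN sinN /rsinh; ring.
Qed.

Lemma measurable_axis_sinh : measurable_fun setT axis_sinh.
Proof.
have : cmeas (fun s => csinh (lap b (iR s))) by rewrite /csinh; cmeas; exact: cmeas_lap_iR.
by case.
Qed.

Lemma measurable_axis_cosh : measurable_fun setT axis_cosh.
Proof.
have : cmeas (fun s => ccosh (lap b (iR s))) by rewrite /ccosh; cmeas; exact: cmeas_lap_iR.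
move=> [_ h]; apply: measurable_funN; exact: measurable_funM.
Qed.

Hypotheses (fA : moments_finite axis_sinh) (fB : moments_finite axis_cosh).
Hypotheses (A0 : forall s, 0 <= axis_sinh s) (B0 : forall s, 0 <= axis_cosh s).

(* The coefficient of [z^-n] in the expansion of [cexp (lap b z)]: odd powers come
   from the sinh, even powers from the cosh. *)
Definition mcoef n : R :=
  if n is m.+1 then (-1) ^+ m./2 * moment (if odd n then axis_sinh else axis_cosh) m./2 else 1.

Let sinh_rem z J := csinh (lap b z) - \sum_(j < J) (-1) ^+ j * (moment axis_sinh j)%:C / z ^+ j.*2.+1.
Let cosh_rem z J := ccosh (lap b z) - 1 - \sum_(j < J) (-1) ^+ j * (moment axis_cosh j)%:C / z ^+ j.*2.+2.

Let eps_double (e : bool) k : ((-1) ^+ e) ^+ k.*2 = 1 :> R[i].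
Proof. by rewrite -mul2n exprM -signr_odd; case: e => /=; rewrite ?expr1 ?expr0 ?sqrrN !expr1n. Qed.

Lemma mcoef_odd k : mcoef k.*2.+1 = (-1) ^+ k * moment axis_sinh k.
Proof. by rewrite /mcoef /= doubleK odd_double. Qed.

Lemma mcoef_even k : mcoef k.*2.+2 = (-1) ^+ k * moment axis_cosh k.
Proof. by rewrite /mcoef /= uphalf_double odd_double. Qed.

Let sinh_remS z k :
  sinh_rem z k.+1 = sinh_rem z k - (-1) ^+ k * (moment axis_sinh k)%:C / z ^+ k.*2.+1.
Proof. by rewrite /sinh_rem big_ord_recr opprD addrA. Qed.

Let cosh_remS z k :
  cosh_rem z k.+1 = cosh_rem z k - (-1) ^+ k * (moment axis_cosh k)%:C / z ^+ k.*2.+2.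
Proof. by rewrite /cosh_rem big_ord_recr opprD addrA. Qed.

(** Each new term belongs, by the parity of its exponent, to the series of [csinh] or to that of
    [ccosh - 1]. The boolean [e] chooses between [exp L] and [exp (- L)], which share both
    remainders up to the sign of the odd one. *)
Lemma expansion_split z (e : bool) N : 0 < Re z ->
  cexp ((-1) ^+ e * lap b z) - \sum_(n < N.+1) ((-1) ^+ e) ^+ n * (mcoef n)%:C / z ^+ n =
  (-1) ^+ e * sinh_rem z N.+1./2 + cosh_rem z N./2.
Proof.
move=> z0; have nz : z != 0 by exact: neq0_Re.
elim: N => [|N IH].
  rewrite big_ord1 /sinh_rem /cosh_rem !big_ord0 !subr0 !expr0 mul1r divr1 /=.
  by case: e; rewrite ?expr1 ?expr0 ?mulN1r ?mul1r /csinh /ccosh rmorph1 ?opprK; field.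
have sub3 (u v t : R[i]) : u - (v + t) = u - v - t by rewrite opprD addrA.
rewrite big_ord_recr sub3 IH [(nat_of_ord _)]/=.
have [k [Nk|Nk]] : exists k, N = k.*2 \/ N = k.*2.+1.
  exists N./2; rewrite -{1 3}(odd_double_half N); case: (odd N); [by right|by left].
- rewrite Nk mcoef_odd [in LHS]exprS eps_double mulr1 /= doubleK uphalf_double sinh_remS.
  move: (sinh_rem z k) (cosh_rem z k) => q r.
  by rewrite rmorphM rmorphXn rmorphN1 mulrBr !mulrA addrAC.
- rewrite Nk mcoef_even -doubleS eps_double mul1r /= doubleK uphalf_double cosh_remS.
  move: (sinh_rem _ _) (cosh_rem z k) => q r.
  by rewrite rmorphM rmorphXn rmorphN1 addrA.
Qed.

Let rem_sinh z J : 0 < Re z -> normc (sinh_rem z J) <= cscfac z * (`|mcoef J.*2.+1| / normc z ^+ J.*2.+1).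
Proof.
move=> z0; rewrite mcoef_odd normrM normrX normrN1 expr1n mul1r ger0_norm.
  by rewrite /sinh_rem csinh_rep //; exact: stieltjes_remainder.
rewrite /moment divr_ge0 ?pi_ge0 //; apply: Rintegral_ge0 => s _.
by rewrite mulr_ge0 // -mul2n exprM exprn_ge0 // sqr_ge0.
Qed.

Let rem_cosh z J : 0 < Re z -> normc (cosh_rem z J) <= cscfac z * (`|mcoef J.*2.+2| / normc z ^+ J.*2.+2).
Proof.
move=> z0; have nz : z != 0 by exact: neq0_Re.
have r0 := normc_gt0 nz.
rewrite mcoef_even normrM normrX normrN1 expr1n mul1r ger0_norm; last first.
  rewrite /moment divr_ge0 ?pi_ge0 //; apply: Rintegral_ge0 => s _.
  by rewrite mulr_ge0 // -mul2n exprM exprn_ge0 // sqr_ge0.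
have -> : cosh_rem z J = (stieltjes axis_cosh z
    - \sum_(j < J) (-1) ^+ j * (moment axis_cosh j)%:C / z ^+ j.*2.+1) / z.
  rewrite /cosh_rem ccosh_rep // mulrBl mulr_suml; congr (_ - _); apply: eq_bigr => j _.
  by rewrite (exprS z j.*2.+1) invfM mulrA [RHS]mulrAC -!mulrA [z^-1 * _]mulrC.
have := stieltjes_remainder J z0 fB B0.
rewrite normc_div (exprS (normc z) J.*2.+1) => h.
rewrite ler_pdivrMr //; apply: (le_trans h); rewrite le_eqVlt; apply/orP; left; apply/eqP.
by have {}r0 := lt0r_neq0 r0; field; rewrite r0 ?expf_neq0.
Qed.

(** The first omitted terms of the odd and of the even series are the [N]-th and [N.+1]-st in one
    order or the other. The constant term 1 belongs to neither series and must be among the terms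
    kept, whence [1 <= N]. *)
Lemma truncated_bound z (e : bool) N : (1 <= N)%N -> 0 < Re z ->
  normc (cexp ((-1) ^+ e * lap b z) - \sum_(n < N) ((-1) ^+ e) ^+ n * (mcoef n)%:C / z ^+ n) <=
  (`|mcoef N| / normc z ^+ N + `|mcoef N.+1| / normc z ^+ N.+1) * cscfac z.
Proof.
case: N => // N _ z0; rewrite expansion_split // [leRHS]mulrC [leRHS]mulrDr.
have ne : normc ((-1) ^+ e : R[i]) = 1 by rewrite normcX normcN normc1 expr1n.
have [k [Nk|Nk]] : exists k, N = k.*2 \/ N = k.*2.+1.
  exists N./2; rewrite -{1 3}(odd_double_half N); case: (odd N); [by right|by left].
- rewrite Nk doubleK (_ : (k.*2.+1)./2 = k); last by rewrite /= uphalf_double.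
  apply: normcD_le; last exact: rem_cosh.
  by rewrite normcM ne mul1r; exact: rem_sinh.
- rewrite Nk -doubleS doubleK (_ : (k.*2.+1)./2 = k); last by rewrite /= uphalf_double.
  rewrite addrC; apply: normcD_le; first exact: rem_cosh.
  by rewrite normcM ne mul1r; exact: rem_sinh.
Qed.

End HyperbolicRepresentation.

(** * The truncated kernel *)

Section TruncatedKernel.
Variable R : realType.
Implicit Types (z w : R[i]) (x y s t T : R).
Local Open Scope classical_set_scope.

(** The poles of [1 / (e^t - 1)] other than 0 are ['i] times [freq k] and its negative;
    [pole_pair k] collects the contribution of such a pair to [b]. *)
Definition freq k : R := 2 * pi * k.+1%:R.

Lemma freq_gt0 k : 0 < freq k.
Proof. by rewrite !mulr_gt0 ?pi_gt0. Qed.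

Definition pole_pair k t : R := 2 / (t ^+ 2 + freq k ^+ 2).
Definition pole_pair' k t : R := - (4 * t) / (t ^+ 2 + freq k ^+ 2) ^+ 2.
Definition trunc_kernel K t : R := \sum_(k < K) pole_pair k t.
Definition trunc_kernel' K t : R := \sum_(k < K) pole_pair' k t.

Lemma sqrD_freq_gt0 k t : 0 < t ^+ 2 + freq k ^+ 2.
Proof. by rewrite ltr_wpDl ?sqr_ge0 // exprn_gt0 // freq_gt0. Qed.

Lemma freq_ge1 k : 1 <= freq k.
Proof.
have p := @pi_ge2 R; have k1 : 1 <= k.+1%:R :> R by rewrite ler1n.
rewrite /freq; nra.
Qed.

Lemma pole_pair_ge0 k t : 0 <= pole_pair k t.
Proof. by rewrite divr_ge0 // ltW // sqrD_freq_gt0. Qed.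

Lemma pole_pair_le k t : pole_pair k t <= 2 * (1 + t ^+ 2)^-1.
Proof.
rewrite ler_pM2l // lef_pV2 ?posrE ?onesqr_gt0 ?sqrD_freq_gt0 //.
by rewrite addrC lerD2l exprn_ege1 // freq_ge1.
Qed.

Lemma pole_pair'_le0 k t : 0 <= t -> pole_pair' k t <= 0.
Proof. by move=> t0; rewrite /pole_pair' mulNr oppr_le0 divr_ge0 ?sqr_ge0 // mulr_ge0. Qed.

(** Both [2 * |t|] and [1 + t ^+ 2] are at most the denominator's base [t ^+ 2 + freq k ^+ 2], the
    latter because [freq k >= 1]. *)
Lemma pole_pair'_le k t : `|pole_pair' k t| <= 2 * (1 + t ^+ 2)^-1.
Proof.
rewrite /pole_pair' normrM normrN normrM normfV.
have d0 := sqrD_freq_gt0 k t; have o0 := onesqr_gt0 t.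
have d1 : 1 + t ^+ 2 <= t ^+ 2 + freq k ^+ 2 by rewrite addrC lerD2l exprn_ege1 // freq_ge1.
rewrite (ger0_norm (sqr_ge0 _)) ler_pdivrMr ?exprn_gt0 // [`|4|]ger0_norm //.
rewrite mulrAC ler_pdivlMr //.
have t2 : 2 * `|t| <= 1 + t ^+ 2.
  by rewrite -(real_normK (num_real t)); have := sqr_ge0 (`|t| - 1); rewrite !expr2; lra.
move: (1 + t ^+ 2) (t ^+ 2 + _) d0 d1 o0 t2 => o d d0 d1 o0 t2; rewrite expr2.
have h1 : (2 * `|t|) * o <= o * o by rewrite ler_pM2r.
have h2 : o * o <= d * d by apply: ler_pM => //; exact: ltW.
lra.
Qed.

Lemma rder_pole_pair k t : is_derive t 1 (pole_pair k) (pole_pair' k t).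
Proof.
have d0 := lt0r_neq0 (sqrD_freq_gt0 k t).
have h := rderD (rderM (rder_id t) (rder_id t)) (rder_cst t (freq k ^+ 2)).
have hV := rderM (rder_cst t 2) (rderV (_ : (fun y => y * y + freq k ^+ 2) t != 0) h).
rewrite /pole_pair; under eq_fun do rewrite expr2.
apply: rder_eq (hV _) _; first by rewrite -expr2.
by rewrite /pole_pair' /= !mul0r add0r !mul1r mulr1 addr0 -expr2; field; exact: d0.
Qed.

Lemma rder_sum n (f f' : 'I_n -> R -> R) t : (forall i, is_derive t 1 (f i) (f' i t)) ->
  is_derive t 1 (fun x => \sum_(i < n) f i x) (\sum_(i < n) f' i t).
Proof.
elim: n f f' => [|n IH] f f' h.
  by rewrite big_ord0; under eq_fun do rewrite big_ord0; exact: rder_cst.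
rewrite big_ord_recr; under eq_fun do rewrite big_ord_recr.
by apply: rderD => //; exact: (IH (fun i => f (widen_ord (leqnSn n) i)) (fun i => f' (widen_ord (leqnSn n) i))).
Qed.

Lemma rder_trunc_kernel K t : is_derive t 1 (trunc_kernel K) (trunc_kernel' K t).
Proof. by apply: (rder_sum (f := fun i => pole_pair i) (f' := fun i => pole_pair' i)) => i; exact: rder_pole_pair. Qed.

Lemma rder_pole_pair' k t : exists a, is_derive t 1 (pole_pair' k) a.
Proof.
have d0 := lt0r_neq0 (sqrD_freq_gt0 k t).
have h := rderD (rderM (rder_id t) (rder_id t)) (rder_cst t (freq k ^+ 2)).
have h2 := rderM h h.
have hV := rderM (rderN (rderM (rder_cst t 4) (rder_id t)))
  (rderV (_ : (fun y => (y * y + freq k ^+ 2) * (y * y + freq k ^+ 2)) t != 0) h2).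
eexists; rewrite /pole_pair'; under eq_fun do rewrite !expr2.
by apply: hV; rewrite -!expr2 expf_neq0.
Qed.

Lemma rder_trunc_kernel' K t : exists a, is_derive t 1 (trunc_kernel' K) a.
Proof.
exists (\sum_(k < K) projT1 (cid (rder_pole_pair' k t))).
apply: (rder_sum (f := fun i => pole_pair' i) (f' := fun i t => projT1 (cid (rder_pole_pair' i t)))) => i.
exact: (projT2 (cid (rder_pole_pair' i t))).
Qed.

Lemma rder_continuous (f : R -> R) t a : is_derive t 1 f a -> {for t, continuous f}.
Proof.
move=> dx; apply: differentiable_continuous; apply/derivable1_diffP.
exact: (@ex_derive _ _ _ _ _ _ _ dx).
Qed.

Lemma continuous_trunc_kernel K : continuous (trunc_kernel K).
Proof. by move=> t; exact: rder_continuous (rder_trunc_kernel K t). Qed.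

Lemma continuous_trunc_kernel' K : continuous (trunc_kernel' K).
Proof. by move=> t; have [a] := rder_trunc_kernel' K t; exact: rder_continuous. Qed.

Lemma trunc_kernel_ge0 K t : 0 <= trunc_kernel K t.
Proof. by apply: sumr_ge0 => k _; exact: pole_pair_ge0. Qed.

Lemma trunc_kernel_le K t : trunc_kernel K t <= 2 * K%:R * (1 + t ^+ 2)^-1.
Proof.
rewrite mulrAC; apply: (@le_trans _ _ (\sum_(k < K) 2 * (1 + t ^+ 2)^-1)).
  by apply: ler_sum => k _; exact: pole_pair_le.
by rewrite sumr_const card_ord mulr_natr.
Qed.

Lemma trunc_kernel'_le K t : `|trunc_kernel' K t| <= 2 * K%:R * (1 + t ^+ 2)^-1.
Proof.
rewrite mulrAC; apply: (@le_trans _ _ (\sum_(k < K) 2 * (1 + t ^+ 2)^-1)).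
  apply: (le_trans (ler_norm_sum _ _ _)); apply: ler_sum => k _; exact: pole_pair'_le.
by rewrite sumr_const card_ord mulr_natr.
Qed.

Lemma trunc_kernel'_le0 K t : 0 <= t -> trunc_kernel' K t <= 0.
Proof. by move=> t0; apply: sumr_le0 => k _; exact: pole_pair'_le0. Qed.

Lemma rintble_onesqr_half c : rintble `]0, +oo[ (fun t : R => c * (1 + t ^+ 2)^-1).
Proof.
apply: rintbleZ => //; apply: (rintbleS measurableT) => //; exact: rintble_oneDsqrV.
Qed.

Lemma kernel_trunc K : kernel (trunc_kernel K).
Proof.
have m : measurable_fun setT (trunc_kernel K) := continuous_measurable_fun (continuous_trunc_kernel (K := K)).
split=> //; apply: (rintble_le _ m (rintble_onesqr_half (2 * K%:R))) => // t _.
by rewrite ger0_norm ?trunc_kernel_ge0 // trunc_kernel_le.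
Qed.

Lemma kernel_trunc' K : kernel (trunc_kernel' K).
Proof.
have m : measurable_fun setT (trunc_kernel' K) := continuous_measurable_fun (continuous_trunc_kernel' (K := K)).
split=> //; apply: (rintble_le _ m (rintble_onesqr_half (2 * K%:R))) => // t _.
exact: trunc_kernel'_le.
Qed.

Lemma cvg_onesqr_nat c : c * (1 + n.+1%:R ^+ 2)^-1 @[n --> \oo] --> (0 : R).
Proof.
apply: (@norm_cvg0 _ R).
apply: (squeeze_cvgr _ (cvg_cst 0) (cvg_invn `|c|)); near=> n.
rewrite normr_ge0 normrM /=; apply: ler_wpM2l => //.
rewrite ger0_norm ?invr_ge0 ?(ltW (onesqr_gt0 _)) //.
rewrite lef_pV2 ?posrE ?onesqr_gt0 //.
have : 1 <= n.+1%:R :> R by rewrite ler1n.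
by rewrite expr2; nra.
Unshelve. all: by end_near. Qed.

Lemma cvg_trunc_kernel K : trunc_kernel K n.+1%:R @[n --> \oo] --> (0 : R).
Proof.
apply: (squeeze_cvgr _ (cvg_cst 0) (cvg_onesqr_nat (2 * K%:R))); near=> n.
by rewrite trunc_kernel_ge0 trunc_kernel_le.
Unshelve. all: by end_near. Qed.

Lemma trunc_kernel_le_inv K t : 0 < t -> trunc_kernel K t <= 1 / (2 * t).
Proof.
move=> t0; have p0 := @pi_gt0 R.
(* By the mean value theorem, the k-th term is at most the k-th increment of
   [atan (2 pi k / t) / (pi t)]. *)
suff h : trunc_kernel K t <= atan (2 * pi * K%:R / t) / (pi * t).
  apply: (le_trans h); rewrite ler_pdivrMr ?mulr_gt0 //.
  rewrite (_ : 1 / (2 * t) * (pi * t) = pi / 2); last by field; lra.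
  by apply: ltW; exact: atan_ltpi2.
elim: K => [|K IH]; first by rewrite /trunc_kernel big_ord0 mulr0 mul0r atan0 mul0r.
rewrite /trunc_kernel big_ord_recr /= -/(trunc_kernel K t).
set u := 2 * pi * K%:R / t; set v := 2 * pi * K.+1%:R / t.
have uv : u < v by rewrite ltr_pM2r ?invr_gt0 // ltr_pM2l ?mulr_gt0 // ltr_nat.
have u0 : 0 <= u by rewrite divr_ge0 ?(ltW t0) // !mulr_ge0 // ltW.
have [c] := MVT uv (fun y _ => is_derive1_atan y) (continuous_subspaceT (fun y => @continuous_atan R y)).
rewrite in_itv /= => /andP[uc cv] e.
have vu : v - u = 2 * pi / t by rewrite /v /u -(natr1 K); field; lra.
have : pole_pair K t <= (atan v - atan u) / (pi * t).
  have alg (p o : R) : p != 0 -> o != 0 -> o^-1 * (2 * p / t) / (p * t) = 2 / (t ^+ 2 * o).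
    by move=> pn on; field; rewrite pn on lt0r_neq0.
  rewrite e vu alg ?lt0r_neq0 ?onesqr_gt0 //.
  rewrite /pole_pair ler_pM2l // lef_pV2 ?posrE ?mulr_gt0 ?exprn_gt0 ?onesqr_gt0 ?sqrD_freq_gt0 //.
  rewrite mulrDr mulr1 lerD2l -exprMn.
  have fk := freq_gt0 K.
  have tc : t * c <= freq K by have := ltW cv; rewrite /v -/(freq K) ler_pdivlMr // mulrC.
  have c0 : 0 <= c by lra.
  have tc0 : 0 <= t * c := mulr_ge0 (ltW t0) c0.
  by rewrite lerXn2r // nnegrE ltW.
by rewrite mulrBl; lra.
Qed.

End TruncatedKernel.

(** * Integration by parts in the truncated transform *)

Section TruncatedKernelTransform.
Variable R : realType.
Implicit Types (z w : R[i]) (x y s t T : R).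
Local Open Scope classical_set_scope.

Lemma cder_cexpN w t : cder (fun t => cexp (- (w * t%:C))) t (- w * cexp (- (w * t%:C))).
Proof.
apply: cder_cexp; apply: cderN; apply: cder_eq (cderZ w (cder_id t)) _; exact: mulr1.
Qed.

(** Halving the left endpoint keeps the intervals nondegenerate: for [n = 0] both endpoints would
    otherwise be 1. *)
Lemma itv_oy_exhaust x : `]0, +oo[ x -> \forall n \near \oo, (n.+1%:R : R)^-1 / 2 <= x <= n.+1%:R.
Proof.
move=> /gt0_itv x0.
exists (Num.bound (x + x^-1)) => // n /= xn.
have h : x + x^-1 < n.+1%:R.
  apply: (lt_le_trans (archi_boundP _)); last by rewrite ler_nat leqW.
  by rewrite addr_ge0 ?invr_ge0 // ltW.
have v0 : 0 < x^-1 by rewrite invr_gt0.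
apply/andP; split; last by lra.
have : (n.+1%:R : R)^-1 <= x.
  by rewrite -[leRHS]invrK lef_pV2 ?posrE ?ltr0n // ?invr_gt0 //; lra.
have : 0 < (n.+1%:R : R)^-1 by rewrite invr_gt0 ltr0n.
by move: (n.+1%:R^-1) => v; lra.
Qed.

Lemma cint_ftc0y (f F : R -> R[i]) A B : (forall t, cder F t (f t)) ->
  (forall t, exists d, cder f t d) -> cmeas f -> cintble `]0, +oo[ f ->
  F 0 = A -> ccvg (fun n => F n.+1%:R) B -> cintegral `]0, +oo[ f = B - A.
Proof.
move=> dF df mf jf FA cB.
apply: (@cint_ftc _ _ f F (fun n => (n.+1%:R)^-1 / 2) (fun n => n.+1%:R)) => //.
- move=> n; have n1 : 1 <= n.+1%:R :> R by rewrite ler1n.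
  have : (n.+1%:R : R)^-1 <= 1 by rewrite invf_le1 ?ltr0n.
  by move: (n.+1%:R^-1) => v; lra.
- move=> n x /andP[h _]; rewrite /= in_itv /= andbT; apply: lt_le_trans h.
  by rewrite divr_gt0 // invr_gt0 ltr0n.
- exact: itv_oy_exhaust.
  have v0 : (n.+1%:R : R)^-1 / 2 @[n --> \oo] --> (0 : R).
    rewrite -(mul0r (2^-1 : R)); apply: cvgM; [exact: cvg_harmonic|exact: cvg_cst].
  have [d1 d2] := dF 0; rewrite -FA; split.
    exact: (continuous_cvg _ (rder_continuous d1) v0).
  exact: (continuous_cvg _ (rder_continuous d2) v0).
Qed.

(** Holds on the closed half-plane because the kernel vanishes at infinity. It feeds
    [hardy_mul_cexp] and also, by comparing [w = iR s] with [w = 0], the imaginary part on the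
    axis. *)
Lemma lap_trunc_kernel_by_parts K w : 0 <= Re w ->
  w * lap (trunc_kernel K) w = (trunc_kernel K 0)%:C + lap (trunc_kernel' K) w.
Proof.
move=> w0.
have dk t : cder (fun t => (trunc_kernel K t)%:C) t (trunc_kernel' K t)%:C := cderR (rder_trunc_kernel K t).
have i1 := cintble_lap (@kernel_trunc R K) w0; have i2 := cintble_lap (@kernel_trunc' R K) w0.
pose f t := (trunc_kernel' K t)%:C * cexp (- (w * t%:C)) + (trunc_kernel K t)%:C * (- w * cexp (- (w * t%:C))).
have fE t : f t = (trunc_kernel' K t)%:C * cexp (- (w * t%:C)) - w * ((trunc_kernel K t)%:C * cexp (- (w * t%:C))).
  by rewrite /f; ring.
have m1 := (@kernel_trunc R K).1; have m2 := (@kernel_trunc' R K).1.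
have iw := cintbleZ w (measurable_itv _) i1.
have jf : cintble `]0, +oo[ f.
  by apply: (cintble_eq (measurable_itv _) _ (cintbleB (measurable_itv _) i2 iw)) => t _; rewrite fE.
have H : cintegral `]0, +oo[ f = 0 - (trunc_kernel K 0)%:C.
  apply: (@cint_ftc0y f (fun t => (trunc_kernel K t)%:C * cexp (- (w * t%:C)))) => //.
  - by move=> t; apply: cderM (dk t) (cder_cexpN w t).
  - move=> t; have [a da] := rder_trunc_kernel' K t; eexists.
    apply: cderD; apply: cderM; [exact: (cderR da)|exact: cder_cexpN|exact: dk|].
    by apply: cderZ; exact: cder_cexpN.
  - by rewrite /f; cmeas.
  - by rewrite mulr0 oppr0 cexp0 mulr1.
  - apply: (ccvg_bound _ (cvg_trunc_kernel K)); near=> n; rewrite subr0 -[leRHS]mulr1.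
    apply: normcM_le; first by rewrite normcR ger0_norm ?trunc_kernel_ge0.
    exact: normc_cexpN_le1.
move: H; rewrite (cint_eq (fun t _ => fE t)) (cintB (measurable_itv _) i2 iw) (cintZ _ (measurable_itv _) i1).
by rewrite -/(lap _ _) -/(lap _ _) sub0r => /eqP; rewrite subr_eq addrC -subr_eq opprK addrC => /eqP ->.
Unshelve. all: by end_near. Qed.

End TruncatedKernelTransform.

(** * The real part of the truncated transform on the axis *)

Section TruncatedKernelAxis.
Variable R : realType.
Implicit Types (z w : R[i]) (x y s t T : R).
Local Open Scope classical_set_scope.

(** The Poisson kernel in a second role: read at the real point [freq k], it is a piece of [b], so
    [cintegral_Lorentz] also computes the Fourier transform of [b]. *)
Lemma pole_pair_poisson k t : (pole_pair k t)%:C = ((freq R k)^-1)%:C * poisson (freq R k)%:C t.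
Proof.
have f0 := freq_gt0 R k.
have d0 := sqrD_freq_gt0 k t.
have n1 : (freq R k)%:C != 0 by apply: neq0_Re.
have n2 : (freq R k)%:C ^+ 2 + t%:C ^+ 2 != 0 by apply: sqrD_neq0.
rewrite /pole_pair /poisson rmorphM rmorph_nat !fmorphV rmorphD !rmorphXn /= addrC.
by field; rewrite n1 n2.
Qed.

Lemma cintegral_pole_pair k T : 0 <= T ->
  cintegral setT (fun t => (pole_pair k t)%:C * cexp (- (iR t * T%:C))) = (expR (- (freq R k * T)) / k.+1%:R)%:C.
Proof.
move=> T0; have f0 := freq_gt0 R k.
have z0 : 0 < Re (freq R k)%:C by [].
have I : cintble setT (fun t => cexp (- (iR t * T%:C)) * poisson (freq R k)%:C t).
  apply: (@cintble_poissonM _ _ _ 1 z0); first by cmeas.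
  by move=> s; apply: normc_cexpN_le1; rewrite ?Re_iR.
transitivity (((freq R k)^-1)%:C * cintegral setT (fun t => cexp (- (iR t * T%:C)) * poisson (freq R k)%:C t)).
  rewrite -cintZ //; apply: cint_eq => t _; rewrite pole_pair_poisson; ring.
rewrite cintegral_Lorentz // -rmorphM -rmorphN cexpR natRC -!rmorphM; congr _%:C.
have p0 := lt0r_neq0 (@pi_gt0 R); rewrite /freq; move: (pi : R) p0 => p p0; field; by rewrite p0 andbT nat1r pnatr_eq0.
Qed.

Lemma pole_pairN k t : pole_pair k (- t) = pole_pair k t.
Proof. by rewrite /pole_pair sqrrN. Qed.

Lemma trunc_kernelN K t : trunc_kernel K (- t) = trunc_kernel K t.
Proof. by apply: eq_bigr => k _; exact: pole_pairN. Qed.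

Lemma rintble_trunc_kernel K : rintble setT (@trunc_kernel R K).
Proof.
have m := (@kernel_trunc R K).1.
apply: (rintble_le measurableT m (rintbleZ (2 * K%:R) measurableT (rintble_oneDsqrV R))) => t _.
by rewrite ger0_norm ?trunc_kernel_ge0 // trunc_kernel_le.
Qed.

Lemma ge0_rint_even (h : R -> R) : (forall x, 0 <= h x) -> continuous h -> (forall x, h (- x) = h x) ->
  rintble setT h -> \int[mu]_x h x = 2 * \int[mu]_(x in `]0, +oo[) h x.
Proof.
move=> h0 ch eh ih; have mh := continuous_measurable_fun ch.
rewrite /Rintegral ge0_symfun_integralT //; last by move=> x /=; rewrite eh.
have -> : [set x | 0 <= x] = `[0, +oo[ :> set R.
  by apply/seteqP; split => x /=; rewrite in_itv /= andbT.
rewrite -integral_itv_obnd_cbnd; last by apply/measurable_EFinP; exact: measurable_funTS.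
rewrite fineM //; apply: (@integrable_fin_num _ _ _ mu _ (measurable_itv _)).
exact: (rintbleS measurableT).
Qed.

(** The nonnegative case is applied to [h + g] and to [g], so that [h] may change sign. *)
Lemma rint_even_dominated (h g : R -> R) : continuous h -> continuous g ->
  (forall x, `|h x| <= g x) -> (forall x, h (- x) = h x) -> (forall x, g (- x) = g x) ->
  rintble setT g -> \int[mu]_x h x = 2 * \int[mu]_(x in `]0, +oo[) h x.
Proof.
move=> ch cg hg eh eg ig.
have ih : rintble setT h by apply: (rintble_le measurableT (continuous_measurable_fun ch) ig) => x _.
have S (f : R -> R) : rintble setT f -> rintble `]0, +oo[ f by exact: rintbleS.
have e x : h x = (h x + g x) - g x by rewrite addrK.
transitivity (\int[mu]_x (h x + g x) - \int[mu]_x g x).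
  by rewrite -rintB //; [apply: eq_Rintegral => x _|exact: rintbleD].
rewrite ge0_rint_even //.
- rewrite [X in _ - X]ge0_rint_even //.
    by rewrite rintD; [ring|done|exact: S..].
  by move=> x; apply: le_trans (hg x).
- by move=> x; have := hg x; rewrite ler_norml => /andP[]; lra.
- by move=> x; apply: cvgD; [exact: ch|exact: cg].
- by move=> x; rewrite eh eg.
- exact: rintbleD.
Qed.

Lemma Re_lap_axis (c : R -> R) s : Re (lap c (iR s)) = \int[mu]_(t in `]0, +oo[) (c t * cos (s * t)).
Proof.
apply: eq_Rintegral => t _.
rewrite ReZl Re_cexp ReN ImN ReZr ImZr Re_iR Im_iR mul0r oppr0 expR0 mul1r cosN //.
Qed.

(** The cosine transform of the even kernel is half a Fourier integral over the line, computed pole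
    pair by pole pair. As that formula needs a nonnegative parameter, evenness of the cosine brings
    in the absolute value of [s]. *)
Lemma Re_lap_trunc_kernel K s : Re (lap (trunc_kernel K) (iR s)) =
  \sum_(k < K) expR (- (freq R k * `|s|)) / (2 * k.+1%:R).
Proof.
have ck := @continuous_trunc_kernel R K.
have csin : continuous (fun t : R => cos (s * t)).
  move=> t; apply: (@continuous_comp _ _ _ (fun t => s * t) cos); last exact: continuous_cos.
  by apply: cvgM; [exact: cvg_cst|exact: cvg_id].
have E := @rint_even_dominated (fun t => trunc_kernel K t * cos (s * t)) (trunc_kernel K).
rewrite Re_lap_axis; apply: (@mulfI _ 2); first by rewrite pnatr_eq0.
rewrite -E //; last first.
- exact: rintble_trunc_kernel.
- exact: trunc_kernelN.
- by move=> x; rewrite trunc_kernelN mulrN cosN.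
- by move=> x; rewrite normrM (ger0_norm (trunc_kernel_ge0 _ _)) ler_piMr ?trunc_kernel_ge0 // cos_max.
- by move=> t; apply: cvgM; [exact: ck|exact: csin].
have T0 := normr_ge0 s.
pose F (k : nat) (t : R) : R[i] := (pole_pair k t)%:C * cexp (- (iR t * `|s|%:C)).
have IF k : cintble setT (F k).
  apply: (cintble_le measurableT _ (rintbleZ 2 measurableT (rintble_oneDsqrV R))).
    have m : measurable_fun setT (@pole_pair R k).
      by apply: continuous_measurable_fun => t; exact: rder_continuous (rder_pole_pair k t).
    by rewrite /F; cmeas.
  move=> t _; rewrite -[leRHS]mulr1; apply: normcM_le.
    by rewrite normcR ger0_norm ?pole_pair_ge0 // pole_pair_le.
  by apply: normc_cexpN_le1; rewrite ?Re_iR.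
have [_ H] := cint_sum (F := fun i : 'I_K => F i) measurableT (fun i => IF i).
move/(congr1 (@complex.Re R)): H; rewrite (Re_sum K (fun i => cintegral setT (F i))).
under eq_bigr do rewrite cintegral_pole_pair //.
under eq_bigr do rewrite ReC.
have -> : Re (cintegral setT (fun x => \sum_(i < K) F i x)) = \int[mu]_t (trunc_kernel K t * cos (s * t)).
  apply: eq_Rintegral => t _; rewrite (Re_sum K (F^~ t)) /trunc_kernel mulr_suml; apply: eq_bigr => k _.
  rewrite /F ReZl Re_cexp ReN ImN ReZr ImZr Re_iR Im_iR mul0r oppr0 expR0 mul1r cosN; congr (_ * _).
  by have [s0|s0] := leP 0 s; rewrite ?(ger0_norm s0) ?(ltr0_norm s0) ?mulrN ?cosN mulrC.
move=> ->; rewrite mulr_sumr; apply: eq_bigr => k _; field; by rewrite nat1r pnatr_eq0.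
Qed.
End TruncatedKernelAxis.

(** * The imaginary part of the truncated transform on the axis *)

Section AxisPhase.
Variable R : realType.
Implicit Types (z w : R[i]) (x y s t T : R).
Local Open Scope classical_set_scope.

Lemma rint_ftc0y (h H : R -> R) A B : (forall t, is_derive t 1 H (h t)) -> continuous h ->
  rintble `]0, +oo[ h -> H 0 = A -> (H n.+1%:R @[n --> \oo] --> B) ->
  \int[mu]_(t in `]0, +oo[) h t = B - A.
Proof.
move=> dH ch ih HA HB.
apply: (@rint_ftc _ _ h H (fun n => (n.+1%:R)^-1 / 2) (fun n => n.+1%:R)) => //.
- move=> n; have n1 : 1 <= n.+1%:R :> R by rewrite ler1n.
  have : (n.+1%:R : R)^-1 <= 1 by rewrite invf_le1 ?ltr0n.
  by move: (n.+1%:R^-1) => v; lra.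
- move=> n x /andP[e _]; rewrite /= in_itv /= andbT; apply: lt_le_trans e.
  by rewrite divr_gt0 // invr_gt0 ltr0n.
- exact: itv_oy_exhaust.
- by move=> x _; exact: ch.
- exact: continuous_measurable_fun.
- rewrite -HA; apply: (continuous_cvg _ (rder_continuous (dH 0))).
  rewrite -(mul0r (2^-1 : R)); apply: cvgM; [exact: cvg_harmonic|exact: cvg_cst].
Qed.

Variable K : nat.
Local Notation b := (@trunc_kernel R K).
Local Notation b' := (@trunc_kernel' R K).

Let ib' : rintble `]0, +oo[ b'. Proof. exact: (@kernel_trunc' R K).2. Qed.

Lemma continuous_cosM s : continuous (fun t : R => cos (s * t)).
Proof.
move=> t; apply: (@continuous_comp _ _ _ (fun t => s * t) cos); last exact: continuous_cos.
by apply: cvgM; [exact: cvg_cst|exact: cvg_id].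
Qed.

Lemma rintbleM_bounded D (h g : R -> R) M : measurable D -> measurable_fun setT h -> measurable_fun setT g ->
  rintble D h -> (forall x, D x -> `|g x| <= M) -> rintble D (fun x => h x * g x).
Proof.
move=> mD mh mg ih hM; apply: (rintble_le mD _ (rintbleZ M mD (rintble_norm mD ih))).
  exact: measurable_funM.
by move=> x Dx; rewrite normrM mulrC ler_wpM2r // hM.
Qed.

Let mb' : measurable_fun setT b'. Proof. exact: (@kernel_trunc' R K).1. Qed.

Let ib'c s : rintble `]0, +oo[ (fun t => b' t * cos (s * t)).
Proof.
apply: (@rintbleM_bounded _ b' (fun t => cos (s * t)) 1) => //.
- exact: (continuous_measurable_fun (@continuous_cosM s)).
- by move=> t _; exact: cos_max.
Qed.

(* Both sides of [w L(w) = b(0) + L'(w)] at [w = i s] and at [w = 0]. *)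
Lemma Im_lap_trunc_kernel s : - (s * Im (lap b (iR s))) = \int[mu]_(t in `]0, +oo[) (- b' t * (1 - cos (s * t))).
Proof.
have s0 : 0 <= Re (iR s) by rewrite Re_iR.
have := congr1 (@complex.Re R) (lap_trunc_kernel_by_parts K s0).
rewrite ReM Re_iR Im_iR mul0r sub0r ReD ReC Re_lap_axis => ->.
have := congr1 (@complex.Re R) (lap_trunc_kernel_by_parts K (lexx 0 : 0 <= Re 0)).
rewrite mul0r Re0 ReD ReC (_ : 0 = iR 0); last by rewrite /iR mulr0.
rewrite Re_lap_axis => /esym/eqP; rewrite addr_eq0 => /eqP ->.
rewrite addrC -rintB //; apply: eq_Rintegral => t _; rewrite mul0r cos0; ring.
Qed.

Lemma Im_lap_trunc_kernel_le0 s : 0 <= - (s * Im (lap b (iR s))).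
Proof.
rewrite Im_lap_trunc_kernel; apply: Rintegral_ge0 => t /gt0_itv t0.
apply: mulr_ge0; first by rewrite oppr_ge0; apply: trunc_kernel'_le0; exact: ltW.
by rewrite subr_ge0 cos_le1.
Qed.

(* An increasing rational majorant: after an integration by parts, the bound
   [b t <= 1 / (2 t)] turns it into the exact constant [pi / 2]. *)
Lemma oneBcos_le u : 1 - cos u <= 4 - 16 / (4 + u ^+ 2) :> R.
Proof.
have u2 := sqr_ge0 u; have p : 0 < 4 + u ^+ 2 by lra.
have -> : 4 - 16 / (4 + u ^+ 2) = 4 * u ^+ 2 / (4 + u ^+ 2) by field; rewrite addrC lt0r_neq0 //; lra.
rewrite ler_pdivlMr //.
have [h|h] := leP 4 (u ^+ 2).
  by have := cos_geN1 u; nra.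
have e : 1 - cos u = 2 * sin (u / 2) ^+ 2.
  have -> : cos u = cos ((u / 2) *+ 2) by congr cos; rewrite -mulr_natr; field.
  by rewrite cos_mulr2n; have := cos2Dsin2 (u / 2); lra.
have hs : sin (u / 2) ^+ 2 <= (u / 2) ^+ 2.
  by rewrite -real_normK ?num_real // -[leRHS]real_normK ?num_real // lerXn2r ?nnegrE // sin_le_abs.
rewrite e; move: hs; rewrite exprMn exprVn; move: (sin (u / 2) ^+ 2) (u ^+ 2) u2 h p => S U *; nra.
Qed.

Let q s t : R := (4 + (s * t) ^+ 2)^-1.
Let d0 s t : 0 < 4 + (s * t) ^+ 2. Proof. by have := sqr_ge0 (s * t); lra. Qed.

Let dq s t : is_derive t 1 (q s) (- (2 * s ^+ 2 * t) * q s t ^+ 2).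
Proof.
have h1 := rderM (rder_cst t s) (rder_id t).
have h := rderD (rder_cst t 4) (rderM h1 h1).
have hV := rderV (_ : (fun y => 4 + s * y * (s * y)) t != 0) h.
rewrite /q; under eq_fun do rewrite expr2.
apply: rder_eq (hV _) _; first by rewrite -expr2 lt0r_neq0.
by have := lt0r_neq0 (d0 s t); rewrite /= expr2 => n0; field.
Qed.

(** Put [f t = 4 - 16 * q s t], the majorant of [1 - cos (s * t)], so that
    [f' t = 32 * s ^+ 2 * t * q s t ^+ 2]. Then [psi] is [- (b f)' + f' / (2 t)], and its primitive
    [Psi] rises from 0 at 0 to [s * (pi / 2)] at infinity. *)
Let psi s t := - b' t * (4 - 16 * q s t) - b t * (32 * s ^+ 2 * t * q s t ^+ 2) + 16 * s ^+ 2 * q s t ^+ 2.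
Let Psi s t := - b t * (4 - 16 * q s t) + s * (2 * (s * t) * q s t + atan (s * t / 2)).

Let dPsi s t : is_derive t 1 (Psi s) (psi s t).
Proof.
have hq := dq s t; have hb := rder_trunc_kernel K t.
have h1 := rderM (rder_cst t s) (rder_id t).
have h2 := rderM h1 (rder_cst t 2^-1).
have ha := rder_comp (is_derive1_atan ((fun y => s * y / 2) t)) h2.
have hA := rderM (rderN hb) (rderB (rder_cst t 4) (rderM (rder_cst t 16) hq)).
have hB := rderM (rder_cst t s) (rderD (rderM (rderM (rder_cst t 2) h1) hq) ha).
apply: rder_eq (rderD hA hB) _ => /=; rewrite /psi.
have n0 := lt0r_neq0 (d0 s t).
have e : (1 + (s * t / 2) ^+ 2)^-1 = 4 * q s t.
  rewrite /q; have -> : 1 + (s * t / 2) ^+ 2 = (4 + (s * t) ^+ 2) / 4 by field.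
  by rewrite invf_div.
rewrite e /q; move: (b t) (b' t) => B B'; field; exact: n0.
Qed.

Let q_bounds s t : 0 < q s t <= 4^-1.
Proof.
rewrite /q invr_gt0 d0 /= lef_pV2 ?posrE ?d0 //; by have := sqr_ge0 (s * t); lra.
Qed.

Let sq_bound s t : (s * t) ^+ 2 * q s t <= 1.
Proof. by rewrite /q ler_pdivrMr ?d0 // mul1r; lra. Qed.

Let cq s : continuous (q s).
Proof. by move=> t; exact: rder_continuous (dq s t). Qed.

Let cpsi s : continuous (psi s).
Proof.
move=> t; have cb := @continuous_trunc_kernel R K t; have cb' := @continuous_trunc_kernel' R K t.
have c2 : q s x ^+ 2 @[x --> t] --> q s t ^+ 2 by apply: exprn_continuous_comp || (rewrite expr2; under eq_fun do rewrite expr2; apply: cvgM; exact: cq).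
apply: cvgD; last by apply: cvgM; [exact: cvg_cst|exact: c2].
apply: cvgB.
  apply: cvgM; first exact: cvgN.
  by apply: cvgB; [exact: cvg_cst|apply: cvgM; [exact: cvg_cst|exact: cq]].
apply: cvgM; first exact: cb.
apply: cvgM; last exact: c2.
by apply: cvgM; [exact: cvg_cst|exact: cvg_id].
Qed.

(** The difference between [psi] and [- b' f] is [f' * (1 / (2 t) - b)]. It is nonnegative since [f]
    increases, which [1 - cos] itself does not do. *)
Let psi_ge s t : 0 < t -> - b' t * (1 - cos (s * t)) <= psi s t.
Proof.
move=> t0; have h1 := oneBcos_le (s * t); have h2 := trunc_kernel_le_inv K t0.
have h3 := trunc_kernel'_le0 K (ltW t0).
have -> : psi s t = - b' t * (4 - 16 * q s t) + 16 * s ^+ 2 * q s t ^+ 2 * (1 - b t * (2 * t)).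
  by rewrite /psi; ring.
apply: (@le_trans _ _ (- b' t * (4 - 16 * q s t))).
  by apply: ler_wpM2l => //; rewrite oppr_ge0.
rewrite lerDl; apply: mulr_ge0; first exact: mulr_ge0 (mulr_ge0 (ler0n R 16) (sqr_ge0 s)) (sqr_ge0 _).
by rewrite subr_ge0 -ler_pdivlMr // mulr_gt0.
Qed.

Let ipsi s : 0 < s -> rintble `]0, +oo[ (psi s).
Proof.
move=> s0.
(* One constant per summand of [psi]: 4 bounds [4 - 16 q], [s * 2] bounds [32 s^2 t q^2], each times
   the bound [2 K] of the kernels; [s ^+ 2 + 1] bounds [16 s^2 q^2 (1 + t^2)]. *)
apply: (rintble_le _ _ (rintble_onesqr_half ((4 + s * 2) * (2 * K%:R) + (s ^+ 2 + 1)))) => //.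
  exact: continuous_measurable_fun.
move=> t /gt0_itv t0; have [/ltW q0 q1] := andP (q_bounds s t).
have k0 : 0 <= 2 * K%:R * (1 + t ^+ 2)^-1 by rewrite !mulr_ge0 // invr_ge0 ltW // onesqr_gt0.
rewrite [leRHS]mulrDl -[(4 + s * 2) * _ * _]mulrA.
apply: (le_trans (ler_normD _ _)); apply: lerD.
  apply: (le_trans (ler_normB _ _)); rewrite [leRHS]mulrDl; apply: lerD.
    rewrite normrM normrN mulrC; apply: ler_pM => //; last exact: trunc_kernel'_le.
    by rewrite ler_norml; apply/andP; split; lra.
  rewrite normrM mulrC; apply: ler_pM => //; last first.
    by rewrite ger0_norm ?trunc_kernel_ge0 // trunc_kernel_le.
  rewrite (_ : _ * q s t ^+ 2 = s * (32 * (s * t) * q s t ^+ 2)); last by ring.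
  have st0 : 0 < s * t by rewrite mulr_gt0.
  rewrite ger0_norm; last exact: mulr_ge0 (ltW s0) (mulr_ge0 (mulr_ge0 (ler0n R 32) (ltW st0)) (sqr_ge0 _)).
  apply: ler_wpM2l; first exact: ltW.
  rewrite /q exprVn ler_pdivrMr ?exprn_gt0 ?d0 //.
  move: (s * t) st0 => u u0; have := sqr_ge0 (u - 2); rewrite !expr2; nra.
rewrite ger0_norm; last exact: mulr_ge0 (mulr_ge0 (ler0n R 16) (sqr_ge0 s)) (sqr_ge0 _).
rewrite ler_pdivlMr ?onesqr_gt0 //.
have -> : 16 * s ^+ 2 * q s t ^+ 2 * (1 + t ^+ 2) = 16 * s ^+ 2 * q s t ^+ 2 + 16 * (s * t) ^+ 2 * q s t ^+ 2 by ring.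
apply: lerD.
  have : q s t ^+ 2 <= 4^-1 ^+ 2 by rewrite lerXn2r // nnegrE.
  by have := sqr_ge0 s; rewrite !expr2; nra.
rewrite /q exprVn ler_pdivrMr ?exprn_gt0 ?d0 // mul1r.
by move: ((s * t) ^+ 2) => u; have := sqr_ge0 (u - 4); rewrite !expr2; lra.
Qed.

Let lim_Psi s : 0 < s -> Psi s n.+1%:R @[n --> \oo] --> 0 + s * (0 + pi / 2).
Proof.
move=> s0; apply: cvgD.
  apply: (@norm_cvg0 _ R).
  have l4 : trunc_kernel K n.+1%:R * 4 @[n --> \oo] --> (0 : R).
    by rewrite -(mul0r (4 : R)); apply: cvgM; [exact: cvg_trunc_kernel|exact: cvg_cst].
  apply: (squeeze_cvgr _ (cvg_cst 0) l4).
  near=> n; have [/ltW q0 q1] := andP (q_bounds s n.+1%:R).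
  rewrite normr_ge0 /= normrM normrN (ger0_norm (trunc_kernel_ge0 _ _)).
  apply: ler_wpM2l; first exact: trunc_kernel_ge0.
  by rewrite ler_norml; apply/andP; split; lra.
apply: cvgM; first exact: cvg_cst.
apply: cvgD.
  apply: (@norm_cvg0 _ R).
  apply: (squeeze_cvgr _ (cvg_cst 0) (cvg_invn (2 / s))); near=> n.
  have n0 : 0 < n.+1%:R :> R by rewrite ltr0n.
  have u0 : 0 < s * n.+1%:R by rewrite mulr_gt0.
  have [/ltW q0 q1] := andP (q_bounds s n.+1%:R).
  rewrite normr_ge0 ger0_norm /=; last exact: mulr_ge0 (mulr_ge0 (ler0n R 2) (ltW u0)) q0.
  have -> : 2 / s / n.+1%:R = 2 / (s * n.+1%:R) by rewrite invfM mulrA.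
  rewrite ler_pdivlMr //; have := sq_bound s n.+1%:R.
  by rewrite !expr2; move: (s * _) (q _ _) => u Q; lra.
apply: (cvg_comp _ atan _ (@cvgy_atan R)).
apply/cvgryPge => A; near=> n.
have h : A * 2 / s <= n%:R by near: n; exact: nbhs_infty_ger.
have : A * 2 / s <= n.+1%:R by apply: (le_trans h); rewrite ler_nat.
by rewrite ler_pdivrMr // [s * _]mulrC ler_pdivlMr.
Unshelve. all: by end_near. Qed.

Lemma Im_lap_trunc_kernel_le s : 0 < s -> - (s * Im (lap b (iR s))) <= s * (pi / 2).
Proof.
move=> s0; rewrite Im_lap_trunc_kernel.
have <- : \int[mu]_(t in `]0, +oo[) psi s t = s * (pi / 2).
  have := lim_Psi s0; rewrite !add0r => l.
  have P0 : Psi s 0 = 0.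
    rewrite /Psi /q !(mulr0, mul0r, atan0, expr0n) /= !addr0.
    have -> : 4 - 16 * 4^-1 = 0 :> R by field.
    by rewrite !mulr0 addr0.
  by rewrite (rint_ftc0y (dPsi s) (@cpsi s) (ipsi s0) P0 l) subr0.
apply: le_Rintegral => //; last first.
- by move=> t /gt0_itv; exact: psi_ge.
- exact: ipsi.
- apply: (rintble_eq _ _ (rintbleB (measurable_itv _) (ib'c s) ib')) => // t _; ring.
Qed.

End AxisPhase.

(** * Sign and decay of the two densities *)

Section AxisDecay.
Variable R : realType.
Implicit Types (z w : R[i]) (x y s t T : R).
Local Open Scope classical_set_scope.

Lemma rsinh_ge0 x : 0 <= x -> 0 <= rsinh x.
Proof. by move=> x0; rewrite divr_ge0 // subr_ge0 ler_expR; lra. Qed.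

Lemma rsinh_le x : 0 <= x -> rsinh x <= x * expR x.
Proof.
move=> x0; rewrite /rsinh ler_pdivrMr //.
have -> : expR (- x) = expR x * expR (- (2 * x)) by rewrite -expRD; congr expR; lra.
have := expR_ge1Dx (- (2 * x)); have := expR_gt0 x; move: (expR x) (expR _) => e f; nra.
Qed.

Lemma expr_le_fact_expR x n : 0 <= x -> x ^+ n <= n`!%:R * expR x.
Proof.
move=> x0; case: n => [|n]; first by rewrite expr0 mul1r; have := expR_ge1Dx x; lra.
have := expR_ge1Dxn n x0; have f0 : 0 < n.+1`!%:R :> R by rewrite ltr0n fact_gt0.
move=> h; rewrite mulrC -ler_pdivrMr //; lra.
Qed.

(** Comparing [expR |s|] with single terms of its series bounds
    [|s| ^+ n * (1 + s ^+ 2) * expR (- |s|)] by the two factorials. *)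
Lemma rintble_exprM_expN n (A : R -> R) C : measurable_fun setT A ->
  (forall s, `|A s| <= C * `|s| ^+ n * expR (- `|s|)) -> rintble setT A.
Proof.
move=> mA hA; have C0 : 0 <= C.
  have := le_trans (normr_ge0 _) (hA 1); rewrite normr1 expr1n mulr1.
  by rewrite pmulr_lge0 ?expR_gt0.
apply: (rintble_le measurableT mA (rintbleZ (C * (n`!%:R + n.+2`!%:R)) measurableT (rintble_oneDsqrV R))).
move=> s _; apply: (le_trans (hA s)); rewrite -!mulrA; apply: ler_wpM2l => //.
rewrite ler_pdivlMr ?onesqr_gt0 // expRN mulrAC ler_pdivrMr ?expR_gt0 //.
have h1 := expr_le_fact_expR n (normr_ge0 s); have h2 := expr_le_fact_expR n.+2 (normr_ge0 s).
rewrite mulrDr mulr1 mulrDl; apply: lerD => //.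
by rewrite -(real_normK (num_real s)) -exprD addn2.
Qed.

Variable K : nat.
Local Notation b := (@trunc_kernel R K).

Definition axis_modulus s : R := \sum_(k < K) expR (- (freq R k * `|s|)) / (2 * k.+1%:R).

Lemma axis_modulus_ge0 s : 0 <= axis_modulus s.
Proof. by apply: sumr_ge0 => k _; rewrite divr_ge0 ?expR_ge0. Qed.

Lemma axis_modulus_le s : axis_modulus s <= K%:R * expR (- `|s|).
Proof.
rewrite mulr_natl -[K in _ *+ K]card_ord -sumr_const; apply: ler_sum => k _.
have k1 : 1 <= k.+1%:R :> R by rewrite ler1n.
rewrite ler_pdivrMr; last lra.
apply: (@le_trans _ _ (expR (- `|s|))).
  by rewrite ler_expR lerN2 ler_peMl ?freq_ge1.
by rewrite ler_peMr ?expR_ge0 //; lra.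
Qed.

Lemma rsinh_axis_modulus_le s : rsinh (axis_modulus s) <= (K%:R * expR K%:R) * expR (- `|s|).
Proof.
have r0 := axis_modulus_ge0 s; have r1 := axis_modulus_le s.
apply: (le_trans (rsinh_le r0)); rewrite mulrAC; apply: ler_pM; rewrite ?expR_ge0 // ler_expR.
by apply: (le_trans r1); rewrite ler_piMr // expR_le1 oppr_le0.
Qed.

Let phi s := Im (lap b (iR s)).

Let phiN s : phi (- s) = - phi s.
Proof.
rewrite /phi (_ : iR (- s) = conjc (iR s)); last by rewrite conj_iR iRN.
by rewrite lap_conj ?Re_iR ?Im_conj //; exact: kernel_trunc.
Qed.

Let phi_gt0 s : 0 < s -> - (pi / 2) <= phi s <= 0.
Proof.
move=> s0; have h1 := Im_lap_trunc_kernel_le0 K s; have h2 := Im_lap_trunc_kernel_le K s0.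
move: h1 h2; rewrite -mulrN -/(phi s) pmulr_rge0 // ler_pM2l // => h1 h2.
by apply/andP; split; lra.
Qed.

Let phi_bound s : `|phi s| <= pi / 2.
Proof.
have p := @pi_ge0 R.
have [s0|s0|<-] := ltgtP 0 s.
- by have /andP[] := phi_gt0 s0; rewrite ler_norml => a c; apply/andP; split; lra.
- have /andP[] := @phi_gt0 (- s) ltac:(lra).
  by rewrite phiN ler_norml => a c; apply/andP; split; lra.
- have : phi 0 = 0 by have := phiN 0; rewrite oppr0; lra.
  by move=> ->; rewrite normr0; lra.
Qed.

Let sin_phi s : s * sin (phi s) <= 0.
Proof.
have p := @pi_ge0 R.
suff H x : 0 < x -> x * sin (phi x) <= 0.
  have [s0|s0|<-] := ltgtP 0 s; [exact: H| |by rewrite mul0r].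
  by have := H (- s); rewrite phiN sinN mulrNN; apply; lra.
move=> x0; have /andP[h1 h2] := phi_gt0 x0.
rewrite pmulr_rle0 // -oppr_ge0 -sinN; apply: sin_ge0_pi; apply/andP; split; lra.
Qed.

Lemma axis_sinh_trunc s : axis_sinh b s = rsinh (axis_modulus s) * cos (phi s).
Proof. by rewrite axis_sinhE Re_lap_trunc_kernel. Qed.

Lemma axis_cosh_trunc s : axis_cosh b s = - (s * (rsinh (axis_modulus s) * sin (phi s))).
Proof. by rewrite axis_coshE Re_lap_trunc_kernel. Qed.

(** Here the constant [pi / 2] in the phase bound is essential, as it makes the cosine nonnegative.
    The other density only uses that the phase has the sign opposite to [s] and modulus at most
    [pi]. *)
Lemma axis_sinh_ge0 s : 0 <= axis_sinh b s.
Proof.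
rewrite axis_sinh_trunc mulr_ge0 ?rsinh_ge0 ?axis_modulus_ge0 // cos_ge0_pihalf //.
by rewrite -ler_norml.
Qed.

Lemma axis_cosh_ge0 s : 0 <= axis_cosh b s.
Proof.
rewrite axis_cosh_trunc mulrCA -mulrN mulr_ge0 ?rsinh_ge0 ?axis_modulus_ge0 // oppr_ge0.
exact: sin_phi.
Qed.

Lemma moments_finite_decay (A : R -> R) n C : measurable_fun setT A ->
  (forall s, `|A s| <= C * `|s| ^+ n * expR (- `|s|)) -> moments_finite A.
Proof.
move=> mA hA; split=> // j; apply: (@rintble_exprM_expN (j.*2 + n) _ C).
  by apply: measurable_funM => //; exact: measurable_funX.
move=> s; rewrite normrM normrX exprD [leRHS](_ : _ = `|s| ^+ j.*2 * (C * `|s| ^+ n * expR (- `|s|))); last ring.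
by apply: ler_wpM2l => //; exact: exprn_ge0.
Qed.

Lemma moments_finite_sinh : moments_finite (axis_sinh b).
Proof.
apply: (@moments_finite_decay _ 0 (K%:R * expR K%:R)).
  apply: measurable_axis_sinh; exact: kernel_trunc.
move=> s; rewrite expr0 mulr1 axis_sinh_trunc normrM -[leRHS]mulr1.
have r := rsinh_ge0 (axis_modulus_ge0 s).
by apply: ler_pM => //; [rewrite ger0_norm // rsinh_axis_modulus_le|exact: cos_max].
Qed.

Lemma moments_finite_cosh : moments_finite (axis_cosh b).
Proof.
apply: (@moments_finite_decay _ 1 (K%:R * expR K%:R)).
  apply: measurable_axis_cosh; exact: kernel_trunc.
move=> s; rewrite axis_cosh_trunc normrN normrM normrM expr1 [leRHS]mulrAC mulrC.
have r := rsinh_ge0 (axis_modulus_ge0 s).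
apply: ler_pM => //; rewrite ?mulr_ge0 // -[leRHS]mulr1.
by apply: ler_pM => //; [rewrite ger0_norm // rsinh_axis_modulus_le|exact: sin_max].
Qed.

Lemma trunc_kernel_bound z (e : bool) N : (1 <= N)%N -> 0 < Re z ->
  normc (cexp ((-1) ^+ e * lap b z) - \sum_(n < N) ((-1) ^+ e) ^+ n * (mcoef b n)%:C / z ^+ n) <=
  (`|mcoef b N| / normc z ^+ N + `|mcoef b N.+1| / normc z ^+ N.+1) * cscfac z.
Proof.
apply: (truncated_bound (@kernel_trunc R K) (@kernel_trunc' R K) (b0 := b 0)).
- exact: lap_trunc_kernel_by_parts.
- exact: moments_finite_sinh.
- exact: moments_finite_cosh.
- exact: axis_sinh_ge0.
- exact: axis_cosh_ge0.
Qed.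

End AxisDecay.

(** * Expansion coefficients and Bernoulli numbers *)

Section Germs.
Variable R : realType.
Implicit Types (f g : R -> R) (x y : R) (p q : {poly R}).

(** The variable stands for [1 / z] with [z] large and real, later also for [t] near 0. A bound on
    all of []0, 1]] avoids choosing neighbourhoods. *)
Definition bigO n f := exists C, forall y, 0 < y <= 1 -> `|f y| <= C * y ^+ n.

Lemma bigO_eq n f g : (forall y, 0 < y <= 1 -> f y = g y) -> bigO n f -> bigO n g.
Proof. by move=> e [C h]; exists C => y y01; rewrite -e //; exact: h. Qed.

Lemma bigOD n f g : bigO n f -> bigO n g -> bigO n (fun y => f y + g y).
Proof.
move=> [C h] [D k]; exists (C + D) => y y01; rewrite mulrDl.
by apply: (le_trans (ler_normD _ _)); apply: lerD; [exact: h|exact: k].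
Qed.

Lemma bigON n f : bigO n f -> bigO n (fun y => - f y).
Proof. by move=> [C h]; exists C => y y01; rewrite normrN; exact: h. Qed.

Lemma bigOB n f g : bigO n f -> bigO n g -> bigO n (fun y => f y - g y).
Proof. by move=> h k; apply: bigOD => //; exact: bigON. Qed.

Lemma bigOM m n f g : bigO m f -> bigO n g -> bigO (m + n) (fun y => f y * g y).
Proof.
move=> [C h] [D k]; exists (C * D) => y y01; rewrite normrM exprD mulrACA.
by apply: ler_pM => //; [exact: h|exact: k].
Qed.

Lemma bigO_cst c : bigO 0 (fun=> c).
Proof. by exists `|c| => y _; rewrite expr0 mulr1. Qed.

Lemma bigO_id : bigO 1 id.
Proof. by exists 1 => y /andP[y0 _]; rewrite mul1r expr1 ger0_norm // ltW. Qed.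

Lemma bigO_sum n m (F : 'I_m -> R -> R) : (forall i, bigO n (F i)) -> bigO n (fun y => \sum_(i < m) F i y).
Proof.
elim: m F => [|m IH] F h.
  by exists 0 => y _; rewrite big_ord0 normr0 mul0r.
by under eq_fun do rewrite big_ord_recr; apply: bigOD => //; exact: IH.
Qed.

Lemma bigOW m n f : (m <= n)%N -> bigO n f -> bigO m f.
Proof.
move=> mn [C h]; exists C => y y01; apply: (le_trans (h y y01)).
have C0 : 0 <= C by have := h 1 ltac:(by rewrite ltr01 lexx); rewrite expr1n mulr1; apply: le_trans.
by move: y01 => /andP[y0 y1]; apply: ler_wpM2l => //; apply: ler_wiXn2l => //; exact: ltW.
Qed.

Lemma bigO_poly p : bigO 0 (fun y => p.[y]).
Proof.
elim/poly_ind: p => [|p c IH]; first by under eq_fun do rewrite horner0; exact: bigO_cst.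
under eq_fun do rewrite hornerMXaddC.
by apply: bigOD; [apply: (bigOM IH); exact: (bigOW (leq0n 1) bigO_id)|exact: bigO_cst].
Qed.

Lemma bigO1_cst c : bigO 1 (fun=> c) -> c = 0.
Proof.
move=> [C h]; apply/eqP; apply: contraT => c0.
have c1 : 0 < `|c| by rewrite normr_gt0.
have hC : `|c| <= C by have := h 1 ltac:(by rewrite ltr01 lexx); rewrite expr1n mulr1.
have C0 : 0 < C by apply: lt_le_trans hC.
have := h (`|c| / (2 * C)); rewrite expr1 divr_gt0 ?mulr_gt0 // ler_pdivrMr ?mulr_gt0 //.
move=> /(_ ltac:(lra)).
rewrite (_ : C * _ = `|c| / 2); last by field; rewrite gt_eqF.
lra.
Qed.

(** Uniqueness of asymptotic expansions: the constant coefficient vanishes, so one factor of the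
    variable can be divided out of both sides. *)
Lemma germ_coef0 p n : bigO n.+1 (fun y => p.[y]) -> p`_n = 0.
Proof.
elim: n p => [|n IH] p; elim/poly_ind: p => [|p c _]; rewrite ?coef0 // => h.
  rewrite coefD coefMX coefC /= add0r; apply: bigO1_cst.
  apply: (bigO_eq _ (bigOB h (bigOM (bigO_poly p) bigO_id))) => y _.
  by rewrite hornerMXaddC /=; ring.
have c0 : c = 0.
  apply: bigO1_cst; apply: (bigO_eq _ (bigOB (bigOW _ h) (bigOM (bigO_poly p) bigO_id))) => // y _.
  by rewrite hornerMXaddC /=; ring.
rewrite c0 addr0 coefMX /=; apply: IH; case: h => C h; exists C => y y01.
have /andP[y0 _] := y01; have := h y y01.
rewrite c0 addr0 hornerMX normrM (gtr0_norm y0) exprS => k.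
by rewrite -(ler_pM2r y0) -mulrA [_ ^+ _ * y]mulrC.
Qed.

Lemma rder_exprn x n : is_derive x 1 (fun y => y ^+ n) (n%:R * x ^+ n.-1).
Proof.
elim: n => [|n IH]; first by rewrite mul0r; exact: rder_cst.
under eq_fun do rewrite exprS.
apply: rder_eq (rderM (rder_id x) IH) _; case: n {IH} => [|n] /=; first by rewrite !expr0; ring.
by rewrite exprS -(natr1 n.+1); ring.
Qed.

Definition exp_taylor n x : R := \sum_(k < n) (k`!%:R)^-1 * x ^+ k.

Lemma rder_exp_taylor x n : is_derive x 1 (exp_taylor n.+1) (exp_taylor n x).
Proof.
elim: n => [|n IH].
  rewrite {2}/exp_taylor big_ord0 /exp_taylor; under eq_fun do rewrite big_ord1 expr0; exact: rder_cst.
rewrite {1}/exp_taylor; under eq_fun do rewrite big_ord_recr.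
have e : exp_taylor n.+1 x = exp_taylor n x + (0 * x ^+ n.+1 + (n.+1`!%:R)^-1 * (n.+1%:R * x ^+ n)).
  rewrite /exp_taylor big_ord_recr /= factS natrM invfM mul0r add0r; congr (_ + _).
  have n0 : n.+1%:R != 0 :> R by rewrite pnatr_eq0.
  have f0 : n`!%:R != 0 :> R by rewrite pnatr_eq0 -lt0n fact_gt0.
  by move: (n.+1%:R) (n`!%:R) n0 f0 => c d c0 d0; field; rewrite c0 d0.
rewrite e; apply: rderD IH _; exact: (rderM (rder_cst x (n.+1`!%:R)^-1) (rder_exprn x n.+1)).
Qed.

Lemma exp_taylor_remainder n x : `|expR x - exp_taylor n x| <= expR `|x| * `|x| ^+ n.
Proof.
elim: n x => [|n IH] x.
  by rewrite /exp_taylor big_ord0 subr0 expr0 mulr1 ger0_norm ?expR_ge0 // ler_expR ler_norm.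
have d y : is_derive y 1 (fun y => expR y - exp_taylor n.+1 y) (expR y - exp_taylor n y).
  exact: rderB (is_derive_expR y) (rder_exp_taylor y n).
have z0 : expR 0 - exp_taylor n.+1 0 = 0 :> R.
  rewrite expR0 /exp_taylor big_ord_recl big1 => [|i _]; last by rewrite expr0n mulr0.
  by rewrite fact0 invr1 expr0 mul1r addr0 subrr.
have cd (a c : R) : {within `[a, c], continuous (fun y => expR y - exp_taylor n.+1 y)}%classic.
  by apply: continuous_subspaceT => y; exact: rder_continuous (d y).
have step y : `|y| <= `|x| -> `|(expR y - exp_taylor n y) * x| <= expR `|x| * `|x| ^+ n.+1.
  move=> yx; rewrite normrM exprSr mulrA; apply: ler_wpM2r => //.
  apply: (le_trans (IH y)); apply: ler_pM; rewrite ?expR_ge0 ?exprn_ge0 ?ler_expR //.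
  by rewrite lerXn2r // nnegrE.
have [x0|x0|x0] := ltgtP 0 x; last by rewrite -x0 z0 normr0 expr0n mulr0.
  have [c] := MVT x0 (fun y _ => d y) (cd 0 x); rewrite in_itv /= => /andP[c0 cx].
  rewrite z0 !subr0 => ->; apply: step.
  by rewrite (gtr0_norm c0) (gtr0_norm x0) ltW.
have [c] := MVT x0 (fun y _ => d y) (cd x 0); rewrite in_itv /= => /andP[c0 cx].
rewrite z0 !sub0r => /eqP; rewrite eqr_oppLR => /eqP ->; rewrite mulrN opprK; apply: step.
by rewrite (ltr0_norm cx) (ltr0_norm x0) lerN2 ltW.
Qed.

Lemma bigO_exp_taylor f n : bigO 1 f -> bigO n (fun y => expR (f y) - exp_taylor n (f y)).
Proof.
move=> [C h]; have C0 : 0 <= C.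
  by have := h 1 ltac:(by rewrite ltr01 lexx); rewrite expr1n mulr1; apply: le_trans.
exists (expR C * C ^+ n) => y y01; apply: (le_trans (exp_taylor_remainder _ _)).
have hy := h y y01; have /andP[y0 y1] := y01.
rewrite -mulrA -exprMn; apply: ler_pM; rewrite ?expR_ge0 ?exprn_ge0 //.
  by rewrite ler_expR; apply: (le_trans hy); rewrite expr1 ler_piMr.
by rewrite lerXn2r ?nnegrE // mulr_ge0 // ltW.
Qed.

Lemma bigO_subX f g n k : bigO 0 f -> bigO 0 g -> bigO n (fun y => f y - g y) ->
  bigO n (fun y => f y ^+ k - g y ^+ k).
Proof.
move=> hf hg h; elim: k => [|k IH].
  by exists 0 => y _; rewrite subrr normr0 mul0r.
have hk : bigO 0 (fun y => g y ^+ k).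
  elim: (k) => [|j IHj]; first by under eq_fun do rewrite expr0; exact: bigO_cst.
  by under eq_fun do rewrite exprS; exact: (bigOM hg IHj).
have h1 := bigOM hf IH; have h2 := bigOM hk h.
apply: (bigO_eq _ (bigOD h1 h2)) => y _; rewrite !exprS; ring.
Qed.

End Germs.

(** * The expansion coefficients for the truncated kernel *)

Section TruncatedCoefficients.
Variable R : realType.
Implicit Types (x y t : R) (a : nat -> R).
Local Open Scope classical_set_scope.

Lemma measurable_exprM_expN n x : measurable_fun setT (fun t => t ^+ n * expR (- (x * t))).
Proof.
apply: measurable_funM; first exact: measurable_funX.
have : cmeas (fun t => cexp (- (x * t))%:C) by apply: cmeas_cexp; apply: cmeasR; apply: measurable_funN; exact: measurable_funM.
by case; under eq_fun do rewrite cexpR ReC.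
Qed.

Lemma rintble_exprM_expNM n x : 0 < x -> rintble `]0, +oo[ (fun t => t ^+ n * expR (- (x * t))).
Proof.
move=> x0; set C := n`!%:R / x ^+ n + n.+2`!%:R / x ^+ n.+2.
apply: (rintble_le _ (measurable_exprM_expN n x) (rintble_onesqr_half C)) => // t /gt0_itv t0.
have h m : t ^+ m <= m`!%:R / x ^+ m * expR (x * t).
  rewrite mulrAC ler_pdivlMr ?exprn_gt0 // -exprMn [t * x]mulrC.
  by apply: expr_le_fact_expR; rewrite mulr_ge0 // ltW.
rewrite ger0_norm; last by rewrite mulr_ge0 ?expR_ge0 // exprn_ge0 // ltW.
rewrite ler_pdivlMr ?onesqr_gt0 // expRN mulrAC ler_pdivrMr ?expR_gt0 //.
by rewrite mulrDr mulr1 -exprD addn2 mulrDl; apply: lerD.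
Qed.

Lemma cvg_exprM_expN n x : 0 < x -> k.+1%:R ^+ n * expR (- (x * k.+1%:R)) @[k --> \oo] --> (0 : R).
Proof.
move=> x0; apply: (@norm_cvg0 _ R).
apply: (squeeze_cvgr _ (cvg_cst 0) (cvg_invn (n.+1`!%:R / x ^+ n.+1))); near=> k.
have k0 : 0 < k.+1%:R :> R by rewrite ltr0n.
rewrite normr_ge0 ger0_norm /=; last by rewrite mulr_ge0 ?expR_ge0 // exprn_ge0.
rewrite ler_pdivlMr // mulrAC -exprSr expRN ler_pdivrMr ?expR_gt0 //.
rewrite mulrAC ler_pdivlMr ?exprn_gt0 // -exprMn [_ * x]mulrC.
by apply: expr_le_fact_expR; rewrite mulr_ge0 // ltW.
Unshelve. all: by end_near. Qed.

Lemma rint_exprM_expN n x : 0 < x ->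
  \int[mu]_(t in `]0, +oo[) (t ^+ n * expR (- (x * t))) = n`!%:R / x ^+ n.+1.
Proof.
move=> x0; have xn := lt0r_neq0 x0.
have de t : is_derive t 1 (fun t => expR (- (x * t))) (- x * expR (- (x * t))).
  have h := rder_comp (is_derive_expR ((fun t => - (x * t)) t)) (rderN (rderM (rder_cst t x) (rder_id t))).
  by apply: rder_eq h _ => /=; ring.
have dm m t : is_derive t 1 (fun t => t ^+ m * expR (- (x * t)))
    (m%:R * t ^+ m.-1 * expR (- (x * t)) + t ^+ m * (- x * expR (- (x * t)))).
  exact: (rderM (rder_exprn t m) (de t)).
have cm m : continuous (fun t => t ^+ m * expR (- (x * t))) by move=> t; exact: rder_continuous (dm m t).
elim: n => [|n IH].
  have ih := rintble_exprM_expNM 0 x0.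
  rewrite fact0 mul1r expr1 -[RHS]opprK -[RHS]sub0r.
  apply: (@rint_ftc0y _ _ (fun t => - x^-1 * (t ^+ 0 * expR (- (x * t))))) => //.
  - move=> t; apply: rder_eq (rderM (rder_cst t (- x^-1)) (dm 0%N t)) _.
    by rewrite expr0; field.
  - by rewrite mulr0 oppr0 expR0 expr0 !mulr1.
  - by rewrite -(mulr0 (- x^-1)); apply: cvgM; [exact: cvg_cst|exact: cvg_exprM_expN].
have i1 := rintble_exprM_expNM n.+1 x0; have i0 := rintble_exprM_expNM n x0.
have : \int[mu]_(t in `]0, +oo[) (n.+1%:R * (t ^+ n * expR (- (x * t))) - x * (t ^+ n.+1 * expR (- (x * t)))) = 0 - 0.
  apply: (@rint_ftc0y _ _ (fun t => t ^+ n.+1 * expR (- (x * t)))).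
  - by move=> t; apply: rder_eq (dm n.+1 t) _ => /=; ring.
  - by move=> t; apply: cvgB; (apply: cvgM; first exact: cvg_cst); exact: cm.
  - by apply: rintbleB => //; exact: rintbleZ.
  - by rewrite expr0n mul0r.
  - exact: cvg_exprM_expN.
rewrite (rintB (measurable_itv _) (rintbleZ _ (measurable_itv _) i0) (rintbleZ _ (measurable_itv _) i1)).
rewrite (rintZ _ (measurable_itv _) i0) (rintZ _ (measurable_itv _) i1) IH subr0 => /eqP.
rewrite subr_eq0 => /eqP e; apply: (mulfI xn); rewrite -e factS natrM !exprS.
by field; rewrite xn expf_neq0.
Qed.

(** A partial sum of [2 zeta(2j + 2) / (2 pi)^(2j + 2)]; with the sign [(-1) ^+ j], the coefficient
    of [t^(2j)] in the truncated kernel. *)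
Definition freq_sum K j : R := \sum_(k < K) 2 / freq R k ^+ j.*2.+2.

Lemma pole_pair_expansion J k t : pole_pair k t - \sum_(j < J) (-1) ^+ j * (2 / freq R k ^+ j.*2.+2) * t ^+ j.*2 =
  (-1) ^+ J * (t ^+ J.*2 / freq R k ^+ J.*2) * pole_pair k t.
Proof.
have f0 := lt0r_neq0 (freq_gt0 R k); have d0 := lt0r_neq0 (sqrD_freq_gt0 k t).
elim: J => [|J IH]; first by rewrite big_ord0 subr0 !expr0 divr1 !mul1r.
rewrite big_ord_recr /= opprD addrA IH doubleS !exprS /pole_pair.
have F0 := expf_neq0 J.*2 f0.
move: (freq R k ^+ J.*2) F0 => F F0; move: (freq R k) f0 d0 (t ^+ J.*2) ((-1) ^+ J) => f f0 d0 T e.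
by field; rewrite d0 F0 f0.
Qed.

Lemma trunc_kernel_expansion J K t :
  `|trunc_kernel K t - \sum_(j < J) (-1) ^+ j * freq_sum K j * t ^+ j.*2| <= freq_sum K 0 * t ^+ J.*2.
Proof.
have -> : trunc_kernel K t - \sum_(j < J) (-1) ^+ j * freq_sum K j * t ^+ j.*2 =
    \sum_(k < K) (pole_pair k t - \sum_(j < J) (-1) ^+ j * (2 / freq R k ^+ j.*2.+2) * t ^+ j.*2).
  rewrite sumrB; congr (_ - _); rewrite exchange_big; apply: eq_bigr => j _ /=.
  by rewrite /freq_sum mulr_sumr mulr_suml.
rewrite /freq_sum mulr_suml; apply: (le_trans (ler_norm_sum _ _ _)); apply: ler_sum => k _.
have f1 := freq_ge1 R k; have f0 := freq_gt0 R k.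
have t2 : 0 <= t ^+ J.*2 by rewrite -mul2n exprM exprn_ge0 // sqr_ge0.
rewrite pole_pair_expansion 2!normrM normrX normrN1 expr1n mul1r.
rewrite (ger0_norm (pole_pair_ge0 _ _)) ger0_norm; last by rewrite divr_ge0 // exprn_ge0 // ltW.
rewrite mulrC; apply: ler_pM.
- exact: pole_pair_ge0.
- by rewrite divr_ge0 // exprn_ge0 // ltW.
- rewrite /pole_pair ler_pM2l // lef_pV2 ?posrE ?sqrD_freq_gt0 ?exprn_gt0 //.
  by rewrite lerDr sqr_ge0.
- by rewrite ler_piMr // invf_le1 ?exprn_gt0 // exprn_ege1.
Qed.

Lemma lap_real (c : R -> R) x : lap c x%:C = (\int[mu]_(t in `]0, +oo[) (c t * expR (- (x * t))))%:C.
Proof.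
rewrite -cintR; apply: cint_eq => t _.
by rewrite -rmorphM -rmorphN cexpR -rmorphM.
Qed.

(* The coefficient of [z^(1 - 2j)] in the expansion of [lap (trunc_kernel K) z], for [1 <= j]. *)
Definition trunc_exponent_coef K j : R := (-1) ^+ j.-1 * (j.-1.*2)`!%:R * freq_sum K j.-1.

Definition odd_poly_of a n : {poly R} := \sum_(1 <= j < n.+1) a j *: 'X^(j.*2.-1).

Definition exp_coef a n : R := (\sum_(k < n.+1) (k`!%:R)^-1 *: odd_poly_of a n ^+ k)`_n.

Lemma horner_odd_poly_of a n y : (odd_poly_of a n).[y] = \sum_(j < n) a j.+1 * y ^+ j.*2.+1.
Proof.
rewrite /odd_poly_of big_add1 big_mkord horner_sum; apply: eq_bigr => j _.
by rewrite hornerZ hornerXn doubleS.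
Qed.

(** Watson's lemma with [x = y^-1]: the finite geometric expansion of the kernel, with its remainder
    valid for all [t], is integrated term by term against [expR (- (x * t))]. *)
Lemma bigO_lap_trunc_kernel K J :
  bigO J.*2.+1 (fun y => Re (lap (trunc_kernel K) (y^-1)%:C) - \sum_(j < J) trunc_exponent_coef K j.+1 * y ^+ j.*2.+1).
Proof.
exists (freq_sum K 0 * (J.*2)`!%:R) => y /andP[y0 _].
have x0 : 0 < y^-1 by rewrite invr_gt0.
set x := y^-1 in x0 *.
have ic : rintble `]0, +oo[ (fun t => trunc_kernel K t * expR (- (x * t))).
  have := (cintble_lap (@kernel_trunc R K) (w := x%:C) (ltW x0)).1.
  apply: rintble_eq => // t _; by rewrite -rmorphM -rmorphN cexpR -rmorphM ReC.
pose F (j : nat) t := (-1) ^+ j * freq_sum K j * (t ^+ j.*2 * expR (- (x * t))).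
have iF j : rintble `]0, +oo[ (F j) by apply: rintbleZ => //; exact: rintble_exprM_expNM.
have eF j : \int[mu]_(t in `]0, +oo[) F j t = trunc_exponent_coef K j.+1 * y ^+ j.*2.+1.
  rewrite rintZ ?rint_exprM_expN //; last exact: rintble_exprM_expNM.
  by rewrite /trunc_exponent_coef /= -exprVn /x invrK; ring.
have [iS eS] := cint_sum (F := fun (j : 'I_J) t => (F j t)%:C) (measurable_itv _)
  (fun j => cintbleR (measurable_itv _) (iF j)).
have eS' : \int[mu]_(t in `]0, +oo[) (\sum_(j < J) F j t) = \sum_(j < J) trunc_exponent_coef K j.+1 * y ^+ j.*2.+1.
  move/(congr1 (@complex.Re R)): eS; under eq_bigr do rewrite cintR eF.
  rewrite (Re_sum J (fun j => (trunc_exponent_coef K j.+1 * y ^+ j.*2.+1)%:C)) => <-.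
  by apply: eq_Rintegral => t _; rewrite (Re_sum J (fun j => (F j t)%:C)).
have iS' : rintble `]0, +oo[ (fun t => \sum_(j < J) F j t).
  by have := iS.1; apply: rintble_eq => // t _; rewrite (Re_sum J (fun j => (F j t)%:C)).
rewrite lap_real ReC -eS' -rintB //.
have i2 := rintbleZ (freq_sum K 0) (measurable_itv _) (rintble_exprM_expNM J.*2 x0).
apply: (le_trans (le_normr_Rintegral _ _)) => //; first exact: rintbleB.
apply: (@le_trans _ _ (\int[mu]_(t in `]0, +oo[) (freq_sum K 0 * (t ^+ J.*2 * expR (- (x * t)))))); last first.
  rewrite (rintZ _ (measurable_itv _) (rintble_exprM_expNM J.*2 x0)) rint_exprM_expN //.
  by rewrite -exprVn /x invrK mulrA.
apply: le_Rintegral => //; first by apply: rintble_norm => //; exact: rintbleB.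
move=> t /gt0_itv t0; have -> : trunc_kernel K t * expR (- (x * t)) - \sum_(j < J) F j t =
   (trunc_kernel K t - \sum_(j < J) (-1) ^+ j * freq_sum K j * t ^+ j.*2) * expR (- (x * t)).
  rewrite mulrBl [(\sum_(j < J) _) * _]mulr_suml; congr (_ - _).
  by apply: eq_bigr => j _; rewrite /F mulrA.
rewrite normrM (ger0_norm (expR_ge0 _)) mulrA ler_wpM2r ?expR_ge0 //.
exact: trunc_kernel_expansion.
Qed.

Lemma cscfac_real x : 0 < x -> cscfac x%:C = 1.
Proof.
move=> x0; rewrite /cscfac carg_atan // ImC mul0r atan0 normr0 ifF //.
by apply/negbTE; rewrite -leNgt divr_ge0 // pi_ge0.
Qed.

(** On the positive real axis [exp L] has two expansions, one by moments from [trunc_kernel_bound]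
    and one by exponentiating Watson's expansion of [L]. The difference [P] of their polynomials is
    of order [n.+1], so its [n]-th coefficient is 0. *)
Lemma mcoef_trunc_kernel K n : mcoef (@trunc_kernel R K) n = exp_coef (trunc_exponent_coef K) n.
Proof.
pose b := @trunc_kernel R K; pose S := odd_poly_of (trunc_exponent_coef K) n.
pose l y := Re (lap b (y^-1)%:C).
pose P : {poly R} := \sum_(k < n.+1) (k`!%:R)^-1 *: S ^+ k - \sum_(m < n.+1) mcoef b m *: 'X^m.
have lS : bigO n.+1 (fun y => l y - S.[y]).
  have : bigO n.*2.+1 (fun y => l y - S.[y]).
    by under eq_fun do rewrite horner_odd_poly_of; exact: bigO_lap_trunc_kernel.
  by apply: bigOW; rewrite ltnS -addnn leq_addr.
have l1 : bigO 1 l.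
  by have := bigO_lap_trunc_kernel K 0; apply: bigO_eq => y _; rewrite big_ord0 subr0.
have S0 := bigO_poly S.
have : bigO n.+1 (fun y => P.[y]).
  have h3 : bigO n.+1 (fun y => expR (l y) - \sum_(m < n.+1) mcoef b m * y ^+ m).
    exists (`|mcoef b n.+1| + `|mcoef b n.+2|) => y /andP[y0 y1].
    have x0 : 0 < Re (y^-1)%:C by rewrite ReC invr_gt0.
    have := trunc_kernel_bound K false (ltn0Sn n) x0.
    have e : lap b (y^-1)%:C = (l y)%:C by rewrite /l lap_real.
    rewrite cscfac_real ?invr_gt0 // mulr1 expr0 mul1r -/b e cexpR.
    under eq_bigr do rewrite expr1n mul1r -rmorphXn -fmorphV -exprVn invrK -rmorphM.
    rewrite -rmorph_sum -rmorphB normcR => h; apply: (le_trans h).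
    rewrite normcR (ger0_norm (ltW x0 : 0 <= y^-1)) -!exprVn invrK mulrDl; apply: lerD => //.
    by apply: ler_wpM2l => //; rewrite exprSr ler_piMr // exprn_ge0 // ltW.
  have h2 := bigO_exp_taylor n.+1 l1.
  have h1 : bigO n.+1 (fun y => exp_taylor n.+1 (l y) - exp_taylor n.+1 S.[y]).
    rewrite /exp_taylor; under eq_fun do rewrite -sumrB.
    apply: bigO_sum => k; under eq_fun do rewrite -mulrBr.
    by apply: (bigOM (bigO_cst _)); apply: bigO_subX => //; exact: bigOW l1.
  apply: (bigO_eq _ (bigOB (bigOB h3 h2) h1)) => y _.
  rewrite /P hornerD hornerN ![(\sum_(k < _) _).[_]]horner_sum.
  under [X in _ = X - _]eq_bigr do rewrite hornerZ horner_exp.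
  under [X in _ = _ - X]eq_bigr do rewrite hornerZ hornerXn.
  by rewrite /exp_taylor; ring.
move=> /germ_coef0; rewrite /P coefB => /eqP; rewrite subr_eq0 => /eqP h.
rewrite /exp_coef h coef_sum (bigD1 ord_max) //= coefZ coefXn eqxx mulr1 big1 ?addr0 //.
move=> m mn; rewrite coefZ coefXn; case: eqP => [e|_]; last by rewrite mulr0.
by move: mn; rewrite -val_eqE /= -e eqxx.
Qed.

End TruncatedCoefficients.

(** * A finite partial fraction identity from roots of unity *)

Section PartialFractions.
Variable R : realType.
Implicit Types (x y t : R) (k m n : nat).

Lemma oneBcosE x : 1 - cos x = 2 * sin (x / 2) ^+ 2 :> R.
Proof.
have -> : cos x = cos ((x / 2) *+ 2) by congr cos; rewrite -mulr_natr; field.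
by rewrite cos_mulr2n; have := cos2Dsin2 (x / 2); lra.
Qed.

Lemma cos_sqr_ge c : 0 <= c <= pi / 4 -> 2^-1 <= cos c ^+ 2 :> R.
Proof.
move=> /andP[c0 c1].
have : 0 <= cos (c *+ 2) :> R.
  by apply: cos_ge0_pihalf; rewrite -mulr_natr; apply/andP; split; lra.
by rewrite cos_mulr2n; lra.
Qed.

(** By the double angle formula and the mean value theorem, [sin x = x * cos c * cos (x / 2)] with
    both angles in [[0, pi / 4]], where squared cosines are at least one half. *)
Lemma sin_ge_half x : 0 <= x <= pi / 2 -> x / 2 <= sin x :> R.
Proof.
move=> /andP[x0 x1].
have [->|xn] := eqVneq x 0; first by rewrite mul0r sin0.
have y0 : 0 < x / 2 by rewrite divr_gt0 // lt_def xn.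
have [c] := MVT y0 (fun y _ => is_derive_sin y) (continuous_subspaceT (@continuous_sin R)).
rewrite in_itv /= => /andP[c0 cx]; rewrite sin0 !subr0 => e.
have -> : sin x = cos c * cos (x / 2) * x.
  have -> : sin x = sin ((x / 2) *+ 2) by congr sin; rewrite -mulr_natr; field.
  by rewrite sin_mulr2n e -mulr_natr; field.
have p := @pi_gt0 R.
have h1 : 2^-1 <= cos c ^+ 2 by apply: cos_sqr_ge; apply/andP; split; lra.
have h2 : 2^-1 <= cos (x / 2) ^+ 2 by apply: cos_sqr_ge; apply/andP; split; lra.
have g1 : 0 <= cos c by apply: cos_ge0_pihalf; apply/andP; split; lra.
have g2 : 0 <= cos (x / 2) by apply: cos_ge0_pihalf; apply/andP; split; lra.
rewrite [leLHS]mulrC ler_wpM2r // -(ler_pXn2r (_ : (0 < 2)%N)) ?nnegrE ?mulr_ge0 //.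
by rewrite exprMn expr2; apply: ler_pM.
Qed.

Lemma oneBcos_ge x : 0 <= x <= pi -> x ^+ 2 / 8 <= 1 - cos x :> R.
Proof.
move=> /andP[x0 x1]; rewrite oneBcosE.
have h : x / 2 / 2 <= sin (x / 2) by apply: sin_ge_half; apply/andP; split; lra.
have : (x / 2 / 2) ^+ 2 <= sin (x / 2) ^+ 2.
  by apply: lerXn2r; rewrite ?nnegrE // ?(le_trans _ h) // !divr_ge0.
have -> : (x / 2 / 2) ^+ 2 = x ^+ 2 / 16 by field.
lra.
Qed.

Let w n : R[i] := cexp (iR (2 * pi / n%:R)).

Let wX n k : w n ^+ k = cexp (iR (2 * pi * k%:R / n%:R)).
Proof. by rewrite /w -cexpMn natRC /iR mulrCA -rmorphM; congr (cexp ('i * _%:C)); ring. Qed.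

Let wX_neq1 n j : (0 < j < n)%N -> w n ^+ j != 1.
Proof.
move=> /andP[j0 jn]; rewrite wX; apply/eqP => /(congr1 (@complex.Re R)).
rewrite Re_cexp Re_iR expR0 mul1r Im_iR Re1 => e.
have n0 : 0 < n%:R :> R by rewrite ltr0n (leq_trans _ jn).
have := oneBcosE (2 * pi * j%:R / n%:R); rewrite e subrr => /esym/eqP.
rewrite mulf_eq0 pnatr_eq0 sqrf_eq0 /=; apply/negP; rewrite gt_eqF // sin_gt0_pi //.
have -> : 2 * pi * j%:R / n%:R / 2 = pi * (j%:R / n%:R) :> R.
  by have := lt0r_neq0 n0; move: (n%:R : R) => N N0; field.
have p := @pi_gt0 R; have q : 0 < j%:R / n%:R :> R by rewrite divr_gt0 // ltr0n.
by rewrite mulr_gt0 //= -[ltRHS]mulr1 ltr_pM2l // ltr_pdivrMr // mul1r ltr_nat.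
Qed.

Let wn1 n : (0 < n)%N -> w n ^+ n = 1.
Proof.
move=> n0; rewrite wX -mulrA divff ?pnatr_eq0 -?lt0n // mulr1.
apply: eqC; rewrite ?Re_cexp ?Im_cexp Re_iR Im_iR expR0 mul1r mulr_natl.
  by rewrite cos2pi.
by rewrite sin2pi.
Qed.

Let sum_w n j : (0 < j < n)%N -> \sum_(k < n) (w n ^+ k) ^+ j = 0.
Proof.
move=> jn; have n1 := wX_neq1 jn; have /andP[j0 jn'] := jn.
under eq_bigr do rewrite exprAC.
have : (w n ^+ j) ^+ n - 1 = 0 by rewrite exprAC wn1 ?expr1n ?subrr // (leq_trans _ jn').
by rewrite subrX1 => /eqP; rewrite mulf_eq0 subr_eq0 (negPf n1) => /eqP.
Qed.

(** Each summand times [1 - r%:C ^+ n] is a geometric sum; summed over the roots of unity, all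
    powers but the 0-th cancel. *)
Let sum_resolvent n r : (0 < n)%N -> 0 < r < 1 ->
  \sum_(k < n) (1 - w n ^+ k * r%:C)^-1 = n%:R / (1 - r%:C ^+ n).
Proof.
move=> n0 /andP[r0 r1].
have nw k : normc (w n ^+ k) = 1 by rewrite wX normc_cexp Re_iR expR0.
have d k : 1 - w n ^+ k * r%:C != 0.
  rewrite subr_eq0; apply/eqP => /(congr1 (@normc R)); rewrite normc1 normcM nw mul1r normcR gtr0_norm //; lra.
have dn : 1 - r%:C ^+ n != 0.
  rewrite subr_eq0; apply/eqP => /(congr1 (@normc R)); rewrite normc1 normcX normcR gtr0_norm //.
  have : r ^+ n <= r by case: (n) n0 => // m _; rewrite exprS; apply: ler_piMr; [exact: ltW|apply: exprn_ile1; exact: ltW].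
  lra.
have E k : (1 - r%:C ^+ n) / (1 - w n ^+ k * r%:C) = \sum_(j < n) (w n ^+ k * r%:C) ^+ j.
  have := subrX1 (w n ^+ k * r%:C) n; rewrite exprMn exprAC wn1 // expr1n mul1r => e.
  by rewrite -[1 - _ ^+ n]opprB e -mulNr opprB mulrAC divff ?mul1r.
apply: (mulfI dn); rewrite mulr_sumr; under eq_bigr do rewrite E.
rewrite mulrCA divff // mulr1 exchange_big /=.
case: n n0 {nw d dn E} => // n _; rewrite big_ord_recl /=.
under eq_bigr do rewrite expr0.
rewrite sumr_const card_ord big1 ?addr0 // => j _.
under eq_bigr do rewrite exprMn.
by rewrite -mulr_suml sum_w ?mul0r // /bump /= add1n /= ltnS ltn_ord.
Qed.

(* The Poisson kernel of the disc, [r = exp (- t / n)], at the n-th roots of unity, divided by n. *)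
Definition poisson_term t n k : R :=
  let r := expR (- (t / n%:R)) in (1 - r ^+ 2) / ((1 - r) ^+ 2 + 2 * r * (1 - cos (2 * pi * k%:R / n%:R))) / n%:R.

(** The real part of [sum_resolvent] at [r = expR (- (t / n%:R))], for which [r ^+ n] is
    [expR (- t)] whatever [n] is. The right side is [coth (t / 2)]; its partial fractions appear as
    [n] tends to infinity. *)
Lemma sum_poisson_term t n : (0 < n)%N -> 0 < t ->
  \sum_(k < n) poisson_term t n k = 1 + 2 / (expR t - 1).
Proof.
move=> n0 t0; have nR : 0 < n%:R :> R by rewrite ltr0n.
set r := expR (- (t / n%:R)).
have r0 : 0 < r by exact: expR_gt0.
have r1 : r < 1 by rewrite expR_lt1 oppr_lt0 divr_gt0.
have rn : r ^+ n = (expR t)^-1 by rewrite -expRM_natl mulrN mulrCA divff ?mulr1 ?expRN // lt0r_neq0.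
have et : 1 < expR t by rewrite expR_gt1.
have /(congr1 (@complex.Re R)) := sum_resolvent n0 (introT andP (conj r0 r1)).
rewrite (Re_sum n (fun k => (1 - w n ^+ k * r%:C)^-1)) -rmorphXn natRC -rmorphB -fmorphV -rmorphM ReC rn.
have e (k : nat) : Re (1 - w n ^+ k * r%:C)^-1 = 2^-1 + n%:R / 2 * poisson_term t n k.
  rewrite ReV normcE2 !(ReB, ImB) ReZr ImZr Re1 Im1 wX Re_cexp Im_cexp Re_iR Im_iR expR0 !mul1r.
  rewrite /poisson_term -/r; set c := cos _; set s := sin _.
  have cs : c ^+ 2 + s ^+ 2 = 1 by exact: cos2Dsin2.
  have c1 : c <= 1 by exact: cos_le1.
  have D0 : 0 < (1 - r) ^+ 2 + 2 * r * (1 - c).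
    by rewrite ltr_pwDl ?exprn_gt0 ?subr_gt0 // !mulr_ge0 ?subr_ge0 // ltW.
  have -> : (1 - c * r) ^+ 2 + (0 - s * r) ^+ 2 = (1 - r) ^+ 2 + 2 * r * (1 - c).
    have -> : (1 - c * r) ^+ 2 + (0 - s * r) ^+ 2 = 1 - 2 * c * r + (c ^+ 2 + s ^+ 2) * r ^+ 2 by ring.
    by rewrite cs; ring.
  by have := lt0r_neq0 D0; have := lt0r_neq0 nR; move: (n%:R : R) => N N0 DD; field; rewrite N0 DD.
under eq_bigr do rewrite e.
rewrite big_split /= sumr_const card_ord -mulr_sumr -[2^-1 *+ n]mulr_natr.
move: (\sum_(k < n) _) => S h.
have N0 := lt0r_neq0 nR; move: (n%:R : R) N0 h => N N0 h.
have et1 : expR t != 0 by rewrite lt0r_neq0 ?expR_gt0.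
have et2 : expR t - 1 != 0 by rewrite subr_eq0 gt_eqF.
have e1 : (1 - (expR t)^-1)^-1 = expR t / (expR t - 1).
  by move: (expR t) et1 et2 => E E1 E2; field; rewrite E1 E2.
have {}h : N / 2 * S = N * (expR t / (expR t - 1)) - 2^-1 * N by rewrite -e1 -h [RHS]addrC addKr.
have Nh : N / 2 != 0 by rewrite mulf_neq0 ?invr_eq0 ?pnatr_eq0.
apply: (mulfI Nh); rewrite h; field; exact: et2.
Qed.

(** For odd order the roots other than 1 come in conjugate pairs, with equal terms. Keeping one
    index per pair keeps the angles at most [pi], where [oneBcos_ge] applies. *)
Lemma sum_poisson_term_odd t m : 0 < t ->
  poisson_term t m.*2.+1 0 + 2 * \sum_(k < m) poisson_term t m.*2.+1 k.+1 = 1 + 2 / (expR t - 1).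
Proof.
move=> t0; rewrite -(@sum_poisson_term t m.*2.+1) // big_ord_recl; congr (_ + _).
rewrite -addnn big_split_ord /= mulr_natl mulr2n; congr (_ + _); rewrite (reindex_inj rev_ord_inj) /=.
apply: eq_bigr => k _; rewrite /poisson_term /= /bump /=; congr (_ / (_ + _ * (1 - _)) / _).
have km : (k < m)%N by [].
have n0 : (m + m).+1%:R != 0 :> R by rewrite pnatr_eq0.
have -> : 2 * pi * (1 + (m + k))%:R / (m + m).+1%:R = - (2 * pi * (m - k.+1).+1%:R / (m + m).+1%:R) + pi *+ 2 :> R.
  have -> : ((1 + (m + k))%:R : R) = (m + m).+1%:R - (m - k.+1).+1%:R.
    by rewrite -natrB; [congr (_%:R); lia|lia].
  by move: (m + m).+1%:R n0 => N N0; rewrite -mulr_natr; field.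
by rewrite -[LHS]cosN cosD cos2pi sin2pi mulr1 mulr0 subr0.
Qed.

End PartialFractions.

(** * The partial fraction series of Binet's kernel *)

Section BinetKernel.
Variable R : realType.
Implicit Types (x y t : R) (k m n : nat).
Local Open Scope classical_set_scope.

Lemma cvg_mul_oneBexpN t : n.+1%:R * (1 - expR (- (t / n.+1%:R))) @[n --> \oo] --> t.
Proof.
apply/cvgrPdist_le => e e0; near=> n.
have n0 : 0 < n.+1%:R :> R by rewrite ltr0n.
have h1 : `|t| * 2 <= n%:R by near: n; exact: nbhs_infty_ger.
have h2 : 2 * t ^+ 2 / e <= n%:R by near: n; exact: nbhs_infty_ger.
have nn : n%:R <= n.+1%:R :> R by rewrite ler_nat.
have := @expR_taylor1 _ (- (t / n.+1%:R)).
rewrite normrN normrM normfV (gtr0_norm n0) ler_pdivrMr // => /(_ ltac:(lra)).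
have -> : t - n.+1%:R * (1 - expR (- (t / n.+1%:R))) = n.+1%:R * (expR (- (t / n.+1%:R)) - 1 - - (t / n.+1%:R)).
  by have := lt0r_neq0 n0; move: (n.+1%:R) => N N0; field.
rewrite normrM (gtr0_norm n0) => h; apply: (le_trans (ler_wpM2l (ltW n0) h)).
have -> : n.+1%:R * (2 * (- (t / n.+1%:R)) ^+ 2) = 2 * t ^+ 2 / n.+1%:R.
  by have := lt0r_neq0 n0; move: (n.+1%:R) => N N0; field.
by rewrite ler_pdivrMr // [leRHS]mulrC -ler_pdivrMr //; exact: le_trans nn.
Unshelve. all: by end_near. Qed.

Lemma cvg_mul_sin x : n.+1%:R * sin (x / n.+1%:R) @[n --> \oo] --> x.
Proof.
apply/cvgrPdist_le => e e0; near=> n.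
have n0 : 0 < n.+1%:R :> R by rewrite ltr0n.
have h2 : x ^+ 2 / e <= n%:R by near: n; exact: nbhs_infty_ger.
have nn : n%:R <= n.+1%:R :> R by rewrite ler_nat.
have -> : x - n.+1%:R * sin (x / n.+1%:R) = - (n.+1%:R * (sin (x / n.+1%:R) - x / n.+1%:R)).
  by have := lt0r_neq0 n0; move: (n.+1%:R) (sin _) => N s N0; field.
rewrite normrN normrM (gtr0_norm n0); apply: (le_trans (ler_wpM2l (ltW n0) (sin_sub_le _))).
have -> : n.+1%:R * (x / n.+1%:R) ^+ 2 = x ^+ 2 / n.+1%:R.
  by have := lt0r_neq0 n0; move: (n.+1%:R) => N N0; field.
by rewrite ler_pdivrMr // [leRHS]mulrC -ler_pdivrMr //; exact: le_trans nn.
Unshelve. all: by end_near. Qed.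

Lemma cvg_poisson_term t k : 0 < t ->
  poisson_term t n.+1 k @[n --> \oo] --> 2 * t / (t ^+ 2 + (2 * pi * k%:R) ^+ 2).
Proof.
move=> t0; set a := 2 * pi * k%:R.
have c1 := @cvg_mul_oneBexpN t.
have cr : expR (- (t / n.+1%:R)) @[n --> \oo] --> (1 : R).
  have -> : (fun n => expR (- (t / n.+1%:R))) =
     (fun n => 1 - n.+1%:R * (1 - expR (- (t / n.+1%:R))) / n.+1%:R).
    apply/funext => n; have n0 : n.+1%:R != 0 :> R by rewrite pnatr_eq0.
    by rewrite mulrAC divff // mul1r opprB addrCA subrr addr0.
  rewrite -[X in _ --> X]subr0; apply: cvgB; first exact: cvg_cst.
  rewrite -(mulr0 t); apply: cvgM c1 _; exact: cvg_harmonic.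
have c2 : n.+1%:R ^+ 2 * (1 - cos (a / n.+1%:R)) @[n --> \oo] --> a ^+ 2 / 2.
  have h := @cvg_mul_sin (a / 2).
  have -> : (fun n => n.+1%:R ^+ 2 * (1 - cos (a / n.+1%:R))) =
      (fun n => 2 * ((n.+1%:R * sin (a / 2 / n.+1%:R)) * (n.+1%:R * sin (a / 2 / n.+1%:R)))).
    by apply/funext => n; rewrite oneBcosE [a / 2 / _]mulrAC; ring.
  have -> : a ^+ 2 / 2 = 2 * (a / 2 * (a / 2)) by field.
  by apply: cvgM; [exact: cvg_cst|exact: cvgM].
pose r n := expR (- (t / n.+1%:R)); pose q n := n.+1%:R * (1 - r n).
(* Numerator and denominator are multiplied by the square of the order, so that each ingredient has
   a finite limit and the limiting denominator is positive. *)
have -> : (fun n => poisson_term t n.+1 k) = (fun n =>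
    q n * (1 + r n) * (q n * q n + 2 * r n * (n.+1%:R ^+ 2 * (1 - cos (a / n.+1%:R))))^-1).
  apply/funext => n; rewrite /poisson_term /q /r /=; have n0 : 0 < n.+1%:R :> R by rewrite ltr0n.
  have r0 := expR_gt0 (- (t / n.+1%:R)).
  have r1 : expR (- (t / n.+1%:R)) < 1 by rewrite expR_lt1 oppr_lt0 divr_gt0.
  have cc := cos_le1 (a / n.+1%:R); rewrite -/a.
  move: (expR (- (t / n.+1%:R))) (cos (a / n.+1%:R)) r0 r1 cc => {q}{}r c r0 r1 cc; move: (n.+1%:R) n0 => N n0.
  have D0 : 0 < (1 - r) ^+ 2 + 2 * r * (1 - c).
    by rewrite ltr_pwDl ?exprn_gt0 ?subr_gt0 // !mulr_ge0 ?subr_ge0 // ltW.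
  have -> : N * (1 - r) * (N * (1 - r)) + 2 * r * (N ^+ 2 * (1 - c)) = N ^+ 2 * ((1 - r) ^+ 2 + 2 * r * (1 - c)) by ring.
  by have := lt0r_neq0 D0; have := lt0r_neq0 n0; move: (_ + _) => D N0 DD; field; rewrite N0 DD.
have -> : 2 * t / (t ^+ 2 + a ^+ 2) = t * (1 + 1) * (t * t + 2 * 1 * (a ^+ 2 / 2))^-1.
  have -> : t * t + 2 * 1 * (a ^+ 2 / 2) = t ^+ 2 + a ^+ 2 by field.
  by congr (_ / _); ring.
have c3 : q n * (1 + r n) @[n --> \oo] --> t * (1 + 1).
  by apply: cvgM => //; apply: cvgD => //; exact: cvg_cst.
have c4 : q n * q n + 2 * r n * (n.+1%:R ^+ 2 * (1 - cos (a / n.+1%:R))) @[n --> \oo] -->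
    t * t + 2 * 1 * (a ^+ 2 / 2).
  apply: cvgD; first exact: cvgM.
  by apply: cvgM => //; apply: cvgM => //; exact: cvg_cst.
have D0 : t * t + 2 * 1 * (a ^+ 2 / 2) != 0.
  by rewrite lt0r_neq0 // ltr_pwDl ?mulr_gt0 // mulr1 mulrC divfK ?pnatr_eq0 // sqr_ge0.
exact: (cvgM c3 (cvgV D0 c4)).
Qed.

Lemma poisson_term_ge0 t n k : 0 < t -> 0 <= poisson_term t n k.
Proof.
move=> t0; rewrite /poisson_term.
have r0 := expR_gt0 (- (t / n%:R)).
have r1 : expR (- (t / n%:R)) <= 1 by rewrite expR_le1 oppr_le0 divr_ge0 // ltW.
rewrite divr_ge0 // divr_ge0 //; first by rewrite subr_ge0 expr_le1 // ltW.
by rewrite addr_ge0 ?sqr_ge0 // !mulr_ge0 ?subr_ge0 ?cos_le1 // ltW.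
Qed.

(** A summable majorant independent of [m], for exchanging limit and sum. It uses
    [1 - r ^+ 2 <= 2 * (t / N)], [r >= (expR t)^-1] and [1 - cos th >= th ^+ 2 / 8]; the leftover
    factor [2 / pi ^+ 2] is below 1. *)
Lemma poisson_term_le t m k : 0 < t -> (k < m)%N ->
  poisson_term t m.*2.+1 k.+1 <= t * expR t / k.+1%:R ^+ 2.
Proof.
move=> t0 km; rewrite /poisson_term; set N : R := m.*2.+1%:R.
have N0 : 0 < N by rewrite ltr0n.
have N1 : 1 <= N by rewrite ler1n.
have p2 := @pi_ge2 R; have p0 := @pi_gt0 R.
have k0 : 0 < k.+1%:R :> R by rewrite ltr0n.
have kN : 2 * k.+1%:R <= N by rewrite -natrM ler_nat; lia.
set th := 2 * pi * k.+1%:R / N.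
have th0 : 0 < th by rewrite /th !mulr_gt0 // invr_gt0.
have c8 : th ^+ 2 / 8 <= 1 - cos th.
  apply: oneBcos_ge; rewrite (ltW th0) /= ler_pdivrMr //.
  by rewrite mulrAC mulrC ler_pM2l.
set r := expR _; have r0 : 0 < r by exact: expR_gt0.
have xt : t / N <= t by rewrite ler_piMr ?(ltW t0) // invf_le1.
have rt : (expR t)^-1 <= r by rewrite -expRN ler_expR lerN2.
have r2 : 1 - r ^+ 2 <= 2 * (t / N).
  have -> : r ^+ 2 = expR (- (2 * (t / N))) by rewrite -expRM_natl mulrN.
  by rewrite lerBlDr -lerBlDl; exact: expR_ge1Dx.
have x0 : 0 < t / N by rewrite divr_gt0.
have D1 : (1 - r) ^+ 2 + 2 * r * (1 - cos th) >= 2 * (expR t)^-1 * (th ^+ 2 / 8).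
  apply: (@le_trans _ _ (2 * r * (1 - cos th))); last by rewrite lerDr sqr_ge0.
  apply: ler_pM => //; rewrite ?divr_ge0 ?sqr_ge0 ?mulr_ge0 ?invr_ge0 ?expR_ge0 //.
  by rewrite ler_pM2l.
have D0 : 0 < 2 * (expR t)^-1 * (th ^+ 2 / 8).
  by rewrite !mulr_gt0 ?invr_gt0 ?expR_gt0 ?exprn_gt0.
apply: (@le_trans _ _ (2 * (t / N) / (2 * (expR t)^-1 * (th ^+ 2 / 8)) / N)).
  rewrite ler_pM2r ?invr_gt0 //.
  apply: (@le_trans _ _ (2 * (t / N) / ((1 - r) ^+ 2 + 2 * r * (1 - cos th)))).
    by rewrite ler_pM2r // invr_gt0; exact: lt_le_trans D1.
  have t20 : 0 < 2 * (t / N) by exact: mulr_gt0.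
  rewrite (ler_pM2l t20) lef_pV2 ?posrE //; exact: lt_le_trans D1.
have -> : 2 * (t / N) / (2 * (expR t)^-1 * (th ^+ 2 / 8)) / N = t * expR t / k.+1%:R ^+ 2 * (2 / pi ^+ 2).
  have alg (p x M E : R) : p != 0 -> x != 0 -> M != 0 -> E != 0 ->
      2 * (t / M) / (2 * E^-1 * ((2 * p * x / M) ^+ 2 / 8)) / M = t * E / x ^+ 2 * (2 / p ^+ 2).
    by move=> h1 h2 h3 h4; field; rewrite h1 h2 h3 h4.
  by apply: alg; rewrite lt0r_neq0 // expR_gt0.
rewrite ler_piMr ?divr_ge0 ?mulr_ge0 ?expR_ge0 ?sqr_ge0 ?(ltW t0) //.
rewrite ler_pdivrMr ?exprn_gt0 // mul1r expr2; nra.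
Qed.

(** The tail telescopes, because [1 / (x + 1)^2 <= 1 / x - 1 / (x + 1)]. *)
Lemma sum_le_telescope (f : nat -> R) C K m : (0 < K)%N -> (K <= m)%N ->
  (forall k, (k < m)%N -> f k <= C / k.+1%:R ^+ 2) -> 0 <= C ->
  \sum_(k < m) f k <= \sum_(k < K) f k + C * (K%:R^-1 - m%:R^-1).
Proof.
move=> K0 Km hf C0; elim: m Km hf => [|m IH]; first by rewrite leqn0 => /eqP e; rewrite e in K0.
rewrite leq_eqVlt => /predU1P[<- _|Km hf]; first by rewrite subrr mulr0 addr0.
rewrite big_ord_recr /=; apply: (le_trans (lerD (IH Km (fun k km => hf k (ltnW km))) (hf m (ltnSn m)))).
rewrite -addrA lerD2l -mulrDr ler_wpM2l //.
have m0 : 0 < m%:R :> R by rewrite ltr0n (leq_trans K0).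
rewrite -addrA lerD2l -(natr1 m); move: (m%:R : R) m0 => x x0.
rewrite -subr_ge0.
have -> : - (x + 1)^-1 - (- x^-1 + (x + 1) ^- 2) = (x * (x + 1) ^+ 2)^-1.
  by field; apply/andP; split; rewrite lt0r_neq0 //; lra.
by rewrite invr_ge0 mulr_ge0 ?sqr_ge0 // ltW.
Qed.

Definition binet_kernel t : R := ((expR t - 1)^-1 - t^-1 + 2^-1) / t.

(** Tannery's argument on the odd finite identities: for fixed [K] let [m] grow in the first [K]
    terms, while the tail stays nonnegative and below the telescoped majorant. The gap to
    [binet_kernel t] thus lies between 0 and [expR t / K%:R]. *)
Lemma cvg_trunc_kernel_binet t : 0 < t -> trunc_kernel K t @[K --> \oo] --> binet_kernel t.
Proof.
move=> t0; have C0 : 0 <= t * expR t by rewrite mulr_ge0 ?expR_ge0 // ltW.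
have odd_cvg k : poisson_term t m.*2.+1 k @[m --> \oo] --> 2 * t / (t ^+ 2 + (2 * pi * k%:R) ^+ 2).
  apply: (cvg_comp (fun m => m.*2) (fun n => poisson_term t n.+1 k) _ (@cvg_poisson_term t k t0)).
  by apply/cvgnyPge => A; exists A => // n /= An; rewrite -addnn (leq_trans An) // leq_addr.
have B K : (0 < K)%N -> 0 <= binet_kernel t - trunc_kernel K t <= expR t / K%:R.
  move=> K0; set T := 1 + 2 / (expR t - 1).
  have c : T - poisson_term t m.*2.+1 0 - 2 * \sum_(k < K) poisson_term t m.*2.+1 k.+1 @[m --> \oo]
    --> T - 2 / t - 2 * (t * trunc_kernel K t).
    apply: cvgB.
      apply: cvgB; first exact: cvg_cst.
      have := odd_cvg 0%N; rewrite mulr0 expr0n addr0 (_ : 2 * t / t ^+ 2 = 2 / t) //.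
      by field; rewrite lt0r_neq0.
    apply: cvgM; first exact: cvg_cst.
    rewrite mulr_sumr; elim: K {K0} => [|K IH]; first by under eq_fun do rewrite big_ord0; rewrite big_ord0; exact: cvg_cst.
    under eq_fun do rewrite big_ord_recr; rewrite big_ord_recr; apply: cvgD => //=.
    have := odd_cvg K.+1; rewrite (_ : 2 * t / _ = t * pole_pair K t) //.
    by rewrite /pole_pair -/(freq R K); ring.
  have e : T - 2 / t - 2 * (t * trunc_kernel K t) = (2 * t) * (binet_kernel t - trunc_kernel K t).
    rewrite /T /binet_kernel; have e1 : expR t - 1 != 0 by rewrite subr_eq0 gt_eqF // expR_gt1.
    by move: (expR t - 1) e1 (trunc_kernel K t) => E E0 S; field; rewrite E0 lt0r_neq0.
  rewrite e in c; have t2 : 0 < 2 * t by rewrite mulr_gt0.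
  have S m : (K <= m)%N -> 0 <= T - poisson_term t m.*2.+1 0 - 2 * \sum_(k < K) poisson_term t m.*2.+1 k.+1 <= 2 * t * (expR t / K%:R).
    move=> Km.
    have -> : T - poisson_term t m.*2.+1 0 - 2 * \sum_(k < K) poisson_term t m.*2.+1 k.+1 =
        2 * (\sum_(k < m) poisson_term t m.*2.+1 k.+1 - \sum_(k < K) poisson_term t m.*2.+1 k.+1).
      by rewrite /T -(sum_poisson_term_odd m t0); ring.
    have h := sum_le_telescope K0 Km (fun k km => poisson_term_le t0 km) C0.
    have h0 : \sum_(k < K) poisson_term t m.*2.+1 k.+1 <= \sum_(k < m) poisson_term t m.*2.+1 k.+1.
      rewrite (big_ord_widen m (fun k => poisson_term t m.*2.+1 k.+1) Km) [leRHS](bigID (fun k : 'I_m => (k < K)%N)) /=.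
      by rewrite lerDl; apply: sumr_ge0 => k _; exact: poisson_term_ge0.
    rewrite mulr_ge0 ?subr_ge0 //= -mulrA ler_pM2l // lerBlDl; apply: (le_trans h).
    rewrite lerD2l mulrA ler_wpM2l // lerBlDr lerDl invr_ge0 //.
  apply/andP; split.
    rewrite -(pmulr_rge0 _ t2); apply: (ler_cvg_to (cvg_cst 0) c).
    by exists K => // m /= /S /andP[].
  rewrite -(ler_pM2l t2).
  apply: (ler_cvg_to c (cvg_cst _)).
  by exists K => // m /= /S /andP[].
apply: (@cvg_zero _ R); apply: (@norm_cvg0 _ R).
apply: (squeeze_cvgr _ (cvg_cst 0) (cvg_invn (2 * expR t))); exists 1%N => // K /= K1.
have /andP[h0 h1] := B K K1.
rewrite normr_ge0 /= distrC ger0_norm //; apply: (le_trans h1).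
have k0 : 1 <= K%:R :> R by rewrite ler1n.
rewrite -(natr1 K) ler_pdivrMr ?(lt_le_trans _ k0) // mulrAC ler_pdivlMr; last lra.
by have := expR_gt0 t; move: (expR t) (K%:R : R) k0 => E x k0 E0; nra.
Qed.

End BinetKernel.

(** * Bernoulli numbers and even zeta values *)

Section BernoulliNumbers.
Variable R : realType.
Implicit Types (x y t : R) (j k m n K J : nat).
Local Open Scope classical_set_scope.

(** As [pi >= 2], each term is at most [1 / ((k + 1) (k + 2))], which telescopes. Uniformity in [K]
    lets the expansion of the truncated kernel pass to the limit with remainder [t ^+ J.*2]. *)
Lemma freq_sum_le1 K j : freq_sum R K j <= 1.
Proof.
suff : freq_sum R K j <= 1 - (K.+1%:R)^-1.
  by have : 0 < (K.+1%:R : R)^-1 by []; move: (K.+1%:R^-1) => v; lra.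
elim: K => [|K IH]; first by rewrite /freq_sum big_ord0 invr1 subrr.
rewrite /freq_sum big_ord_recr /=; apply: (le_trans (lerD IH (lexx _))).
have f1 := freq_ge1 R K; have f0 := freq_gt0 R K.
have k0 : 0 < K.+1%:R :> R by rewrite ltr0n.
have h : 2 / freq R K ^+ j.*2.+2 <= 2 / freq R K ^+ 2.
  rewrite ler_pM2l // lef_pV2 ?posrE ?exprn_gt0 //.
  by apply: ler_weXn2l.
have h2 : 2 / freq R K ^+ 2 <= K.+1%:R^-1 - K.+2%:R^-1.
  have -> : K.+1%:R^-1 - K.+2%:R^-1 = (K.+1%:R * (K.+1%:R + 1))^-1 :> R.
    by rewrite -(natr1 K.+1); move: (K.+1%:R) k0 => x x0; field; rewrite !lt0r_neq0 ?addr_gt0.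
  have x1 : 1 <= K.+1%:R :> R by rewrite ler1n.
  rewrite ler_pdivrMr ?exprn_gt0 // mulrC ler_pdivlMr; last by rewrite mulr_gt0 // addr_gt0.
  rewrite /freq; have p2 := @pi_ge2 R; move: (pi : R) (K.+1%:R) p2 x1 => p x p2 x1.
  rewrite exprMn; have : 16 <= (2 * p) ^+ 2 by rewrite expr2; nra.
  move: ((2 * p) ^+ 2) => q q16; rewrite expr2; nra.
by move: h h2; move: (2 / _) (2 / _) (K.+1%:R^-1) (K.+2%:R^-1) => a b u v; lra.
Qed.

Definition freq_series j : R := limn (fun K => freq_sum R K j).

Lemma cvg_freq_sum j : freq_sum R K j @[K --> \oo] --> freq_series j.
Proof.
apply: nondecreasing_is_cvgn.
  apply/nondecreasing_seqP => K; rewrite /freq_sum big_ord_recr /= lerDl.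
  by rewrite divr_ge0 // exprn_ge0 // ltW // freq_gt0.
by exists 1 => _ [K _ <-]; exact: freq_sum_le1.
Qed.

Lemma cvg_sum_ord n (F : 'I_n -> nat -> R) (L : 'I_n -> R) :
  (forall i, F i k @[k --> \oo] --> L i) -> \sum_(i < n) F i k @[k --> \oo] --> \sum_(i < n) L i.
Proof.
elim: n F L => [|n IH] F L h; first by rewrite big_ord0; under eq_fun do rewrite big_ord0; exact: cvg_cst.
by rewrite big_ord_recr; under eq_fun do rewrite big_ord_recr; apply: cvgD; [exact: IH|exact: h].
Qed.

Lemma binet_kernel_expansion J t : 0 < t ->
  `|binet_kernel t - \sum_(j < J) (-1) ^+ j * freq_series j * t ^+ j.*2| <= t ^+ J.*2.
Proof.
move=> t0.
have c : `|trunc_kernel K t - \sum_(j < J) (-1) ^+ j * freq_sum R K j * t ^+ j.*2| @[K --> \oo] -->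
    `|binet_kernel t - \sum_(j < J) (-1) ^+ j * freq_series j * t ^+ j.*2|.
  apply: cvg_norm; apply: cvgB; first exact: cvg_trunc_kernel_binet.
  apply: cvg_sum_ord => j; apply: cvgM; last exact: cvg_cst.
  by apply: cvgM; [exact: cvg_cst|exact: cvg_freq_sum].
apply: (ler_cvg_to c (cvg_cst _)); apply: nearW => K.
apply: (le_trans (trunc_kernel_expansion _ _ _)); rewrite ler_piMl ?freq_sum_le1 //.
by rewrite exprn_ge0 // ltW.
Qed.

(* Truncations of the series of [t / (exp t - 1) = 1 - t / 2 + t^2 b(t)] and of [(exp t - 1) / t]. *)
Let Q J : {poly R} := 1 - 2^-1 *: 'X + \sum_(j < J) ((-1) ^+ j * freq_series j) *: 'X^(j.*2.+2).
Let E n : {poly R} := \sum_(k < n) (k.+1`!%:R)^-1 *: 'X^k.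

Let coefE n k : (k < n)%N -> (E n)`_k = (k.+1`!%:R)^-1.
Proof.
move=> kn; rewrite coef_sum (bigD1 (Ordinal kn)) //= coefZ coefXn eqxx mulr1 big1 ?addr0 // => i.
by rewrite -val_eqE /= => ik; rewrite coefZ coefXn eq_sym (negPf ik) mulr0.
Qed.

Let coefQ J j : (j < J)%N -> (Q J)`_j.*2.+2 = (-1) ^+ j * freq_series j.
Proof.
move=> jJ; rewrite coefD coefB coefZ coef1 coefX /= mulr0 subr0 add0r.
rewrite coef_sum (bigD1 (Ordinal jJ)) //= coefZ coefXn eqxx mulr1 big1 ?addr0 // => i.
rewrite -val_eqE /= => ik; rewrite coefZ coefXn; case: eqP => [e|_]; last by rewrite mulr0.
by case/eqP: ik; lia.
Qed.

(** With [e * f = 1] one has [E Q - 1 = - ((e - E) f + E (f - Q))], and each truncation error is of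
    order [n]. *)
Let EQ n : bigO n (fun t => (E n * Q n - 1).[t]).
Proof.
pose e t : R := (expR t - 1) / t; pose f t : R := t / (expR t - 1).
have et t : 0 < t -> expR t - 1 != 0 by move=> t0; rewrite subr_eq0 gt_eqF // expR_gt1.
have hE : bigO n (fun t => e t - (E n).[t]).
  have [C hC] := bigO_exp_taylor n.+1 (bigO_id R); exists C => t /andP[t0 t1].
  have := hC t (introT andP (conj t0 t1)).
  have -> : expR t - exp_taylor n.+1 t = t * (e t - (E n).[t]).
    have -> : exp_taylor n.+1 t = 1 + t * (E n).[t].
      rewrite /exp_taylor big_ord_recl fact0 invr1 expr0 mul1r; congr (_ + _).
      rewrite horner_sum mulr_sumr; apply: eq_bigr => k _.
      by rewrite hornerZ hornerXn /bump /= exprS; ring.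
    by rewrite /e; move: ((E n).[t]) => h; field; exact: lt0r_neq0.
  by rewrite normrM gtr0_norm // exprS mulrCA ler_pM2l.
have hQ : bigO n (fun t => f t - (Q n).[t]).
  apply: (@bigOW _ _ n.*2.+2); first by rewrite -addnn; lia.
  exists 1 => t /andP[t0 t1]; rewrite mul1r.
  have -> : f t - (Q n).[t] = t ^+ 2 * (binet_kernel t - \sum_(j < n) (-1) ^+ j * freq_series j * t ^+ j.*2).
    have -> : (Q n).[t] = 1 - t / 2 + t ^+ 2 * \sum_(j < n) (-1) ^+ j * freq_series j * t ^+ j.*2.
      rewrite /Q !(hornerD, hornerN, hornerZ, hornerX, hornerC) [(\sum_(j < n) _).[_]]horner_sum mulr_sumr.
      congr (1 - _ + _); first by rewrite mulrC.
      by apply: eq_bigr => j _; rewrite hornerZ hornerXn -addn2 exprD; ring.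
    rewrite /f /binet_kernel; move: (\sum_(j < n) _) (expR t - 1) (et t t0) => S X X0.
    by field; rewrite X0 lt0r_neq0.
  rewrite normrM normrX (gtr0_norm t0) -[n.*2.+2]addn2 addnC exprD ler_pM2l ?exprn_gt0 //.
  exact: binet_kernel_expansion.
have Q0 := bigO_poly (Q n); have E0 := bigO_poly (E n).
have f0 : bigO 0 f.
  by apply: (bigO_eq _ (bigOD (bigOW (leq0n n) hQ) Q0)) => t _; rewrite subrK.
have h1 := bigOM hE f0; have h2 := bigOM E0 hQ; rewrite addn0 in h1.
apply: (bigO_eq _ (bigON (bigOD h1 h2))) => t /andP[t0 _].
rewrite [(E n * Q n - 1).[t]]hornerD [(E n * Q n).[t]]hornerM [(- 1).[t]]hornerN hornerC.
have : e t * f t = 1 by have := et t t0; rewrite /e /f; move: (expR t - 1) => X X0; field; rewrite X0 lt0r_neq0.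
by move: (e t) (f t) => a b ab; rewrite -ab; ring.
Qed.

(** The Cauchy product in [E Q = 1 + O(t^n)]. Multiplied by factorials it becomes the binomial
    recursion defining [bernoulli], which is how [bernoulli_coefQ] identifies the coefficients. *)
Let recQ n m : (m < n)%N -> \sum_(k < m.+1) (Q n)`_k / ((m.+1 - k)`!%:R) = (m == 0)%:R.
Proof.
move=> mn; have := germ_coef0 (bigOW mn (EQ n)); rewrite coefB coef1 => /eqP; rewrite subr_eq0 => /eqP <-.
rewrite coefMr; apply: eq_bigr => k _.
by rewrite coefE ?(leq_ltn_trans (leq_subr _ _)) // mulrC subSn // -ltnS.
Qed.

Lemma size_bernoulli_seq n : size (bernoulli_seq R n) = n.+1.
Proof. by elim: n => //= n IH; rewrite size_rcons IH. Qed.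

Lemma nth_bernoulli_seq n k : (k <= n)%N -> (bernoulli_seq R n)`_k = bernoulli R k.
Proof.
elim: n => [|n IH]; first by rewrite leqn0 => /eqP ->.
rewrite leq_eqVlt => /predU1P[-> //|kn].
by rewrite /= nth_rcons size_bernoulli_seq kn IH.
Qed.

Lemma bernoulliS m : bernoulli R m.+1 = - ((m.+2%:R)^-1 * \sum_(k < m.+1) 'C(m.+2, k)%:R * bernoulli R k).
Proof.
rewrite {1}/bernoulli /= nth_rcons size_bernoulli_seq ltnn eqxx; congr (- (_ * _)).
by apply: eq_bigr => k _; rewrite nth_bernoulli_seq // -ltnS.
Qed.

Let bernoulli_coefQ n m : (m < n)%N -> bernoulli R m = m`!%:R * (Q n)`_m.
Proof.
elim/ltn_ind: m => [[|m] IH] mn.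
  by have := recQ mn; rewrite big_ord1 /= divr1 fact0 mul1r => ->.
have := recQ mn; rewrite big_ord_recr /= subSnn divr1 => /eqP; rewrite addrC addr_eq0 => /eqP ->.
rewrite bernoulliS mulrN; congr (- _); rewrite !mulr_sumr; apply: eq_bigr => k _.
have km : (k < m.+1)%N by [].
rewrite (IH k km (ltn_trans km mn)).
have c := bin_fact (leqW (ltnW km) : (k <= m.+2)%N).
have {c} c : m.+2%:R * m.+1`!%:R = 'C(m.+2, k)%:R * (k`!%:R * (m.+2 - k)`!%:R) :> R by rewrite -!natrM c -factS.
have f1 : (m.+2 - k)`!%:R != 0 :> R by rewrite pnatr_eq0 -lt0n fact_gt0.
have m2 : m.+2%:R != 0 :> R by rewrite pnatr_eq0.
apply: (mulfI m2); rewrite !mulrA divff // mul1r c.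
by move: (_`!%:R) f1 (k`!%:R) ('C(_, _)%:R) => F F0 k' C; field.
Qed.

(** Euler's evaluation of [zeta(2j + 2)], obtained by comparing two expansions of [t / (exp t - 1)].
    This connects the moments with the Stirling coefficients. *)
Lemma bernoulli_freq_series j : bernoulli R j.*2.+2 = (j.*2.+2)`!%:R * ((-1) ^+ j * freq_series j).
Proof.
rewrite (@bernoulli_coefQ j.*2.+3) // coefQ //.
by rewrite -addnn; lia.
Qed.

Definition stirling_exponent_coef j : R := bernoulli R j.*2 / (j.*2 * j.*2.-1)%N%:R.

Lemma stirling_exponent_coefE j : stirling_exponent_coef j.+1 = (-1) ^+ j * (j.*2)`!%:R * freq_series j.
Proof.
rewrite /stirling_exponent_coef doubleS bernoulli_freq_series /= !factS !natrM.
have h1 : j.*2.+2%:R != 0 :> R by rewrite pnatr_eq0.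
have h2 : j.*2.+1%:R != 0 :> R by rewrite pnatr_eq0.
by move: (j.*2.+2%:R) (j.*2.+1%:R) h1 h2 => a b a0 b0; field; rewrite a0 b0.
Qed.

Lemma stirling_coefE n : stirling_coef R n = (-1) ^+ n * exp_coef stirling_exponent_coef n.
Proof. by []. Qed.

Lemma cvg_trunc_exponent_coef j : trunc_exponent_coef R K j.+1 @[K --> \oo] --> stirling_exponent_coef j.+1.
Proof.
rewrite stirling_exponent_coefE; apply: cvgM; last exact: cvg_freq_sum.
exact: cvg_cst.
Qed.

Let pcvg (P : nat -> {poly R}) (p : {poly R}) := forall i, (P K)`_i @[K --> \oo] --> p`_i.

Let pcvgX P p k : pcvg P p -> pcvg (fun K => P K ^+ k) (p ^+ k).
Proof.
move=> h; elim: k => [|k IH] i.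
  by rewrite expr0; under eq_fun do rewrite expr0; exact: cvg_cst.
rewrite exprS coefM; under eq_fun do rewrite exprS coefM.
by apply: cvg_sum_ord => j; apply: cvgM; [exact: h|exact: IH].
Qed.

(** The [n]-th coefficient is a polynomial in finitely many exponent coefficients, so its limit in
    [K] involves no exchange with an asymptotic expansion. *)
Lemma cvg_exp_coef (a : nat -> nat -> R) b n : (forall j, a K j.+1 @[K --> \oo] --> b j.+1) ->
  exp_coef (a K) n @[K --> \oo] --> exp_coef b n.
Proof.
move=> h; rewrite /exp_coef coef_sum; under eq_fun do rewrite coef_sum.
apply: cvg_sum_ord => k; rewrite coefZ; under eq_fun do rewrite coefZ.
apply: cvgM; first exact: cvg_cst.
apply: pcvgX => i; rewrite /odd_poly_of big_add1 big_mkord coef_sum.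
under eq_fun do rewrite big_add1 big_mkord coef_sum.
apply: cvg_sum_ord => j; rewrite coefZ; under eq_fun do rewrite coefZ.
by apply: cvgM; [exact: h|exact: cvg_cst].
Qed.

Lemma cvg_mcoef n : mcoef (@trunc_kernel R K) n @[K --> \oo] --> (-1) ^+ n * stirling_coef R n.
Proof.
rewrite stirling_coefE mulrA -exprMn mulrNN mulr1 expr1n mul1r.
under eq_fun do rewrite mcoef_trunc_kernel.
by apply: cvg_exp_coef => j; exact: cvg_trunc_exponent_coef.
Qed.

End BernoulliNumbers.

(** * Binet's function and the Gamma function *)

Section BinetFunction.
Variable R : realType.
Implicit Types (z w : R[i]) (x y t : R) (K n : nat).
Local Open Scope classical_set_scope.

Lemma trunc_kernel_le1 K t : trunc_kernel K t <= 1.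
Proof.
have := trunc_kernel_expansion 0 K t; rewrite big_ord0 subr0 expr0 mulr1 => h.
by apply: (le_trans (ler_norm _)); apply: (le_trans h); exact: freq_sum_le1.
Qed.

Lemma binet_kernel_ge0 t : 0 < t -> 0 <= binet_kernel t.
Proof.
move=> t0; apply: (ler_cvg_to (cvg_cst 0) (cvg_trunc_kernel_binet t0)); apply: nearW => K.
exact: trunc_kernel_ge0.
Qed.

Lemma binet_kernel_le1 t : 0 < t -> binet_kernel t <= 1.
Proof.
move=> t0; apply: (ler_cvg_to (cvg_trunc_kernel_binet t0) (cvg_cst (1 : R))); apply: nearW => K.
exact: trunc_kernel_le1.
Qed.

Lemma measurable_binet_kernel : measurable_fun setT (@binet_kernel R).
Proof.
have me : measurable_fun setT (fun t : R => expR t - 1).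
  by apply: measurable_funB => //; exact: measurable_expR.
have m1 (f : R -> R) : measurable_fun setT f -> measurable_fun setT (fun t => (f t)^-1).
  by move=> mf; under eq_fun do rewrite -[_^-1]mul1r; exact: measurable_div_gen.
apply: measurable_div_gen => //; apply: measurable_funD => //.
by apply: measurable_funB; apply: m1.
Qed.

Lemma rintble_expNM x : 0 < x -> rintble `]0, +oo[ (fun t => expR (- (x * t))).
Proof.
move=> x0; apply: (rintble_eq _ _ (rintble_exprM_expNM 0 x0)) => // t _.
by rewrite expr0 mul1r.
Qed.

Lemma rint_expNM x : 0 < x -> \int[mu]_(t in `]0, +oo[) expR (- (x * t)) = x^-1.
Proof.
move=> x0; have := rint_exprM_expN 0 x0; rewrite fact0 mul1r expr1 => <-.
by apply: eq_Rintegral => t _; rewrite expr0 mul1r.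
Qed.

Lemma normc_lap_integrand (c : R -> R) z t : normc ((c t)%:C * cexp (- (z * t%:C))) = `|c t| * expR (- (Re z * t)).
Proof. by rewrite normcM normcR normc_cexp ReN ReZr. Qed.

(** For [Re z > 0] the exponential factor supplies the decay that the full kernel lacks; all kernels
    are bounded by 1. *)
Lemma cvg_lap_trunc_kernel z : 0 < Re z ->
  cintble `]0, +oo[ (fun t => (binet_kernel t)%:C * cexp (- (z * t%:C))) /\
  ccvg (fun K => lap (trunc_kernel K) z) (lap (@binet_kernel R) z).
Proof.
move=> z0; apply: (cint_dct _ _ _ _ (rintble_expNM z0)) => //.
- by move=> K; have m := (@kernel_trunc R K).1; cmeas.
- by have m := measurable_binet_kernel; cmeas.
- move=> t /gt0_itv t0; apply: ccvgM; last exact: ccvg_cst.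
  by apply: ccvgR; exact: cvg_trunc_kernel_binet.
- move=> K t _; rewrite normc_lap_integrand -[leRHS]mul1r ler_wpM2r ?expR_ge0 //.
  by rewrite ger0_norm ?trunc_kernel_ge0 // trunc_kernel_le1.
Qed.

Lemma normc_lap_binet z : 0 < Re z -> normc (lap (@binet_kernel R) z) <= (Re z)^-1.
Proof.
move=> z0; rewrite -rint_expNM //; apply: cint_norm_le => //.
- exact: (cvg_lap_trunc_kernel z0).1.
- exact: rintble_expNM.
move=> t /gt0_itv t0; rewrite normc_lap_integrand -[leRHS]mul1r ler_wpM2r ?expR_ge0 //.
by rewrite ger0_norm ?binet_kernel_ge0 // binet_kernel_le1.
Qed.

Lemma ccvg_lap_binet (u : nat -> R[i]) : (forall n, n.+1%:R <= Re (u n)) -> ccvg (fun n => lap (@binet_kernel R) (u n)) 0.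
Proof.
move=> h; apply: (ccvg_bound _ (@cvg_harmonic R)); apply: nearW => n; rewrite subr0.
have u0 : 0 < Re (u n) by apply: lt_le_trans (h n); rewrite ltr0n.
by apply: (le_trans (normc_lap_binet u0)); rewrite lef_pV2 ?posrE ?ltr0n.
Qed.

Definition binet_weight t x : R := t / 2 * (x * (1 - x)) * expR (- (x * t)).

Lemma continuous_binet_weight t : continuous (binet_weight t).
Proof.
move=> x; apply: cvgM.
  apply: cvgM; first exact: cvg_cst.
  by apply: cvgM; [exact: cvg_id|apply: cvgB; [exact: cvg_cst|exact: cvg_id]].
apply: (@continuous_comp _ _ _ (fun x => - (x * t)) expR); last exact: continuous_expR.
by apply: cvgN; apply: cvgM; [exact: cvg_id|exact: cvg_cst].
Qed.

Lemma rintble_binet_weight t : 0 < t -> rintble `[0, 1] (binet_weight t).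
Proof.
move=> t0; apply: (@rintble_bounded _ _ _ t).
  exact: continuous_measurable_fun (@continuous_binet_weight t).
move=> x /andP[x0 x1]; rewrite normrM -[leRHS]mulr1; apply: ler_pM => //.
  by rewrite ger0_norm ?mulr_ge0 ?subr_ge0 ?divr_ge0 ?(ltW t0) //; nra.
by rewrite ger0_norm ?expR_ge0 // expR_le1 oppr_le0 mulr_ge0 // ltW.
Qed.

(** The error of the trapezoidal rule on [[0, 1]] for [x -> expR (- (x * t)) / t], written with the
    Peano kernel [x (1 - x) / 2]. *)
Lemma binet_kernel_diff t : 0 < t -> binet_kernel t * (1 - expR (- t)) =
  \int[mu]_(x in `[0, 1]) binet_weight t x.
Proof.
move=> t0; have tn := lt0r_neq0 t0.
pose H x := - (x * (1 - x) / 2 + (1 - 2 * x) / (2 * t) - t ^- 2) * expR (- (x * t)).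
have dH x : is_derive x 1 H (binet_weight t x).
  have i := rder_id x.
  have d1 := rderM (rderM i (rderB (rder_cst x 1) i)) (rder_cst x 2^-1).
  have d2 := rderM (rderB (rder_cst x 1) (rderM (rder_cst x 2) i)) (rder_cst x (2 * t)^-1).
  have dE := rder_comp (is_derive_expR ((fun x => - (x * t)) x)) (rderN (rderM i (rder_cst x t))).
  apply: rder_eq (rderM (rderN (rderB (rderD d1 d2) (rder_cst x (t ^- 2)))) dE) _ => /=; rewrite /binet_weight.
  by move: (expR _) => E; field.
rewrite (rint_ftc_itv ltr01 (fun x _ => dH x)).
  rewrite /H !mul0r !mul1r oppr0 expR0 /binet_kernel.
  have e0 := lt0r_neq0 (expR_gt0 t); have e1 : expR t - 1 != 0 by rewrite subr_eq0 gt_eqF // expR_gt1.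
  by rewrite expRN; move: (expR t) e0 e1 => E e0 e1; field; rewrite e0 tn e1.
by move=> x _; exact: continuous_binet_weight.
Qed.

Lemma cintble_mulexp w : 0 < Re w -> cintble `]0, +oo[ (fun t => t%:C * cexp (- (w * t%:C))).
Proof.
move=> w0; apply: (cintble_le _ _ (rintble_exprM_expNM 1 w0)) => //; first by cmeas.
move=> t /gt0_itv t0; rewrite normcM normcR normc_cexp ReN ReZr expr1.
by rewrite gtr0_norm.
Qed.

Lemma cint_mulexp w : 0 < Re w ->
  cintegral `]0, +oo[ (fun t => t%:C * cexp (- (w * t%:C))) = w ^- 2.
Proof.
move=> w0; have wn := neq0_Re w0.
have ex n (c : R[i]) : cmeas (fun t : R => c * (t%:C ^+ n * cexp (- (w * t%:C)))) by cmeas.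
rewrite (@cint_ftc0y _ _ (fun t => - (t%:C / w + w ^- 2) * cexp (- (w * t%:C))) (- w ^- 2) 0).
- by rewrite sub0r opprK.
- move=> t; apply: cder_eq (cderM (cderN (cderD (cderM (cder_id t) (cder_cst t w^-1)) (cder_cst t (w ^- 2)))) (cder_cexpN w t)) _.
  by rewrite /=; move: (cexp _) => E; field.
- by move=> t; eexists; apply: cderM (cder_id t) (cder_cexpN w t).
- by cmeas.
- exact: cintble_mulexp.
- by rewrite mul0r add0r mulr0 oppr0 cexp0 mulr1.
- have h n : ccvg (fun k : nat => k.+1%:R%:C ^+ n * cexp (- (w * k.+1%:R%:C))) (0 : R[i]).
    apply: (ccvg_bound _ (cvg_exprM_expN n w0)); apply: nearW => k.
    by rewrite subr0 normcM normcX normcR normc_cexp ReN ReZr gtr0_norm // ltr0n.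
  rewrite -(_ : - (w^-1 * 0 + w ^- 2 * 0) = 0 :> R[i]); last by rewrite !mulr0 addr0 oppr0.
  apply: ccvg_eq (ccvgN (ccvgD (ccvgM (ccvg_cst w^-1) (h 1%N)) (ccvgM (ccvg_cst (w ^- 2)) (h 0%N)))).
  by apply: nearW => k; rewrite expr0 expr1; ring.
Qed.

Definition binet_frac z x : R[i] := 2^-1 * (x%:C * (1 - x%:C) / (z + x%:C) ^+ 2).

Lemma binet_fracE z x : binet_frac z x = (2^-1 * (x * (1 - x)))%:C * (z + x%:C) ^- 2.
Proof.
have e : (2^-1 * (x * (1 - x)))%:C = 2^-1 * (x%:C * (1 - x%:C)) :> R[i].
  by rewrite !rmorphM rmorphB rmorph1 fmorphV rmorph_nat.
rewrite e; exact: (mulrA 2^-1 (x%:C * (1 - x%:C)) _).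
Qed.

Lemma Re_addR_gt0 z x : 0 < Re z -> 0 <= x -> 0 < Re (z + x%:C).
Proof. by move=> z0 x0; rewrite ReD ReC ltr_pwDl. Qed.

Lemma half_mul_oneB_le1 x : 0 <= x <= 1 -> `|2^-1 * (x * (1 - x))| <= 1.
Proof.
move=> /andP[x0 x1]; rewrite ger0_norm; first by nra.
by rewrite mulr_ge0 // mulr_ge0 // subr_ge0.
Qed.

Lemma rintble_cst01 : rintble `[0, 1] (fun=> 1 : R).
Proof. by apply: (@rintble_bounded _ _ _ 1) => // x _; rewrite normr1. Qed.

Lemma normc_binet_frac z x : 0 < Re z -> 0 <= x <= 1 -> normc (binet_frac z x) <= Re z ^- 2.
Proof.
move=> z0 x01; have /andP[x0 x1] := x01.
rewrite binet_fracE -[leRHS]mul1r; apply: normcM_le; first by rewrite normcR half_mul_oneB_le1.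
have n0 : 0 < normc (z + x%:C) by rewrite normc_gt0 // neq0_Re // Re_addR_gt0.
rewrite normcV normcX lef_pV2 ?posrE ?exprn_gt0 // lerXn2r ?nnegrE ?(ltW z0) ?(ltW n0) //.
by apply: le_trans (Re_le_normc' _); rewrite ReD ReC lerDl.
Qed.

(** Again a trapezoidal error, now of [x -> - log (z + x)], whose second derivative is
    [(z + x)^(-2)]. *)
Lemma cint_binet_frac z : 0 < Re z ->
  cintegral `[0, 1] (binet_frac z) = (z + 2^-1) * (clogh (z + 1) - clogh z) - 1.
Proof.
move=> z0; have nz := neq0_Re z0.
have nz1 : z + 1 != 0 by apply: neq0_Re; rewrite ReD Re1 addr_gt0.
pose F x := 2^-1 * (- x%:C + (1 + 2%:R * z) * clogh (z + x%:C) + z * (1 + z) / (z + x%:C)).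
have dF x : 0 <= x -> cder F x (binet_frac z x).
  move=> x0; have zx := Re_addR_gt0 z0 x0; have n0 := neq0_Re zx.
  have dzx : cder (fun x => z + x%:C) x 1 by apply: cder_eq (cderD (cder_cst x z) (cder_id x)) _; rewrite add0r.
  apply: cder_eq (cderZ 2^-1 (cderD (cderD (cderN (cder_id x)) (cderZ (1 + 2%:R * z) (cder_clogh zx dzx)))
    (cderZ (z * (1 + z)) (cderV n0 dzx)))) _.
  by rewrite /binet_frac; field.
have dh x : 0 <= x -> exists d, cder (binet_frac z) x d.
  move=> x0; have n0 := neq0_Re (Re_addR_gt0 z0 x0); eexists; rewrite /binet_frac.
  apply: cderZ; apply: cderM; first by apply: cderM (cder_id x) (cderB (cder_cst x 1) (cder_id x)).
  apply: cderV; first by rewrite expf_neq0.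
  by apply: cderX; apply: cderD (cder_cst x z) (cder_id x).
have mh : cmeas (binet_frac z) by rewrite /binet_frac; cmeas.
have m01 : measurable (`[0, 1] : set R) by exact: measurable_itv.
have ih : cintble `[0, 1] (binet_frac z).
  apply: (cintble_le m01 mh (rintbleZ (Re z ^- 2) m01 rintble_cst01)) => x /=; rewrite in_itv /= => x01.
  by rewrite mulr1 normc_binet_frac.
have -> : cintegral `[0, 1] (binet_frac z) = F 1 - F 0.
  apply: (@cint_ftc _ _ _ F (fun=> 0) (fun=> 1)) => //.
  - by move=> x /=; rewrite in_itv => xi; apply: nearW.
  - by move=> x /=; rewrite in_itv => /andP[x0 _]; exact: dF.
  - by move=> x /=; rewrite in_itv => /andP[x0 _]; exact: dh.
  - exact: ccvg_cst.
  - exact: ccvg_cst.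
rewrite /F; rewrite (_ : 1%:C = 1 :> R[i]) // (_ : 0%:C = 0 :> R[i]) // addr0.
by move: (clogh _) (clogh _) => A B; field; rewrite nz nz1.
Qed.

(** Shifting [z] by 1 multiplies the integrand by [expR (- t)]; the factor [1 - expR (- t)] turns
    the kernel into [binet_weight], and Fubini reduces the transform to that of [t], which is
    [w ^- 2]. This difference equation makes [stirling_fun] satisfy the recursion of Gamma. *)
Lemma lap_binet_diff z : 0 < Re z -> lap (@binet_kernel R) z - lap (@binet_kernel R) (z + 1) =
  (z + 2^-1) * (clogh (z + 1) - clogh z) - 1.
Proof.
move=> z0; have z1 : 0 < Re (z + 1) by rewrite ReD Re1 addr_gt0.
pose f (p : R * R) := (p.1 / 2 * (p.2 * (1 - p.2)))%:C * cexp (- ((z + p.2%:C) * p.1%:C)).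
have mf : cmeas f.
  rewrite /f; cmeas.
  apply: measurable_funM; first by apply: measurable_funM => //; exact: measurable_fst.
  by apply: measurable_funM; [exact: measurable_snd|apply: measurable_funB => //; exact: measurable_snd].
have m01 : measurable (`[0, 1] : set R) by exact: measurable_itv.
have m0y : measurable (`]0, +oo[ : set R) by exact: measurable_itv.
have i01 := rintble_cst01.
have fb t x : `]0, +oo[ t -> `[0, 1] x -> normc (f (t, x)) <= (t ^+ 1 * expR (- (Re z * t))) * 1.
  move=> /gt0_itv t0 hx; have /andP[x0 x1] : 0 <= x <= 1 by move: hx; rewrite /= in_itv.
  rewrite mulr1 expr1; apply: (@normcM_le _ (t / 2 * (x * (1 - x)))%:C (cexp (- ((z + x%:C) * t%:C)))).
    by rewrite normcR ger0_norm ?mulr_ge0 ?subr_ge0 ?divr_ge0 ?(ltW t0) //; nra.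
  rewrite normc_cexp ler_expR ReN ReZr ReD ReC lerN2 ler_wpM2r ?(ltW t0) //; lra.
have [_ fub] := cint_fubini m0y m01 mf (rintble_exprM_expNM 1 z0) i01 fb.
have [i1 _] := cvg_lap_trunc_kernel z0; have [i2 _] := cvg_lap_trunc_kernel z1.
rewrite -(cintB m0y i1 i2).
transitivity (cintegral `]0, +oo[ (fun t => cintegral `[0, 1] (fun x => f (t, x)))).
  apply: cint_eq => t /gt0_itv t0.
  have -> : (binet_kernel t)%:C * cexp (- (z * t%:C)) - (binet_kernel t)%:C * cexp (- ((z + 1) * t%:C)) =
      (binet_kernel t * (1 - expR (- t)))%:C * cexp (- (z * t%:C)).
    have e : cexp (- t%:C) = (expR (- t))%:C :> R[i] by rewrite -rmorphN cexpR.
    have e2 : (binet_kernel t * (1 - expR (- t)))%:C = (binet_kernel t)%:C * (1 - (expR (- t))%:C) :> R[i].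
      by rewrite rmorphM rmorphB rmorph1.
    by rewrite mulrDl mul1r opprD cexpD e e2; ring.
  have J := rintble_binet_weight t0.
  rewrite (binet_kernel_diff t0) -cintR mulrC -(cintZ _ m01 (cintbleR m01 J)).
  apply: cint_eq => x _; rewrite /f [(_, _).1]/= [(_, _).2]/=.
  have e : cexp (- (x%:C * t%:C)) = (expR (- (x * t)))%:C :> R[i] by rewrite -rmorphM -rmorphN cexpR.
  have e2 : (binet_weight t x)%:C =
      (t / 2 * (x * (1 - x)))%:C * (expR (- (x * t)))%:C :> R[i] by rewrite -rmorphM.
  by rewrite mulrDl opprD cexpD e e2; ring.
rewrite fub.
transitivity (cintegral `[0, 1] (binet_frac z)).
  apply: cint_eq => x /=; rewrite in_itv /= => /andP[x0 x1].
  rewrite /f /=; transitivity (cintegral `]0, +oo[ (fun t => (2^-1 * (x * (1 - x)))%:C * (t%:C * cexp (- ((z + x%:C) * t%:C))))).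
    apply: cint_eq => t _.
    have e : (t / 2 * (x * (1 - x)))%:C = (2^-1 * (x * (1 - x)))%:C * t%:C :> R[i].
      by rewrite -rmorphM; congr (_%:C); ring.
    by rewrite e [RHS]mulrA.
  rewrite (cintZ _ m0y (cintble_mulexp (Re_addR_gt0 z0 x0))) (cint_mulexp (Re_addR_gt0 z0 x0)).
  exact: esym (binet_fracE z x).
exact: cint_binet_frac.
Qed.

End BinetFunction.

(** * Integrability of Euler's integrand *)

Section EulerLimit.
Variable R : realType.
Implicit Types (z w : R[i]) (x y t c : R) (m n : nat).
Local Open Scope classical_set_scope.

Lemma rintble_ge0_exhaust (D : set R) (f : R -> R) (a b : nat -> R) M : measurable D ->
  measurable_fun setT f -> (forall x, D x -> 0 <= f x) ->
  (forall n, a n.+1 <= a n) -> (forall n, b n <= b n.+1) ->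
  (forall n x, a n <= x <= b n -> D x) -> (forall x, D x -> \forall n \near \oo, a n <= x <= b n) ->
  (forall n, rintble `[a n, b n] f) -> (forall n, \int[mu]_(x in `[a n, b n]) f x <= M) -> rintble D f.
Proof.
move=> mD mf f0 da db sD exD ifn hM.
have DE : D = \bigcup_n `[a n, b n].
  apply/seteqP; split => x; last by move=> [n _] /=; rewrite in_itv; exact: sD.
  by move=> /exD [N _ h]; exists N => //=; rewrite in_itv; apply: h => /=.
have nd : nondecreasing_seq (fun n => `[a n, b n] : set R).
  apply/nondecreasing_seqP => n; apply/subsetPset => x /=; rewrite !in_itv /= => /andP[h1 h2].
  by rewrite (le_trans (da n)) // (le_trans h2).
have mi n : measurable_fun `[a n, b n] (EFin \o f) by apply/measurable_EFinP; exact: measurable_funTS.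
have i0 n x : `[a n, b n] x -> (0 <= (EFin \o f) x)%E by rewrite /= in_itv => /sD Dx; rewrite lee_fin f0.
have c := @ge0_nondecreasing_set_cvg_integral _ (measurableTypeR R) R (fun n => `[a n, b n]) (EFin \o f) mu nd (fun n => measurable_itv _) mi i0.
rewrite -DE in c.
apply/integrableP; split; first by apply/measurable_EFinP; exact: measurable_funTS.
have -> : (\int[mu]_(x in D) `|(EFin \o f) x| = \int[mu]_(x in D) (f x)%:E)%E.
  by apply: eq_integral => x; rewrite inE => Dx /=; rewrite ger0_norm // f0.
apply: (@le_lt_trans _ _ M%:E); last exact: ltry.
apply: (cvge_to_le c); apply: nearW => n.
have fin := @integrable_fin_num _ _ _ mu _ (measurable_itv _) _ (ifn n).
by rewrite -(fineK fin) lee_fin; exact: hM.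
Qed.

(* The derivative of [t^x / (1 + t^x)]: integrable, it dominates [t^(x - 1) exp (- t)] at both ends. *)
Definition loglogistic_pdf x t : R := x / t * expR (x * ln t) / (1 + expR (x * ln t)) ^+ 2.

Lemma measurable_exp_ln x : measurable_fun setT (fun t => expR (x * ln t)).
Proof.
by apply: (measurableT_comp (@measurable_expR R)); apply: measurable_funM => //; exact: measurable_ln.
Qed.

Lemma rder_exp_ln x t : 0 < t -> is_derive t 1 (fun t => expR (x * ln t)) (x / t * expR (x * ln t)).
Proof.
move=> t0; have h := rderM (rder_cst t x) (is_derive1_ln t0).
apply: rder_eq (rder_comp (is_derive_expR ((fun t => x * ln t) t)) h) _ => /=; ring.
Qed.

Lemma rintble_loglogistic_pdf x : 0 < x -> rintble `]0, +oo[ (loglogistic_pdf x).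
Proof.
move=> x0.
have m : measurable_fun setT (loglogistic_pdf x).
  apply: measurable_div_gen.
    apply: measurable_funM; last exact: measurable_exp_ln.
    by apply: measurable_div_gen => //; exact: measurable_id.
  by apply: measurable_funX; apply: measurable_funD => //; exact: measurable_exp_ln.
have a0 n : 0 < (n.+2%:R : R)^-1 by [].
have ab n : (n.+2%:R : R)^-1 < n.+2%:R.
  have : 1 < n.+2%:R :> R by rewrite ltr1n.
  by move=> h; apply: (@lt_trans _ _ 1) => //; rewrite invf_lt1.
pose G t : R := - (1 + expR (x * ln t))^-1.
have D0 t : 0 < 1 + expR (x * ln t) by rewrite addr_gt0 ?expR_gt0.
have dG t : 0 < t -> is_derive t 1 G (loglogistic_pdf x t).
  move=> t0; have d := rderD (rder_cst t 1) (rder_exp_ln x t0).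
  have := rderN (rderV (_ : (fun t => 1 + expR (x * ln t)) t != 0) d).
  by move=> /(_ (lt0r_neq0 (D0 t))) h; apply: rder_eq h _; rewrite /loglogistic_pdf /= add0r mulNr opprK.
have cg t : 0 < t -> {for t, continuous (loglogistic_pdf x)}.
  move=> t0; have ce : expR (x * ln s) @[s --> t] --> expR (x * ln t) := rder_continuous (rder_exp_ln x t0).
  have ct : (s^-1 : R) @[s --> t] --> t^-1 by apply: cvgV; [exact: lt0r_neq0|exact: cvg_id].
  apply: cvgM; first by apply: cvgM => //; apply: cvgM => //; exact: cvg_cst.
  apply: cvgV; first by rewrite expf_neq0 // lt0r_neq0.
  rewrite expr2; under eq_fun do rewrite expr2.
  by apply: cvgM; apply: cvgD => //; exact: cvg_cst.
apply: (@rintble_ge0_exhaust _ _ (fun n => n.+2%:R^-1) (fun n => n.+2%:R) 1) => //.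
- move=> t /gt0_itv t0; rewrite /loglogistic_pdf !mulr_ge0 ?invr_ge0 ?expR_ge0 ?sqr_ge0 ?(ltW t0) ?(ltW x0) //.
- by move=> n; rewrite lef_pV2 ?posrE // ler_nat.
- by move=> n; rewrite ler_nat.
- by move=> n t /andP[h _]; rewrite /= in_itv /= andbT; exact: lt_le_trans h.
- move=> t /gt0_itv t0.
  exists (Num.bound (t + t^-1)) => // n /= xn.
  have h : t + t^-1 < n.+2%:R.
    apply: (lt_le_trans (archi_boundP _)); last by rewrite ler_nat leqW // leqW.
    by rewrite addr_ge0 ?invr_ge0 // ltW.
  have v0 : 0 < t^-1 by rewrite invr_gt0.
  apply/andP; split; last by lra.
  by rewrite -[leRHS]invrK lef_pV2 ?posrE //; lra.
- move=> n; apply: continuous_compact_integrable; first exact: segment_compact.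
  apply: continuous_in_subspaceT => t; rewrite inE /= in_itv /= => /andP[h _]; apply: cg.
  exact: lt_le_trans h.
- move=> n.
  have -> : \int[mu]_(t in `[n.+2%:R^-1, n.+2%:R]) loglogistic_pdf x t = G n.+2%:R - G n.+2%:R^-1.
    apply: (rint_ftc_itv (ab n)) => t /andP[h _]; first by apply: dG; exact: lt_le_trans h.
    by apply: cg; exact: lt_le_trans h.
  rewrite /G opprK; have h1 := D0 n.+2%:R; have h2 := D0 n.+2%:R^-1.
  have : 0 <= (1 + expR (x * ln n.+2%:R))^-1 by rewrite invr_ge0 ltW.
  have : (1 + expR (x * ln n.+2%:R^-1))^-1 <= 1 by rewrite invf_le1 // lerDl expR_ge0.
  by move: (_^-1) ((1 + expR (x * ln n.+2%:R))^-1) => u v; lra.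
Qed.

Lemma expR_ln_nat n t : 0 < t -> expR (n%:R * ln t) = t ^+ n.
Proof. by move=> t0; rewrite expRM_natl lnK // posrE. Qed.

Lemma expR_ln_sub1 x t : 0 < t -> expR ((x - 1) * ln t) = expR (x * ln t) / t.
Proof. by move=> t0; rewrite mulrBl mul1r expRB lnK // posrE. Qed.

Lemma rintble_Gamma x : 0 < x -> rintble `]0, +oo[ (fun t => expR ((x - 1) * ln t) * expR (- t)).
Proof.
move=> x0; have [n hn] : exists n : nat, x <= n%:R by exists (Num.bound x); apply/ltW/archi_boundP; exact: ltW.
(* With [T = t ^+ n] and [u <= 1 + T], one has [(1 + u)^2 <= (2 + T)^2 <= 8 + 2 T^2], and [T^2] is
   at most [(2n)!] times [expR t]. *)
pose C : R := 8 + 2 * (n + n)`!%:R.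
apply: (rintble_le _ _ (rintbleZ (C / x) _ (rintble_loglogistic_pdf x0))) => //.
  apply: measurable_funM; first exact: measurable_exp_ln.
  by apply: (measurableT_comp (@measurable_expR R)); exact: measurable_funN.
move=> t /gt0_itv t0; rewrite ger0_norm ?mulr_ge0 ?expR_ge0 // expR_ln_sub1 // /loglogistic_pdf.
set u := expR (x * ln t); have u0 : 0 < u by exact: expR_gt0.
have ut : u <= 1 + t ^+ n.
  have tn : 0 <= t ^+ n by rewrite exprn_ge0 // ltW.
  have [t1|t1] := leP t 1.
    have : u <= 1 by rewrite expR_le1 mulr_ge0_le0 ?(ltW x0) // ln_le0.
    lra.
  have : u <= t ^+ n by rewrite -expR_ln_nat // ler_expR ler_wpM2r // ln_ge0 // ltW.
  lra.
have key : (1 + u) ^+ 2 <= C * expR t.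
  have h : t ^+ n * t ^+ n <= (n + n)`!%:R * expR t.
    by rewrite -exprD; apply: expr_le_fact_expR; exact: ltW.
  have e1 : 1 <= expR t by have := expR_ge1Dx t; lra.
  have T0 : 0 <= t ^+ n by rewrite exprn_ge0 // ltW.
  rewrite /C mulrDl -[2 * _ * _]mulrA.
  move: (expR t) ((n + n)`!%:R * expR t) (t ^+ n) h e1 ut T0 => E F T h e1 ut T0.
  have u1 : 0 <= 1 + u by rewrite addr_ge0 // ltW.
  have T2 : 0 <= 2 + T by rewrite addr_ge0.
  have uT : 1 + u <= 2 + T by lra.
  have := ler_pM u1 u1 uT uT.
  by rewrite expr2; have := sqr_ge0 (T - 2); rewrite expr2; lra.
rewrite (_ : C / x * _ = u / t * (C / (1 + u) ^+ 2)); last first.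
  have := lt0r_neq0 x0; have := lt0r_neq0 t0; have : 1 + u != 0 by rewrite lt0r_neq0 // addr_gt0.
  by move: C u {u0 ut key} => C u h1 h2 h3; field; rewrite h1 h2 h3.
apply: ler_wpM2l; first by rewrite divr_ge0 // ltW.
by rewrite ler_pdivlMr ?exprn_gt0 ?addr_gt0 // expRN mulrC ler_pdivrMr ?expR_gt0.
Qed.

End EulerLimit.

(** * Euler's limit formula for Gamma *)

Section GammaEuler.
Variable R : realType.
Implicit Types (z w : R[i]) (x y t c : R) (m n : nat).
Local Open Scope classical_set_scope.

Definition tpow z t : R[i] := cexp (z * (ln t)%:C).

Lemma normc_tpow z t : normc (tpow z t) = expR (Re z * ln t).
Proof. by rewrite normc_cexp ReZr. Qed.

Lemma tpowD1 z t : 0 < t -> tpow (z + 1) t = tpow z t * t%:C.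
Proof. by move=> t0; rewrite /tpow mulrDl mul1r cexpD cexpR lnK. Qed.

Lemma tpowB1 z t : 0 < t -> tpow (z - 1) t = tpow z t / t%:C.
Proof.
move=> t0; have tn : t%:C != 0 by exact: neq0_Re.
by rewrite -[in RHS](subrK 1 z) tpowD1 // mulfK.
Qed.

Lemma cmeas_tpow z : cmeas (tpow z).
Proof. by rewrite /tpow; have m := @measurable_ln R; cmeas. Qed.

Lemma cder_tpow z t : 0 < t -> cder (tpow z) t (z * tpow (z - 1) t).
Proof.
move=> t0; have d := cder_cexp (cderZ z (cderR (is_derive1_ln t0))).
apply: cder_eq d _; rewrite tpowB1 // fmorphV /tpow; ring.
Qed.

Lemma Re_subr1 z : Re (z - 1) = Re z - 1.
Proof. by rewrite ReB Re1. Qed.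

Lemma rintble_tpow x c : 0 < x -> rintble `]0, c] (fun t => expR ((x - 1) * ln t)).
Proof.
move=> x0; have m0c : measurable (`]0, c] : set R) by exact: measurable_itv.
have sub : `]0, c] `<=` (`]0, +oo[ : set R) by move=> t /=; rewrite !in_itv /= => /andP[->].
have i := rintbleS (measurable_itv _) m0c sub (rintble_Gamma x0).
apply: (rintble_le m0c (measurable_exp_ln (x - 1)) (rintbleZ (expR c) m0c i)) => t /=.
rewrite in_itv /= => /andP[t0 tc]; rewrite ger0_norm ?expR_ge0 // mulrCA -[leLHS]mulr1.
by rewrite ler_wpM2l ?expR_ge0 // -expRD -expR0 ler_expR subr_ge0.
Qed.

Definition beta_integrand z c m t : R[i] := tpow (z - 1) t * ((1 - t / c) ^+ m)%:C.

Lemma cmeas_beta_integrand z c m : cmeas (beta_integrand z c m).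
Proof.
rewrite /beta_integrand; apply: cmeasM (cmeas_tpow _) _; apply: cmeasR; apply: measurable_funX.
by apply: measurable_funB => //; exact: measurable_funM.
Qed.

Lemma beta_weight_le1 c m t : 0 < t <= c -> 0 <= (1 - t / c) ^+ m <= 1.
Proof.
move=> /andP[t0 tc]; have c0 : 0 < c by exact: lt_le_trans tc.
have h0 : 0 <= 1 - t / c by rewrite subr_ge0 ler_pdivrMr // mul1r.
by rewrite exprn_ge0 // exprn_ile1 // lerBlDr lerDl divr_ge0 // ltW.
Qed.

Lemma cintble_beta_integrand z c m : 0 < Re z -> cintble `]0, c] (beta_integrand z c m).
Proof.
move=> z0; apply: (cintble_le (measurable_itv _) (cmeas_beta_integrand z c m) (rintble_tpow c z0)) => t tin.
have tc : 0 < t <= c by move: tin; rewrite /= in_itv.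
have /andP[h0 h1] := beta_weight_le1 m tc.
rewrite /beta_integrand normcM normc_tpow Re_subr1 normcR ger0_norm // ler_piMr ?expR_ge0 //.
Qed.

Lemma cvg_exp_ln0 x c : 0 < x -> 0 < c -> expR (x * ln (c / n.+2%:R)) @[n --> \oo] --> (0 : R).
Proof.
move=> x0 c0; apply/cvgrPdist_le => e e0; near=> n.
rewrite sub0r normrN ger0_norm ?expR_ge0 //.
have h : c / expR (ln e / x) <= n%:R by near: n; exact: nbhs_infty_ger.
have n0 : 0 < n.+2%:R :> R by rewrite ltr0n.
have h2 : c / n.+2%:R <= expR (ln e / x).
  rewrite ler_pdivrMr // mulrC -ler_pdivrMr ?expR_gt0 //; apply: (le_trans h).
  by rewrite ler_nat leqW // leqW.
rewrite -[leRHS]lnK ?posrE // ler_expR mulrC -ler_pdivlMr //.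
by rewrite -[leRHS]expRK ler_ln ?posrE ?expR_gt0 ?divr_gt0.
Unshelve. all: by end_near. Qed.

Lemma cint_tpow z c : 0 < Re z -> 0 < c -> cintegral `]0, c] (tpow (z - 1)) = tpow z c / z.
Proof.
move=> z0 c0; have nz := neq0_Re z0.
have e : cintegral `]0, c] (tpow (z - 1)) = cintegral `]0, c] (beta_integrand z c 0).
  by apply: cint_eq => t _; rewrite /beta_integrand expr0 mulr1.
have ib : cintble `]0, c] (tpow (z - 1)).
  apply: (cintble_eq (measurable_itv _) _ (cintble_beta_integrand c 0 z0)) => t _.
  by rewrite /beta_integrand expr0 mulr1.
rewrite (@cint_ftc _ _ _ (fun t => tpow z t / z) (fun n => c / n.+2%:R) (fun=> c) 0 (tpow z c / z)) ?subr0 //.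
- by move=> n; rewrite ltr_pdivrMr ?ltr0n // ltr_pMr // ltr1n.
- move=> n t /andP[h1 h2]; rewrite /= in_itv /= h2 andbT; apply: lt_le_trans h1.
  by rewrite divr_gt0 ?ltr0n.
- move=> t /=; rewrite in_itv /= => /andP[t0 tc].
  exists (Num.bound (c / t)) => // n /= hn; rewrite tc andbT ler_pdivrMr ?ltr0n // mulrC -ler_pdivrMr //.
  have := archi_boundP (divr_ge0 (ltW c0) (ltW t0)) => /ltW h; apply: (le_trans h).
  by rewrite ler_nat leqW // leqW.
- move=> t /=; rewrite in_itv /= => /andP[t0 _].
  apply: cder_eq (cderM (cder_tpow z t0) (cder_cst t z^-1)) _.
  by rewrite mulr0 addr0 mulrAC divff // mul1r.
- by move=> t /=; rewrite in_itv /= => /andP[t0 _]; eexists; exact: cder_tpow.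
- exact: cmeas_tpow.
- rewrite -(mul0r z^-1); apply: ccvgM; last exact: ccvg_cst.
  apply: (ccvg_bound _ (cvg_exp_ln0 z0 c0)); apply: nearW => n.
  by rewrite subr0 normc_tpow.
- exact: ccvg_cst.
Qed.

Fixpoint rising z n : R[i] := if n is m.+1 then rising z m * (z + m%:R) else 1.

Lemma rising_shift z n : z * rising (z + 1) n = rising z n.+1.
Proof.
elim: n => [|n IH]; first by rewrite /= mul1r mulr1 addr0.
by rewrite [rising _ _]/= mulrA IH /= -(natr1 n); ring.
Qed.

Lemma rising_neq0 z n : 0 < Re z -> rising z n != 0.
Proof.
move=> z0; elim: n => [|n IH] /=; first exact: oner_neq0.
by rewrite mulf_neq0 // neq0_Re // ReD Re_nat ltr_pwDl.
Qed.

(** Induction on [m] over all [z]: splitting off one factor [1 - t / c] expresses the integral at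
    [z] by those at [z] and [z + 1] with exponent [m]. *)
Lemma beta_integral z c m : 0 < Re z -> 0 < c ->
  cintegral `]0, c] (beta_integrand z c m) = tpow z c * m`!%:R / rising z m.+1.
Proof.
move=> z0 c0; have cn : c%:C != 0 by exact: neq0_Re.
elim: m z z0 => [|m IH] z z0.
  rewrite /= mul1r addr0 mulr1 -cint_tpow //; apply: cint_eq => t _.
  by rewrite /beta_integrand expr0 mulr1.
have z1 : 0 < Re (z + 1) by rewrite ReD Re1 addr_gt0.
have i1 := cintble_beta_integrand c m z0; have i2 := cintble_beta_integrand c m z1.
transitivity (cintegral `]0, c] (fun t => beta_integrand z c m t - c%:C^-1 * beta_integrand (z + 1) c m t)).
  apply: cint_eq => t /=; rewrite in_itv /= => /andP[t0 _].
  rewrite /beta_integrand addrK -[in tpow z t](subrK 1 z) tpowD1 // exprS.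
  have -> : ((1 - t / c) * (1 - t / c) ^+ m)%:C = (1 - t%:C / c%:C) * ((1 - t / c) ^+ m)%:C :> R[i].
    by rewrite rmorphM rmorphB rmorph1 rmorphM fmorphV.
  by move: (tpow _ _) (_ %:C) => A B; ring.
rewrite (cintB (measurable_itv _) i1 (cintbleZ _ (measurable_itv _) i2)) (cintZ _ (measurable_itv _) i2).
rewrite IH // IH // tpowD1 // -(rising_shift z m.+1) -(rising_shift z m).
have nz := neq0_Re z0; have r0 := rising_neq0 m z1.
have n0 : z + 1 + m%:R != 0 by apply: neq0_Re; rewrite ReD Re_nat ltr_pwDl.
rewrite [rising (z + 1) m.+1]/= factS natrM -(natr1 m).
by move: (rising _ _) (tpow _ _) r0 => A B A0; field; rewrite n0 A0 nz cn.
Qed.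

Lemma cint_indic (D E : set R) (f : R -> R[i]) : E `<=` D ->
  cintegral D (fun t => f t * (\1_E t)%:C) = cintegral E f.
Proof.
move=> ED; have H (h : R -> R) : \int[mu]_(t in D) (h t * \1_E t) = \int[mu]_(t in E) h t.
  rewrite [RHS]Rintegral_mkcond Rintegral_mkcond; apply: eq_Rintegral => t _; rewrite /patch indicE.
  have [tE|_] := boolP (t \in E); last by rewrite mulr0; case: ifP.
  by rewrite (mem_set (ED _ (set_mem tE))) mulr1.
by apply: eqC; rewrite /= -H; apply: eq_Rintegral => t _; rewrite ?ReZr ?ImZr.
Qed.

Lemma cGammaE z : cGamma z = cintegral `]0, +oo[ (fun t => tpow (z - 1) t * cexp (- t%:C)).
Proof. by apply: cint_eq => t /gt0_itv t0; rewrite cpowR. Qed.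

Lemma onem_divX_le n t : 0 < t <= n.+1%:R -> (1 - t / n.+1%:R) ^+ n.+1 <= expR (- t).
Proof.
move=> /andP[t0 tn]; have n0 : 0 < n.+1%:R :> R by rewrite ltr0n.
have -> : - t = n.+1%:R * - (t / n.+1%:R) by have := lt0r_neq0 n0; move: (n.+1%:R) => N N0; field.
rewrite expRM_natl lerXn2r ?nnegrE ?expR_ge0 //; last exact: expR_ge1Dx.
by rewrite subr_ge0 ler_pdivrMr // mul1r.
Qed.

(** The weight [expR (- t)] is replaced by [(1 - t / n) ^ n] on []0, n]], which lies below it and
    converges to it; the resulting beta integrals are explicit. *)
Lemma ccvg_Euler z : 0 < Re z ->
  ccvg (fun n => tpow z n.+1%:R * n.+1`!%:R / rising z n.+2) (cGamma z).
Proof.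
move=> z0; have m0y : measurable (`]0, +oo[ : set R) by exact: measurable_itv.
pose F n t := beta_integrand z n.+1%:R n.+1 t * (\1_(`]0, n.+1%:R] : set R) t)%:C.
have sub n : `]0, n.+1%:R] `<=` (`]0, +oo[ : set R) by move=> t /=; rewrite !in_itv /= => /andP[->].
have eF n : cintegral `]0, +oo[ (F n) = tpow z n.+1%:R * n.+1`!%:R / rising z n.+2.
  by rewrite cint_indic // beta_integral ?ltr0n.
have mF n : cmeas (F n).
  apply: cmeasM (cmeas_beta_integrand _ _ _) _; apply: cmeasR; exact/measurable_indicP.
have mG : cmeas (fun t => tpow (z - 1) t * cexp (- t%:C)) by have m := cmeas_tpow (z - 1); cmeas.
have cF t : `]0, +oo[ t -> ccvg (F^~ t) (tpow (z - 1) t * cexp (- t%:C)).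
  move=> /gt0_itv t0; apply: ccvg_eq (ccvgM (ccvg_cst (tpow (z - 1) t)) (ccvg_1Dexp (- t%:C))).
  exists (Num.bound t) => // n /= tn; rewrite /F indicE mem_set ?mulr1.
    by rewrite /beta_integrand rmorphXn rmorphB rmorph1 rmorphM fmorphV rmorph_nat mulNr.
  rewrite /= in_itv /= t0 /=; apply: ltW; apply: (lt_le_trans (archi_boundP (ltW t0))).
  by rewrite ler_nat leqW.
have bF n t : `]0, +oo[ t -> normc (F n t) <= expR ((Re z - 1) * ln t) * expR (- t).
  move=> /gt0_itv t0; rewrite /F indicE.
  have [tn|_] := boolP (t \in _); last by rewrite mulr0 normc0 mulr_ge0 ?expR_ge0.
  have tn' : 0 < t <= n.+1%:R by move: tn; rewrite inE /= in_itv.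
  have /andP[h0 _] := beta_weight_le1 n.+1 tn'.
  rewrite mulr1 /beta_integrand normcM normc_tpow Re_subr1 normcR ger0_norm // ler_wpM2l ?expR_ge0 //.
  exact: onem_divX_le.
have [_ c] := cint_dct m0y mF mG cF (rintble_Gamma z0) bF.
by rewrite cGammaE; apply: ccvg_eq c; apply: nearW.
Qed.

End GammaEuler.

(** * Binet's formula up to a constant *)

Section StirlingFormula.
Variable R : realType.
Implicit Types (z w : R[i]) (x y t c : R) (m n : nat).
Local Open Scope classical_set_scope.

Local Notation L := (lap (@binet_kernel R)).

Definition stirling_fun z : R[i] := cexp ((z - 2^-1) * clog z - z + L z).

Lemma stirling_fun_neq0 z : stirling_fun z != 0.
Proof. exact: cexp_neq0. Qed.

Lemma stirling_funD1 z : 0 < Re z -> stirling_fun (z + 1) = z * stirling_fun z.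
Proof.
move=> z0; have z1 : 0 < Re (z + 1) by rewrite ReD Re1 addr_gt0.
have nz := neq0_Re z0.
have d := lap_binet_diff z0; rewrite -(clogE z0) -(clogE z1) in d.
rewrite -{2}(cexp_clog nz) -cexpD; congr cexp.
have {d} -> : L (z + 1) = L z - ((z + 2^-1) * (clog (z + 1) - clog z) - 1) by rewrite -d; move: (L z) (L (z + 1)) => a b; ring.
by move: (clog z) (clog (z + 1)) (L z) => a b l; field.
Qed.

Lemma stirling_fun_rising z n : 0 < Re z -> stirling_fun (z + n%:R) = rising z n * stirling_fun z.
Proof.
move=> z0; elim: n => [|n IH]; first by rewrite addr0 mul1r.
rewrite -(natr1 n) addrA stirling_funD1; last by rewrite ReD Re_nat ltr_pwDl.
by rewrite IH /= mulrA [(z + _) * _]mulrC.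
Qed.

Lemma rising1 n : rising (1 : R[i]) n = n`!%:R.
Proof. by elim: n => [|n IH] //=; rewrite IH nat1r -natrM mulnC factS. Qed.

Lemma ccvg_clog1 z : 0 < Re z -> ccvg (fun n => clog (1 + z / n.+1%:R)) 0.
Proof.
move=> z0; have rN n : z / n.+1%:R = z * (n.+1%:R^-1)%:C by rewrite natRC fmorphV.
have r1 : Re (1 + z / n.+1%:R) @[n --> \oo] --> (1 : R).
  under eq_fun do rewrite ReD Re1 rN ReZr.
  have h : 1 + Re z / n.+1%:R @[n --> \oo] --> (1 + 0 : R) by apply: cvgD; [exact: cvg_cst|exact: cvg_invn].
  by rewrite addr0 in h.
have i1 : Im (1 + z / n.+1%:R) @[n --> \oo] --> (0 : R).
  under eq_fun do rewrite ImD Im1 rN ImZr add0r.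
  exact: cvg_invn.
have c : ccvg (fun n => clogh (1 + z / n.+1%:R)) 0.
  split; rewrite /clogh /=.
    rewrite -(mul0r (2^-1 : R)); apply: cvgM; last exact: cvg_cst.
    rewrite -(@ln1 R); apply: continuous_cvg; first exact: continuous_ln.
    under eq_fun do rewrite !expr2.
    have h := cvgD (cvgM r1 r1) (cvgM i1 i1); rewrite mulr1 mulr0 addr0 in h; exact: h.
  rewrite -(@atan0 R); apply: continuous_cvg; first exact: continuous_atan.
  rewrite -(mul0r (1^-1)); apply: cvgM => //; apply: cvgV => //; exact: oner_neq0.
apply: ccvg_eq c; apply: nearW => n; rewrite clogE //.
by rewrite ReD Re1 rN ReZr addr_gt0 // mulr_gt0.
Qed.

Lemma Re_1Ddiv z n : 0 < Re z -> 0 < Re (1 + z / n.+1%:R).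
Proof. by move=> z0; rewrite ReD Re1 natRC -fmorphV ReZr addr_gt0 // mulr_gt0. Qed.

Lemma stirling_fun_shift z n : 0 < Re z ->
  stirling_fun (z + n.+1%:R) = cexp ((z - 2^-1) * clog (1 + z / n.+1%:R)) * (1 + z / n.+1%:R) ^+ n.+1 * cexp (- z) *
    cexp (L (z + n.+1%:R) - L n.+1%:R) * (stirling_fun n.+1%:R * tpow z n.+1%:R).
Proof.
move=> z0; have N0 : 0 < n.+1%:R :> R by rewrite ltr0n.
have w0 := neq0_Re (Re_1Ddiv n z0).
have NC : n.+1%:R != 0 :> R[i] by rewrite pnatr_eq0.
have e1 : clog n.+1%:R = (ln n.+1%:R)%:C :> R[i] by rewrite natRC clogR.
have e2 : clog (z + n.+1%:R) = (ln n.+1%:R)%:C + clog (1 + z / n.+1%:R).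
  by rewrite -(clogZ N0 w0) -natRC; congr clog; move: (n.+1%:R : R[i]) NC => N NC; field.
rewrite -[X in X ^+ n.+1](cexp_clog w0) -cexpMn /stirling_fun /tpow e1 e2 -!cexpD; congr cexp.
ring.
Qed.

(** The growth condition [f (z + n) ~ f n * n ^ z], which together with the recursion singles out
    Gamma up to a constant factor. *)
Lemma ccvg_stirling_fun_shift z : 0 < Re z ->
  ccvg (fun n => stirling_fun (z + n.+1%:R) / (stirling_fun n.+1%:R * tpow z n.+1%:R)) 1.
Proof.
move=> z0.
have c1 : ccvg (fun n => cexp ((z - 2^-1) * clog (1 + z / n.+1%:R))) 1.
  by have := ccvg_cexp (ccvgM (ccvg_cst (z - 2^-1)) (ccvg_clog1 z0)); rewrite mulr0 cexp0.
have c3 : ccvg (fun n => cexp (L (z + n.+1%:R) - L n.+1%:R)) 1.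
  have l1 : ccvg (fun n => L (z + n.+1%:R)) 0.
    by apply: ccvg_lap_binet => n; rewrite ReD Re_nat lerDr ltW.
  have l2 : ccvg (fun n => L n.+1%:R) 0 by apply: ccvg_lap_binet => n; rewrite Re_nat.
  by have := ccvg_cexp (ccvgB l1 l2); rewrite subr0 cexp0.
have := ccvgM (ccvgM (ccvgM c1 (ccvg_1Dexp z)) (ccvg_cst (cexp (- z)))) c3.
rewrite mul1r mulr1 -cexpD subrr cexp0; apply: ccvg_eq; apply: nearW => n.
rewrite (stirling_fun_shift n z0); apply: esym; apply: mulfK.
exact: mulf_neq0 (stirling_fun_neq0 _) (cexp_neq0 _).
Qed.

(** The recursion rewrites the rising factorial and the factorial in Euler's quotient through values
    of [stirling_fun]; the growth condition then gives its limit. *)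
Lemma cGamma_stirling_fun z : 0 < Re z -> cGamma z = stirling_fun z / stirling_fun 1.
Proof.
move=> z0; apply: (ccvg_unique (ccvg_Euler z0)).
have := ccvg_stirling_fun_shift z0 => /(ccvgV (oner_neq0 _)) c1.
(* Euler's quotient has one more factor [z + n.+1%:R] below and [n.+1%:R] above than the recursion
   accounts for; their ratio is this sequence. *)
have c2 : ccvg (fun n => (1 + z / n.+1%:R)^-1) 1^-1.
  apply: ccvgV; first exact: oner_neq0.
  rewrite -[X in ccvg _ X]addr0; apply: ccvgD; [exact: ccvg_cst|exact: ccvg_invZ].
have := ccvgM (ccvg_cst (stirling_fun z / stirling_fun 1)) (ccvgM c2 c1).
rewrite invr1 !mulr1; apply: ccvg_eq; apply: nearW => n.
have s1 := stirling_fun_neq0 1; have sz := stirling_fun_neq0 z.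
have NC : n.+1%:R != 0 :> R[i] by rewrite pnatr_eq0.
have zN : z + n.+1%:R != 0 by apply: neq0_Re; rewrite ReD Re_nat ltr_pwDl.
have r0 := rising_neq0 n.+1 z0.
have e1 : stirling_fun n.+1%:R = n`!%:R * stirling_fun 1.
  by rewrite -rising1 -stirling_fun_rising ?Re1 // nat1r.
have t0 : tpow z n.+1%:R != 0 by exact: cexp_neq0.
have f0 : n`!%:R != 0 :> R[i] by rewrite pnatr_eq0 -lt0n fact_gt0.
have e2 : 1 + z / n.+1%:R = (z + n.+1%:R) / n.+1%:R by move: (n.+1%:R : R[i]) NC => N NC; field.
rewrite e2 stirling_fun_rising // e1 [rising z n.+2]/= -/(rising z n.+1) factS natrM.
move: (rising z n.+1) (tpow _ _) (stirling_fun 1) (stirling_fun z) (n`!%:R) r0 t0 s1 sz f0.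
move: (n.+1%:R) NC zN => N NC zN r T s1 sz F r0 t0 s10 sz0 f0.
by field; rewrite ?zN ?NC ?r0 ?t0 ?s10 ?sz0 ?f0.
Qed.

End StirlingFormula.

(** * Gamma(3/2) from the Gaussian integral *)

Section StirlingConstant.
Variable R : realType.
Implicit Types (z w : R[i]) (x y t c : R) (m n : nat).
Local Open Scope classical_set_scope.

Lemma sqrt_expR_ln t : 0 < t -> Num.sqrt t = expR (2^-1 * ln t).
Proof.
move=> t0; have e : t = expR (2^-1 * ln t) ^+ 2.
  by rewrite -expRM_natl mulrA mulfV ?pnatr_eq0 // mul1r lnK.
by rewrite {1}e sqrtr_sqr ger0_norm // expR_ge0.
Qed.

Let G t : R := Num.sqrt t * expR (- t).
Let H u : R := 2 * u ^+ 2 * gauss_fun u.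

Let cG : continuous G.
Proof.
move=> t; apply: cvgM; first exact: sqrt_continuous.
apply: (@continuous_comp _ _ _ (fun t => - t) expR); last exact: continuous_expR.
exact: continuousN.
Qed.

Let G0 t : 0 <= G t. Proof. by rewrite mulr_ge0 ?sqrtr_ge0 ?expR_ge0. Qed.
Let H0 u : 0 <= H u. Proof. by rewrite mulr_ge0 ?expR_ge0 // mulr_ge0 ?sqr_ge0. Qed.

Let dgauss (u : R) : is_derive u 1 (fun u : R => gauss_fun u) (- (2 * u) * gauss_fun u).
Proof.
have d := rderN (rder_exprn u 2).
by apply: rder_eq (rder_comp (is_derive_expR ((fun u => - u ^+ 2) u)) d) _; rewrite /gauss_fun /= expr1; ring.
Qed.

Let cgauss : continuous (fun u : R => gauss_fun u).
Proof. by move=> u; exact: rder_continuous (dgauss u). Qed.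

Let cH : continuous H.
Proof.
move=> u; apply: cvgM; last exact: cgauss.
apply: cvgM; first exact: cvg_cst.
by rewrite expr2; under eq_fun do rewrite expr2; apply: cvgM; exact: cvg_id.
Qed.

Let igauss : rintble `]0, +oo[ (fun u : R => gauss_fun u).
Proof.
exact: (rintbleS measurableT (measurable_itv _) (@subsetT _ _) (@integrableT_gauss R)).
Qed.

Let iH : rintble `]0, +oo[ H.
Proof.
apply: (rintble_le (measurable_itv _) (continuous_measurable_fun cH) (rintble_onesqr_half 6)) => u _.
rewrite ger0_norm // ler_pdivlMr ?onesqr_gt0 // /H /gauss_fun expRN mulrAC ler_pdivrMr ?expR_gt0 //.
have u2 := sqr_ge0 u; have h1 := expr_le_fact_expR 1 u2; have h2 := expr_le_fact_expR 2 u2.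
move: (u ^+ 2) (expR _) u2 h1 h2 => v E v0; rewrite expr1.
have -> : 1`!%:R = 1 :> R by []. have -> : 2`!%:R = 2 :> R by [].
rewrite expr2; nra.
Qed.

Let int_gauss : \int[mu]_(u in `]0, +oo[) gauss_fun (u : R) = Num.sqrt pi / 2.
Proof.
rewrite /Rintegral integral_itv_obnd_cbnd ?integral0y_gauss //.
by apply/measurable_EFinP; apply: measurable_funTS; exact: continuous_measurable_fun.
Qed.

Let int_H : \int[mu]_(u in `]0, +oo[) H u = Num.sqrt pi / 2.
Proof.
have ud (u : R) : is_derive u 1 (fun u : R => u * gauss_fun u) (gauss_fun u - H u).
  by apply: rder_eq (rderM (rder_id u) (dgauss u)) _; rewrite /H; ring.
have : \int[mu]_(u in `]0, +oo[) (gauss_fun (u : R) - H u) = 0 - 0.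
  apply: (@rint_ftc0y _ _ (fun u : R => u * gauss_fun u)) => //.
  - by move=> u; apply: cvgB; [exact: cgauss|exact: cH].
  - exact: rintbleB.
  - by rewrite mul0r.
  - apply: (@norm_cvg0 _ R).
    apply: (squeeze_cvgr _ (cvg_cst 0) (cvg_invn 1)); apply: nearW => n.
    have n0 : 0 < n.+1%:R :> R by rewrite ltr0n.
    rewrite normr_ge0 ger0_norm ?mulr_ge0 ?expR_ge0 //= ler_pdivlMr // mulrAC.
    rewrite /gauss_fun expRN ler_pdivrMr ?expR_gt0 // mul1r.
    have := expr_le_fact_expR 1 (sqr_ge0 (n.+1%:R : R)).
    by rewrite expr1 [1`!](_ : _ = 1%N) // mul1r expr2.
by rewrite rintB // int_gauss subr0 => /eqP; rewrite subr_eq0 => /eqP <-.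
Qed.

(** The change of variable [t = u ^+ 2] on compact intervals; [int_G] passes to the limit along the
    squares. *)
Let substitution n : (\int[mu]_(x in `[0%R, (n ^ 2)%:R]) (G x)%:E = \int[mu]_(x in `[0%R, n%:R]) (H x)%:E)%E.
Proof.
pose F (u : R) := u ^+ 2.
have dF (u : R) : is_derive u 1 F (2 * u) by apply: rder_eq (rder_exprn u 2) _; rewrite expr1.
have F' : F^`() = (fun u => 2 * u) by apply/funext => u; rewrite derive1E (@derive_val _ _ _ _ _ _ _ (dF u)).
have cF' : continuous F^`() by rewrite F' => u; apply: cvgM; [exact: cvg_cst|exact: cvg_id].
have cF : continuous F by move=> u; exact: rder_continuous (dF u).
have e0 : F 0 = 0 by rewrite /F expr0n.
have en : F n%:R = (n ^ 2)%:R by rewrite /F natrX.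
rewrite -{1}e0 -en (@integration_by_substitution_increasing _ F G) //.
- apply: eq_integral => u; rewrite inE /= in_itv /= => /andP[u0 _]; congr EFin.
  rewrite F'; transitivity (G (u ^+ 2) * (2 * u)); first by [].
  by rewrite /G /H sqrtr_sqr ger0_norm // /gauss_fun; ring.
- by move=> u v; rewrite !in_itv /= => /andP[u0 _] _ uv; rewrite /F ltrXn2r.
- by apply/cvg_ex; exists (F^`() 0); apply: cvg_at_right_filter; exact: cF'.
- by apply/cvg_ex; exists (F^`() n%:R); apply: cvg_at_left_filter; exact: cF'.
- split.
  + by move=> u _; exact: (@ex_derive _ _ _ _ _ _ _ (dF u)).
  + by apply: cvg_at_right_filter; exact: cF.
  + by apply: cvg_at_left_filter; exact: cF.
- exact: continuous_subspaceT.
Qed.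

Let int_G : \int[mu]_(t in `]0, +oo[) G t = Num.sqrt pi / 2.
Proof.
rewrite -int_H /Rintegral; congr fine.
have mG := continuous_measurable_fun cG; have mH := continuous_measurable_fun cH.
rewrite !integral_itv_obnd_cbnd; try by apply/measurable_EFinP; exact: measurable_funTS.
have c1 := @ge0_cvgn_integral R mu _ G0 mG; have c2 := @ge0_cvgn_integral R mu _ H0 mH.
have sq : (n ^ 2)%N @[n --> \oo] --> \oo.
  by apply/cvgnyPge => A; exists A => // n /= An; apply: (leq_trans An); case: (n) => // k; rewrite -mulnn leq_pmull.
have c3 := cvg_comp _ (fun k : nat => \int[mu]_(x in `[0%R, k%:R]) (G x)%:E)%E sq c1.
apply: (cvg_unique (@ereal_hausdorff R) c3).
by move: c2; under eq_fun do rewrite -substitution.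
Qed.

(* At 3/2 rather than at 1/2, the integrand extends continuously to 0. *)
Lemma cGamma_3half : cGamma (2^-1 + 1 : R[i]) = (Num.sqrt pi / 2)%:C.
Proof.
rewrite cGammaE -int_G -cintR; apply: cint_eq => t /gt0_itv t0.
have e : cexp (- t%:C) = (expR (- t))%:C :> R[i] by rewrite -rmorphN cexpR.
rewrite addrK e /tpow /G sqrt_expR_ln //.
have -> : 2^-1 * (ln t)%:C = (2^-1 * ln t)%:C :> R[i] by rewrite rmorphM fmorphV rmorph_nat.
by rewrite cexpR -rmorphM.
Qed.

End StirlingConstant.

(** * The value of the constant and the limit in [K] *)

Section ScaledGamma.
Variable R : realType.
Implicit Types (z w : R[i]) (x y t c : R) (m n : nat).
Local Open Scope classical_set_scope.

Local Notation L := (lap (@binet_kernel R)).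
Local Notation S := (@stirling_fun R).

Let half_gt0 : 0 < Re (2^-1 : R[i]).
Proof. by rewrite (_ : 2^-1 = (2^-1 : R)%:C) ?ReC ?invr_gt0 // fmorphV rmorph_nat. Qed.

(** The left side does not depend on [n]: a step multiplies the quotient by
    [N (N + 1/2) / (2 N (2 N + 1)) = 1/4]. At [n = 0] it is evaluated by
    [stirling_fun 2 = stirling_fun 1]. *)
Lemma stirling_fun_duplication n :
  4 ^+ n.+1 * (S n.+1%:R * S (2^-1 + n.+1%:R) / S (n.+1.*2)%:R) = 4 * S (2^-1 + 1).
Proof.
have nz k : 0 < Re (k.+1%:R : R[i]) by rewrite Re_nat.
elim: n => [|n IH].
  have e : S 2%:R = S 1 by rewrite -(nat1r 1) stirling_funD1 ?Re1 ?mul1r.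
  by rewrite e expr1 [S 1 * _]mulrC mulfK // stirling_fun_neq0.
rewrite -IH exprS doubleS -(natr1 n.+1) -(natr1 (n.+1.*2.+1)) -(natr1 n.+1.*2) addrA.
have e2 : n.+1.*2%:R = 2%:R * n.+1%:R :> R[i] by rewrite -natrM mul2n.
have m2 : 0 < Re (n.+1.*2%:R : R[i]) by rewrite Re_nat ltr0n double_gt0.
have m21 : 0 < Re (n.+1.*2%:R + 1 : R[i]) by rewrite ReD Re1 addr_gt0.
have hn : 0 < Re (2^-1 + n.+1%:R : R[i]) by rewrite ReD addr_gt0.
rewrite !stirling_funD1 //.
have s0 := stirling_fun_neq0 (n.+1.*2%:R : R[i]).
have a0 := neq0_Re m2; have a1 := neq0_Re m21; rewrite e2 in a0 a1 s0 *.
move: (S (2%:R * n.+1%:R)) (S n.+1%:R) (S (2^-1 + n.+1%:R)) (4 ^+ n.+1) s0 => A B C D A0.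
move: (n.+1%:R : R[i]) a0 a1 => N a0 a1; field.
by rewrite A0 a1 andbT; move: a0; rewrite mulf_eq0 negb_or => /andP[].
Qed.

(** All powers of [n] and exponentials cancel identically in the explicit formula; what remains is
    the root of 2 times [exp (2 L(n) - L(2n))], and [L] vanishes at infinity. *)
Lemma ccvg_stirling_fun_double :
  ccvg (fun n => 4 ^+ n.+1 * (S n.+1%:R ^+ 2 * tpow 2^-1 n.+1%:R / S (n.+1.*2)%:R)) (Num.sqrt 2)%:C.
Proof.
have l1 : ccvg (fun n => L n.+1%:R) 0 by apply: ccvg_lap_binet => n; rewrite Re_nat.
have l2 : ccvg (fun n => L n.+1.*2%:R) 0.
  by apply: ccvg_lap_binet => n; rewrite Re_nat ler_nat -addnn leq_addr.
have e2 : (Num.sqrt 2)%:C = cexp (2^-1 * (ln 2)%:C) :> R[i].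
  by rewrite sqrt_expR_ln // -cexpR rmorphM fmorphV rmorph_nat.
have := ccvg_cexp (ccvgD (ccvg_cst (2^-1 * (ln 2)%:C)) (ccvgB (ccvgM (ccvg_cst 2%:R) l1) l2)).
rewrite mulr0 subrr addr0 e2; apply: ccvg_eq; apply: nearW => n.
have N0 : 0 < n.+1%:R :> R by rewrite ltr0n.
have c1 : clog n.+1%:R = (ln n.+1%:R)%:C :> R[i] by rewrite natRC clogR.
have c2 : clog n.+1.*2%:R = (ln 2)%:C + (ln n.+1%:R)%:C :> R[i].
  by rewrite natRC -mul2n natrM clogR ?mulr_gt0 // lnM ?posrE // rmorphD.
have c4 : 4 ^+ n.+1 = cexp (n.+1%:R * (2%:R * (ln 2)%:C)) :> R[i].
  rewrite cexpMn; congr (_ ^+ _); rewrite cexpMn cexpR lnK ?posrE // rmorph_nat.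
  by rewrite expr2 -natrM.
have d2 : n.+1.*2%:R = 2%:R * n.+1%:R :> R[i] by rewrite -natrM mul2n.
rewrite /stirling_fun c1 c2 c4 /tpow expr2 -cexpN -!cexpD; congr cexp.
rewrite d2; move: (L n.+1%:R) (L (2%:R * n.+1%:R)) (ln 2)%:C (ln n.+1%:R)%:C => a b l2' lN.
by move: (n.+1%:R : R[i]) => N; field.
Qed.

(* The duplication formula holds exactly and asymptotically; comparing both
   expresses [stirling_fun (3/2)], and Gamma(3/2) is a Gaussian integral. *)
Lemma stirling_fun1 : S 1 = (Num.sqrt (2 * pi))^-1%:C.
Proof.
have c := ccvgM (ccvg_stirling_fun_shift half_gt0) ccvg_stirling_fun_double.
have c' : ccvg (fun=> 4 * S (2^-1 + 1)) (1 * (Num.sqrt 2)%:C).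
  apply: ccvg_eq c; apply: nearW => n; rewrite -(stirling_fun_duplication n).
  have t0 : tpow (2^-1 : R[i]) n.+1%:R != 0 := cexp_neq0 _.
  have s1 := stirling_fun_neq0 (n.+1%:R : R[i]); have s2 := stirling_fun_neq0 (n.+1.*2%:R : R[i]).
  move: (S n.+1%:R) (S n.+1.*2%:R) (tpow _ _) (S (2^-1 + _)) (4 ^+ n.+1) s1 s2 t0 => a b t d f a0 b0 t0.
  by field; rewrite a0 b0 t0.
have e1 := ccvg_unique c' (ccvg_cst _).
have z0 : 0 < Re (2^-1 + 1 : R[i]) by rewrite ReD Re1 addr_gt0.
have s1 := stirling_fun_neq0 (1 : R[i]).
have e2 : S (2^-1 + 1) = (Num.sqrt pi / 2)%:C * S 1.
  by rewrite -cGamma_3half (cGamma_stirling_fun z0) divfK.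
have p0 : 0 < Num.sqrt pi :> R by rewrite sqrtr_gt0 pi_gt0.
have q0 : 0 < Num.sqrt 2 :> R by rewrite sqrtr_gt0.
have q2 : Num.sqrt 2 ^+ 2 = 2 :> R by rewrite sqr_sqrtr.
have e3 : (Num.sqrt pi / 2)%:C = (Num.sqrt pi)%:C / 2%:R :> R[i] by rewrite rmorphM fmorphV rmorph_nat.
have e4 : ((Num.sqrt 2 * Num.sqrt pi)^-1)%:C = ((Num.sqrt 2)%:C * (Num.sqrt pi)%:C)^-1 :> R[i].
  by rewrite fmorphV rmorphM.
rewrite sqrtrM // e4.
have q2C : (Num.sqrt 2)%:C ^+ 2 = 2%:R :> R[i] by rewrite -rmorphXn q2 rmorph_nat.
have pC : (Num.sqrt pi)%:C != 0 :> R[i] by exact: neq0_Re.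
have qC : (Num.sqrt 2)%:C != 0 :> R[i] by exact: neq0_Re.
(* The comparison now reads [4 * (sqrt pi / 2) * S 1 = sqrt 2]. *)
move: e1; rewrite e2 e3 mul1r.
move: (Num.sqrt 2)%:C (Num.sqrt pi)%:C (S 1) q2C pC qC => q p s qq p1 q1 h.
have -> : s = q / (2%:R * p) by rewrite h; field; exact: p1.
by rewrite -qq; field; rewrite p1 q1.
Qed.

Lemma scaled_gammaE z : 0 < Re z -> scaled_gamma z = cexp (L z).
Proof.
move=> z0; have nz := neq0_Re z0.
have q0 : (Num.sqrt (2 * pi))%:C != 0 :> R[i].
  by apply: neq0_Re; rewrite ReC sqrtr_gt0 mulr_gt0 // pi_gt0.
have e : ((Num.sqrt (2 * pi))^-1)%:C^-1 = (Num.sqrt (2 * pi))%:C :> R[i] by rewrite fmorphV invrK.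
rewrite /scaled_gamma (cGamma_stirling_fun z0) stirling_fun1 e /stirling_fun /cpow !cexpD.
have c1 := cexp_neq0 ((z - 2^-1) * clog z); have c2 := cexp_neq0 (- z).
move: (cexp ((z - 2^-1) * clog z)) (cexp (- z)) (cexp (L z)) (Num.sqrt (2 * pi))%:C c1 c2 q0 => a b l q a0 b0 q0.
by field; rewrite a0 b0 q0.
Qed.

(** For fixed [z] and [N] the truncated inequality involves finitely many coefficients, each
    convergent in [K], and a right-hand factor independent of [K]. With [e = true] the two
    alternating signs cancel, which gives the expansion of the inverse. *)
Lemma binet_bound z (e : bool) N : (1 <= N)%N -> 0 < Re z ->
  normc (cexp ((-1) ^+ e * L z) - \sum_(n < N) ((-1) ^+ e) ^+ n * ((-1) ^+ n * stirling_coef R n)%:C / z ^+ n) <=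
  (`|stirling_coef R N| / normc z ^+ N + `|stirling_coef R N.+1| / normc z ^+ N.+1) * cscfac z.
Proof.
move=> N1 z0; pose M K n := mcoef (@trunc_kernel R K) n.
have cl : ccvg (fun K => cexp ((-1) ^+ e * lap (@trunc_kernel R K) z) - \sum_(n < N) ((-1) ^+ e) ^+ n * (M K n)%:C / z ^+ n)
    (cexp ((-1) ^+ e * L z) - \sum_(n < N) ((-1) ^+ e) ^+ n * ((-1) ^+ n * stirling_coef R n)%:C / z ^+ n).
  apply: ccvgB.
    by apply: ccvg_cexp; apply: ccvgM; [exact: ccvg_cst|exact: (cvg_lap_trunc_kernel z0).2].
  apply: ccvg_sum => n; apply: ccvgM; last exact: ccvg_cst.
  by apply: ccvgM; [exact: ccvg_cst|apply: ccvgR; exact: cvg_mcoef].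
have cM n : `|M K n| @[K --> \oo] --> `|stirling_coef R n|.
  have h := cvg_norm (@cvg_mcoef R n); rewrite normrM normrX normrN1 expr1n mul1r in h; exact: h.
have cr : (`|M K N| / normc z ^+ N + `|M K N.+1| / normc z ^+ N.+1) * cscfac z @[K --> \oo] -->
   (`|stirling_coef R N| / normc z ^+ N + `|stirling_coef R N.+1| / normc z ^+ N.+1) * cscfac z.
  apply: cvgM; last exact: cvg_cst.
  by apply: cvgD; apply: cvgM; [exact: cM|exact: cvg_cst|exact: cM|exact: cvg_cst].
apply: (ccvg_le cl cr) => K; exact: trunc_kernel_bound.
Qed.

End ScaledGamma.

Theorem theorem1p2 (R : realType) (N : nat) (z : R[i])
    (hN : (1 <= N)%N) (hz : 0 < complex.Re z) :
  let theta := carg z in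
  let bound :=
    (`|stirling_coef R N| / normc z ^+ N +
     `|stirling_coef R N.+1| / normc z ^+ N.+1) *
    (if pi / 4 < `|theta| then `|(sin (2 * theta))^-1| else 1) in
  normc (gamma_rem N z) <= bound /\ normc (inv_gamma_rem N z) <= bound.
Proof.
move=> theta bound; split.
  have := binet_bound false hN hz; rewrite expr0 mul1r -scaled_gammaE // /gamma_rem.
  under eq_bigr do rewrite expr1n mul1r rmorphM rmorphXn rmorphN1.
  by [].
have := binet_bound true hN hz; rewrite expr1 mulN1r cexpN -scaled_gammaE // /inv_gamma_rem.
under eq_bigr do rewrite rmorphM rmorphXn rmorphN1 mulrA -exprMn mulrNN mulr1 expr1n mul1r.
by [].
Qed.
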